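(* Every smooth plane cubic $C\subset\mathbb{P}^2$ (over $\mathbb{C}$) is a member of a pencil of plane cubics satisfying conditions (C1), (C2) and (C3). Moreover, a pencil of plane cubics satisfying (C1), (C2) and (C3) is unique up to projective transformations of $\mathbb{P}^2$ (that is, any two such pencils are mapped to one another by some element of $\mathrm{PGL}_3(\mathbb{C})$). Such a pencil has exactly four singular members, all of which are nodal cubics, and it is non-isotrivial.
   Context: We work over $\mathbb{C}$. A pencil of plane cubics is the linear system $|V|=\mathbb{P}(V)$ associated with a $2$-dimensional linear subspace $V\subset H^0(\mathbb{P}^2,\mathcal{O}_{\mathbb{P}^2}(3))$; its members are the cubic curves defined by nonzero elements of $V$, and its base points are the points common to all members. The conditions are: (C1) there is only one base point (set-theoretically); (C2) the general member is smooth; (C3) all members are irreducible (in particular reduced). A pencil whose general member is smooth is isotrivial if its smooth members are mutually isomorphic, and non-isotrivial otherwise. *)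

(* Defs.v *)
From mathcomp Require Import all_boot all_order all_algebra.
From mathcomp Require Export reals complex mpoly.

Set Implicit Arguments.
Unset Strict Implicit.
Unset Printing Implicit Defensive.

Import GRing.Theory.

Local Open Scope ring_scope.

(* A point of the projective plane is given by a nonzero row vector of
   homogeneous coordinates, and a member of a linear system by a nonzero form;
   two of them are the same projective object iff they span the same line,
   i.e. <[u]> = <[v]> as vector subspaces.  The varieties below are described
   by their points, whence the algebraically closed ground field. *)

Section PlaneCubics.
Variable K : numClosedFieldType.

(* H^0(P^2, O(3)) *)
Definition cubic_form := dhomog 3 K 3.

Implicit Types (f g : cubic_form) (u v w : 'rV[K]_3) (V W : {vspace cubic_form}).

Definition on_curve f v : Prop := v != 0 /\ f.@[v 0] = 0.

Definition singular_at f v : Prop :=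
  on_curve f v /\ forall i : 'I_3, (f^`M(i)).@[v 0] = 0.

Definition smooth f : Prop := f != 0 /\ forall v, ~ singular_at f v.

Definition singular f : Prop := f != 0 /\ exists v, singular_at f v.

Definition irreducible_mpoly n (p : {mpoly K[n]}) : Prop :=
  [/\ p != 0, p \isn't a GRing.unit
    & forall q r : {mpoly K[n]}, p = q * r ->
        q \is a GRing.unit \/ r \is a GRing.unit].

(* Twice the quadratic part of the Taylor expansion of f at v, i.e. of
   f(v + X).  If v is a singular point, it is killed by v (Euler), hence
   defines the tangent cone at v (if nonzero). *)
Definition quadratic_part f v : {mpoly K[3]} :=
  \sum_(i < 3) \sum_(j < 3) (f^`M(i)^`M(j)).@[v 0] *: ('X_i * 'X_j).

(* A double point with two distinct tangent lines l1 = 0 and l2 = 0. *)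
Definition node f v : Prop :=
  singular_at f v /\
  exists l1 l2 : dhomog 3 K 1,
    free [:: l1; l2] /\ quadratic_part f v = mpoly_of_dhomog l1 * l2.

Definition nodal_cubic f : Prop :=
  irreducible_mpoly f /\
  exists v, node f v /\ forall w, singular_at f w -> <[w]>%VS = <[v]>%VS.

(* phi, acting on homogeneous coordinates, induces a regular map from the curve
   f = 0 to the curve g = 0: around each point it is given by three forms of
   the same degree without common zero there.  This forces phi to be compatible
   with proportionality on the points of the curve f = 0. *)
Definition regular_map f g (phi : 'rV[K]_3 -> 'rV[K]_3) : Prop :=
  (forall v, on_curve f v -> on_curve g (phi v)) /\
  forall v, on_curve f v ->
    exists (d : nat) (F : 'I_3 -> dhomog 3 K d),
      let F_at w := \row_i (F i).@[w 0] in
      F_at v != 0 /\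
      forall w, on_curve f w -> F_at w != 0 -> <[phi w]>%VS = <[F_at w]>%VS.

Definition isomorphic_curves f g : Prop :=
  exists phi psi : 'rV[K]_3 -> 'rV[K]_3,
    [/\ regular_map f g phi, regular_map g f psi,
        forall v, on_curve f v -> <[psi (phi v)]>%VS = <[v]>%VS
      & forall w, on_curve g w -> <[phi (psi w)]>%VS = <[w]>%VS].

Definition pencil V : Prop := \dim V = 2%N.

Definition member V f : Prop := f \in V /\ f != 0.

Definition base_point V v : Prop :=
  v != 0 /\ forall f, member V f -> f.@[v 0] = 0.

Definition unique_base_point V : Prop :=
  exists v, base_point V v /\
    forall w, base_point V w -> <[w]>%VS = <[v]>%VS.

(* The dense open subsets of the projective line P(V) are the complements of
   its finite subsets. *)
Definition general_member_smooth V : Prop :=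
  exists s : seq {vspace cubic_form},
    forall f, member V f -> <[f]>%VS \notin s -> smooth f.

Definition all_members_irreducible V : Prop :=
  forall f, member V f -> irreducible_mpoly f.

Definition special_pencil V : Prop :=
  [/\ pencil V, unique_base_point V, general_member_smooth V
    & all_members_irreducible V].

Definition isotrivial V : Prop :=
  forall f g, member V f -> member V g -> smooth f -> smooth g ->
    isomorphic_curves f g.

Definition exactly_singular_members (n : nat) V : Prop :=
  exists s : seq {vspace cubic_form},
    [/\ uniq s, size s = n
      & forall L, L \in s <->
          exists f, [/\ member V f, singular f & L = <[f]>%VS]].

(* The equation of the image of the curve p = 0 under the projective
   transformation [v] |-> [v *m A]. *)
Definition image_equation (A : 'M[K]_3) (p : {mpoly K[3]}) : {mpoly K[3]} :=
  p \mPo [tuple \sum_(i < 3) invmx A i j *: 'X_i | j < 3].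

Definition projectively_equivalent V W : Prop :=
  exists A : 'M[K]_3, A \in unitmx /\
    forall g, g \in W <->
      exists f, f \in V /\ mpoly_of_dhomog g = image_equation A f.

End PlaneCubics.

(* Main.v *)
Require Import Defs.
From HB Require Import structures.
From mathcomp Require Import all_boot all_order all_algebra ring zify.

(* Coordinates can be chosen so that the base point is (0:0:1) and the member
   singular there is N = xyz - x^3 - y^3, parametrized by (s^2t : st^2 : s^3+t^3).
   Another member meets N at the base point only, so its restriction to N is,
   after exchanging x and y, the monomial s^8t, and the pencil is spanned by N
   and C = xz^2 - y^2z - x^2y.  That a member is singular at the base point P is
   read off the norm a^2 - b^2F of a second member a(x) + b(x)y on a smooth
   member y^2 = F(x), which is a constant times (x - x(P))^9.

   A shear takes C + tN to xz^2 + txyz - y^2z - x^2y.  Every smooth cubic has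
   this form: a flex, found on the Hessian, gives a Weierstrass equation; writing
   F as a cube plus a square gives al x^3 + y^3 + z^3 + 3a xyz = 0, and a rescaling
   followed by the diagonalization of the cyclic permutation of the coordinates
   gives the claim.

   By the two previous points each special pencil contains copies of
   y^2 = x^3 + 1 and y^2 = x^3 - x.  An isomorphism between these two can be made
   to preserve the points at infinity by composing it with an involution "third
   point on the line through A"; then it is given by regular functions on the
   affine curves, and comparing pole orders shows that it is affine in x and y,
   which the equations exclude. *)

Set Implicit Arguments.
Unset Strict Implicit.
Unset Printing Implicit Defensive.

Import GRing.Theory Num.Theory.
Local Open Scope ring_scope.

(** On [cubicM t] each edge of the coordinate triangle touches the curve at one vertex and meets it
    again at another, in a cycle. For a group law with a flex as origin this gives 9P = 0 and 3P !=
    0 for the base point P = (0:0:1): points of order 9 are the geometric source of the standard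
    pencil, and the cyclic normal form exhibits them on every smooth cubic. The degenerate cases are
    where (C3) enters. If P were a flex of a smooth member, the pencil would contain the tripled
    flex tangent; if the member singular at P were cuspidal, it would contain the tripled cuspidal
    tangent. Triple or concurrent lines at P are excluded in the same way. To find a member singular
    at P, a double root of the norm suffices: two cubics tangent to each other at P have
    proportional gradients there, so some combination of them has zero gradient. The high order of
    the root only serves to rule out that P has order 2. Divisors and intersection multiplicities
    are replaced throughout by norms to K[x], a resultant, and ideal membership with explicit
    cofactors. *)

Notation i0 := (@Ordinal 3 0 isT).
Notation i1 := (@Ordinal 3 1 isT).
Notation i2 := (@Ordinal 3 2 isT).

Lemma sum_ord3 (V : nmodType) (F : 'I_3 -> V) :
  \sum_(i < 3) F i = F i0 + F i1 + F i2.
Proof.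
rewrite !big_ord_recr big_ord0 /= add0r.
by congr (_ + _ + _); congr F; apply: val_inj.
Qed.

Lemma ord3_ind (P : 'I_3 -> Prop) : P i0 -> P i1 -> P i2 -> forall i, P i.
Proof.
by move=> h0 h1 h2 [[|[|[|//]]] h]; rewrite (bool_irrelevance h isT).
Qed.

(** * Cubic forms in coordinates *)

Section Coordinates.
Variable K : numClosedFieldType.

Definition vec (x y z : K) : 'rV[K]_3 := \row_j [:: x; y; z]`_j.

Lemma vec0 x y z : vec x y z 0 i0 = x. Proof. by rewrite mxE. Qed.
Lemma vec1 x y z : vec x y z 0 i1 = y. Proof. by rewrite mxE. Qed.
Lemma vec2 x y z : vec x y z 0 i2 = z. Proof. by rewrite mxE. Qed.
Definition vecE := (vec0, vec1, vec2).

Lemma vec_eta (v : 'rV[K]_3) : v = vec (v 0 i0) (v 0 i1) (v 0 i2).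
Proof. by apply/rowP; elim/ord3_ind; rewrite vecE. Qed.

Lemma vecP (P : 'rV[K]_3 -> Prop) :
  (forall x y z, P (vec x y z)) -> forall v, P v.
Proof. by move=> h v; rewrite (vec_eta v). Qed.

Lemma vec_inj x y z x' y' z' :
  vec x y z = vec x' y' z' -> [/\ x = x', y = y' & z = z'].
Proof.
by move=> e; split; [have:= congr1 (fun v : 'rV_3 => v 0 i0) e
  | have:= congr1 (fun v : 'rV_3 => v 0 i1) e
  | have:= congr1 (fun v : 'rV_3 => v 0 i2) e]; rewrite !vecE.
Qed.

Lemma vecD x y z x' y' z' :
  vec x y z + vec x' y' z' = vec (x + x') (y + y') (z + z').
Proof. by apply/rowP; elim/ord3_ind; rewrite mxE !vecE. Qed.

Lemma vecN x y z : - vec x y z = vec (- x) (- y) (- z).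
Proof. by apply/rowP; elim/ord3_ind; rewrite mxE !vecE. Qed.

Lemma vecZ a x y z : a *: vec x y z = vec (a * x) (a * y) (a * z).
Proof. by apply/rowP; elim/ord3_ind; rewrite mxE !vecE. Qed.

Lemma vec_eq0 x y z : (vec x y z == 0) = [&& x == 0, y == 0 & z == 0].
Proof.
have z0 : vec 0 0 0 = 0 by apply/rowP; elim/ord3_ind; rewrite vecE mxE.
apply/eqP/and3P => [|[/eqP-> /eqP-> /eqP->]//].
by rewrite -z0 => /vec_inj [-> -> ->]; rewrite !eqxx.
Qed.

Definition ev (f : cubic_form K) (v : 'rV[K]_3) : K := f.@[v 0].

Definition cubic_val (c : nat -> K) (x y z : K) : K :=
  c 0%N * x ^+ 3 + c 1%N * (x ^+ 2 * y) + c 2%N * (x ^+ 2 * z)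
  + c 3%N * (x * y ^+ 2) + c 4%N * (x * y * z) + c 5%N * (x * z ^+ 2)
  + c 6%N * y ^+ 3 + c 7%N * (y ^+ 2 * z) + c 8%N * (y * z ^+ 2)
  + c 9%N * z ^+ 3.

Definition mon (a b d : nat) : 'X_{1..3} :=
  (U_(i0) *+ a + U_(i1) *+ b + U_(i2) *+ d)%MM.

Lemma mon_eq a b d m : (mon a b d == m) = [&& a == m i0, b == m i1 & d == m i2].
Proof.
apply/eqP/and3P => [<- | [/eqP ea /eqP eb /eqP ed]].
  by rewrite !mnmDE !mulmnE !mnm1E /= !mul0n !mul1n ?addn0 ?add0n !eqxx.
apply/mnmP; elim/ord3_ind; rewrite !mnmDE !mulmnE !mnm1E /=;
by rewrite !mul0n !mul1n ?addn0 ?add0n.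
Qed.

Lemma mpolyX_mon a b d :
  'X_[mon a b d] = 'X_i0 ^+ a * 'X_i1 ^+ b * 'X_i2 ^+ d :> {mpoly K[3]}.
Proof. by rewrite !mpolyXD !mpolyXn. Qed.

Definition cubic_mpoly (c : nat -> K) : {mpoly K[3]} :=
  c 0%N *: 'X_[mon 3 0 0] + c 1%N *: 'X_[mon 2 1 0] + c 2%N *: 'X_[mon 2 0 1]
  + c 3%N *: 'X_[mon 1 2 0] + c 4%N *: 'X_[mon 1 1 1] + c 5%N *: 'X_[mon 1 0 2]
  + c 6%N *: 'X_[mon 0 3 0] + c 7%N *: 'X_[mon 0 2 1] + c 8%N *: 'X_[mon 0 1 2]
  + c 9%N *: 'X_[mon 0 0 3].

Lemma cubic_mpoly_homog c : cubic_mpoly c \is 3.-homog.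
Proof.
rewrite /cubic_mpoly !rpredD ?rpredZ // dhomogX /= mdegE sum_ord3;
by rewrite !mnmDE !mulmnE !mnm1E /= !mul0n !mul1n ?addn0 ?add0n.
Qed.

Definition cubic_of c : cubic_form K := DHomog (cubic_mpoly_homog c).

Lemma sum3_exponents a b d : (a + b + d = 3)%N ->
  (a, b, d) \in [:: (3, 0, 0); (2, 1, 0); (2, 0, 1); (1, 2, 0); (1, 1, 1);
    (1, 0, 2); (0, 3, 0); (0, 2, 1); (0, 1, 2); (0, 0, 3)]%N.
Proof.
by case: a => [|[|[|[|a]]]]; case: b => [|[|[|[|b]]]]; case: d => [|[|[|[|d]]]].
Qed.

(* ((3 - a)(4 - a))/2 + d is the position of x^a y^b z^d in the order used by
   [cubic_val]. *)
Lemma mcoeff_cubic_mpoly c a b d : (a + b + d = 3)%N ->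
  (cubic_mpoly c)@_(mon a b d) = c (((3 - a) * (4 - a))./2 + d)%N.
Proof.
have mE i j k : (mon i j k == mon a b d) = [&& i == a, j == b & k == d].
  by rewrite mon_eq !mnmDE !mulmnE !mnm1E /= !mul0n !mul1n ?addn0 ?add0n.
rewrite /cubic_mpoly !mcoeffD !mcoeffZ !mcoeffX !mE.
move/sum3_exponents; rewrite !inE.
do ?[case/orP]; move/eqP => [-> -> ->];
by rewrite !(mulr0, mulr1, addr0, add0r).
Qed.

Lemma cubic_coefs (f : cubic_form K) : exists c, f = cubic_of c.
Proof.
have [c cE] : exists c, forall a b d, (a + b + d = 3)%N ->
    f@_(mon a b d) = c (((3 - a) * (4 - a))./2 + d)%N.
  exists (fun k => let: (a, b, d) := nth (0, 0, 0)%N [:: (3, 0, 0); (2, 1, 0);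
    (2, 0, 1); (1, 2, 0); (1, 1, 1); (1, 0, 2); (0, 3, 0); (0, 2, 1);
    (0, 1, 2); (0, 0, 3)]%N k in f@_(mon a b d)).
  move=> a b d /sum3_exponents; rewrite !inE.
  by do ?[case/orP]; move/eqP => [-> -> ->].
exists c; apply: val_inj; apply/mpolyP => m.
have [dm | dm] := eqVneq (mdeg m) 3%N; last first.
  rewrite (dhomog_nemf_coeff (dhomog_is_dhomog f) dm).
  by rewrite (dhomog_nemf_coeff (cubic_mpoly_homog c) dm).
have /eqP <- : mon (m i0) (m i1) (m i2) == m by rewrite mon_eq !eqxx.
have s3 : (m i0 + m i1 + m i2 = 3)%N by move: dm; rewrite mdegE sum_ord3.
by rewrite mcoeff_cubic_mpoly // cE.
Qed.

Lemma evE c x y z : ev (cubic_of c) (vec x y z) = cubic_val c x y z.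
Proof.
rewrite /ev /= /cubic_mpoly !mevalD !mevalZ !mpolyX_mon !mevalM !rmorphXn /= !mevalXU.
by rewrite !vecE /cubic_val; ring.
Qed.

End Coordinates.

(** * Gradients and quadratic parts as finite differences of values *)

Section Derivatives.
Variable K : numClosedFieldType.
Implicit Types (f g : cubic_form K) (u v w : 'rV[K]_3) (A B : 'M[K]_3).

Lemma two_neq0 : 2%:R != 0 :> K. Proof. by rewrite pnatr_eq0. Qed.

Lemma evD f g v : ev (f + g) v = ev f v + ev g v.
Proof. exact: mevalD. Qed.
Lemma evZ a f v : ev (a *: f) v = a * ev f v.
Proof. exact: mevalZ. Qed.
Lemma evB f g v : ev (f - g) v = ev f v - ev g v.
Proof. exact: mevalB. Qed.
Lemma ev0 v : ev (0 : cubic_form K) v = 0.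
Proof. exact: meval0. Qed.

(** Ten points with coordinates in {-1, 0, 1} suffice: the values at (1, 1, 0) and (1, -1, 0) give
    the sum and the difference of two mixed coefficients, and 2 is invertible. *)
Lemma cubic_val_eq0 (c : nat -> K) : (forall x y z, cubic_val c x y z = 0) ->
  forall k, (k < 10)%N -> c k = 0.
Proof.
move=> h.
have c0 : c 0%N = 0 by rewrite -(h 1 0 0) /cubic_val; ring.
have c6 : c 6%N = 0 by rewrite -(h 0 1 0) /cubic_val; ring.
have c9 : c 9%N = 0 by rewrite -(h 0 0 1) /cubic_val; ring.
have half a b : a + b = 0 -> b - a = 0 -> a = 0 /\ b = 0 :> K.
  move=> e1 e2; have b0 : b = 0.
    apply: (mulfI two_neq0); rewrite mulr0.
    have -> : 2%:R * b = a + b + (b - a) by ring.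
    by rewrite e1 e2 addr0.
  by move: e1; rewrite b0 addr0.
have [c1 c3] : c 1%N = 0 /\ c 3%N = 0.
  by apply: half; [rewrite -(h 1 1 0) | rewrite -(h 1 (-1) 0)];
    rewrite /cubic_val c0 c6; ring.
have [c2 c5] : c 2%N = 0 /\ c 5%N = 0.
  by apply: half; [rewrite -(h 1 0 1) | rewrite -(h 1 0 (-1))];
    rewrite /cubic_val c0 c9; ring.
have [c7 c8] : c 7%N = 0 /\ c 8%N = 0.
  by apply: half; [rewrite -(h 0 1 1) | rewrite -(h 0 1 (-1))];
    rewrite /cubic_val c6 c9; ring.
have c4 : c 4%N = 0.
  by rewrite -(h 1 1 1) /cubic_val c0 c1 c2 c3 c5 c6 c7 c8 c9; ring.
by case=> [|[|[|[|[|[|[|[|[|[|?]]]]]]]]]].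
Qed.

Lemma cubic_of_eq0 (c : nat -> K) : (forall k, (k < 10)%N -> c k = 0) -> cubic_of c = 0.
Proof.
by move=> h; apply: val_inj; rewrite /= /cubic_mpoly !h // !scale0r !addr0.
Qed.

(** This reduces identities between cubic forms to identities between values, which [ring] can
    decide. *)
Lemma ev_inj f g : (forall v, ev f v = ev g v) -> f = g.
Proof.
move=> h; apply/eqP; rewrite -subr_eq0; apply/eqP.
have [c fgE] := cubic_coefs (f - g); rewrite fgE.
apply/cubic_of_eq0/cubic_val_eq0 => x y z.
by rewrite -evE -fgE evB h subrr.
Qed.

Lemma evZv f a v : ev f (a *: v) = a ^+ 3 * ev f v.
Proof.
elim/(@vecP K): v => x y z; have [c ->] := cubic_coefs f.
by rewrite vecZ !evE /cubic_val; ring.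
Qed.

(* For a cubic these finite differences are exactly the gradient at v and twice
   the quadratic part of f(v + X), applied to u. *)
Definition dirder f v u := (ev f (v + u) - ev f (v - u)) / 2%:R - ev f u.
Definition dirder2 f v u := ev f (v + u) + ev f (v - u) - 2%:R * ev f v.

Lemma meval_mderivX (v : 'I_3 -> K) (m : 'X_{1..3}) i :
  ('X_[m])^`M(i).@[v] = (m i)%:R * \prod_j v j ^+ (m j - (i == j)).
Proof.
rewrite mderivX mevalZ mevalX; congr (_ * _); apply: eq_bigr => j _.
by rewrite mnmBE mnm1E.
Qed.

Lemma meval_mderivX2 (v : 'I_3 -> K) (m : 'X_{1..3}) i j :
  ('X_[m])^`M(i)^`M(j).@[v] =
  (m i)%:R * (m j - (i == j))%:R * \prod_k v k ^+ (m k - (i == k) - (j == k)).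
Proof.
rewrite mderivX mderivZ mevalZ meval_mderivX mnmBE mnm1E mulrA; congr (_ * _).
by apply: eq_bigr => k _; rewrite mnmBE mnm1E.
Qed.

Lemma prod_ord3 (F : 'I_3 -> K) : \prod_(i < 3) F i = F i0 * F i1 * F i2.
Proof.
rewrite !big_ord_recr big_ord0 /= mul1r.
by congr (_ * _ * _); congr F; apply: val_inj.
Qed.

Lemma mon0 a b d : mon a b d i0 = a.
Proof. by have := mon_eq a b d (mon a b d); rewrite eqxx => /esym/and3P[/eqP]. Qed.
Lemma mon1 a b d : mon a b d i1 = b.
Proof. by have := mon_eq a b d (mon a b d); rewrite eqxx => /esym/and3P[_ /eqP]. Qed.
Lemma mon2 a b d : mon a b d i2 = d.
Proof. by have := mon_eq a b d (mon a b d); rewrite eqxx => /esym/and3P[_ _ /eqP]. Qed.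

Definition expo (a b d : nat) (i : 'I_3) : nat := nth 0%N [:: a; b; d] i.

Lemma mon_expo a b d i : mon a b d i = expo a b d i.
Proof. by elim/ord3_ind: i; rewrite ?mon0 ?mon1 ?mon2. Qed.

Definition d1mon (v : 'I_3 -> K) i a b d : K :=
  (expo a b d i)%:R * (v i0 ^+ (a - (i == i0)) * v i1 ^+ (b - (i == i1))
    * v i2 ^+ (d - (i == i2))).

Definition d2mon (v : 'I_3 -> K) i j a b d : K :=
  (expo a b d i)%:R * (expo a b d j - (i == j))%:R *
    (v i0 ^+ (a - (i == i0) - (j == i0)) * v i1 ^+ (b - (i == i1) - (j == i1))
     * v i2 ^+ (d - (i == i2) - (j == i2))).

Lemma meval_mderiv_cubic c (v : 'I_3 -> K) i :
  (cubic_mpoly c)^`M(i).@[v] =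
  c 0%N * d1mon v i 3 0 0
  + c 1%N * d1mon v i 2 1 0
  + c 2%N * d1mon v i 2 0 1
  + c 3%N * d1mon v i 1 2 0
  + c 4%N * d1mon v i 1 1 1
  + c 5%N * d1mon v i 1 0 2
  + c 6%N * d1mon v i 0 3 0
  + c 7%N * d1mon v i 0 2 1
  + c 8%N * d1mon v i 0 1 2
  + c 9%N * d1mon v i 0 0 3.
Proof.
by rewrite /cubic_mpoly !mderivD !mderivZ !mevalD !mevalZ !meval_mderivX !prod_ord3
  !mon_expo.
Qed.

Lemma meval_mderiv2_cubic c (v : 'I_3 -> K) i j :
  (cubic_mpoly c)^`M(i)^`M(j).@[v] =
  c 0%N * d2mon v i j 3 0 0
  + c 1%N * d2mon v i j 2 1 0
  + c 2%N * d2mon v i j 2 0 1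
  + c 3%N * d2mon v i j 1 2 0
  + c 4%N * d2mon v i j 1 1 1
  + c 5%N * d2mon v i j 1 0 2
  + c 6%N * d2mon v i j 0 3 0
  + c 7%N * d2mon v i j 0 2 1
  + c 8%N * d2mon v i j 0 1 2
  + c 9%N * d2mon v i j 0 0 3.
Proof.
by rewrite /cubic_mpoly !mderivD !mderivZ !mevalD !mevalZ !meval_mderivX2 !prod_ord3
  !mon_expo.
Qed.

Lemma dirderE f v u : \sum_i u 0 i * f^`M(i).@[v 0] = dirder f v u.
Proof.
elim/(@vecP K): v => x y z; elim/(@vecP K): u => x' y' z'.
have [c ->] := cubic_coefs f.
rewrite /dirder vecN !vecD !evE sum_ord3 !vecE !meval_mderiv_cubic.
rewrite /d1mon !vecE /expo /= !(subSS, subn0, sub0n) /cubic_val.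
by field.
Qed.

Lemma dirder2E f v u : (quadratic_part f v).@[u 0] = dirder2 f v u.
Proof.
elim/(@vecP K): v => x y z; elim/(@vecP K): u => x' y' z'.
have [c ->] := cubic_coefs f.
rewrite /dirder2 vecN !vecD !evE /quadratic_part.
rewrite raddf_sum sum_ord3 /= !raddf_sum !sum_ord3 /=.
rewrite !mevalZ !mevalM !mevalXU !meval_mderiv2_cubic !vecE.
rewrite /d2mon !vecE /expo /= !(subSS, subn0, sub0n) /cubic_val.
by ring.
Qed.

End Derivatives.

(** * Linear changes of coordinates *)

Section Substitution.
Variable K : numClosedFieldType.
Implicit Types (f g : cubic_form K) (u v w : 'rV[K]_3) (A B : 'M[K]_3).

Definition rows3 u v w : 'M[K]_3 := \matrix_i [:: u; v; w]`_i.

Lemma mul_vec_rows3 x y z u v w :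
  vec x y z *m rows3 u v w = x *: u + y *: v + z *: w.
Proof.
rewrite mulmx_sum_row sum_ord3 !vecE.
by congr (_ + _ + _); congr (_ *: _); rewrite rowK.
Qed.

Definition mulv := (mul_vec_rows3, vecZ, vecD, vecN).

Definition det3 u v w : K :=
  u 0 i0 * (v 0 i1 * w 0 i2 - v 0 i2 * w 0 i1)
  - u 0 i1 * (v 0 i0 * w 0 i2 - v 0 i2 * w 0 i0)
  + u 0 i2 * (v 0 i0 * w 0 i1 - v 0 i1 * w 0 i0).

Definition cross u v : 'rV[K]_3 :=
  vec (u 0 i1 * v 0 i2 - u 0 i2 * v 0 i1) (u 0 i2 * v 0 i0 - u 0 i0 * v 0 i2)
      (u 0 i0 * v 0 i1 - u 0 i1 * v 0 i0).

(** Up to the determinant, the columns of the inverse are the cross products of the rows. *)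
Lemma rows3_unit u v w : det3 u v w != 0 -> rows3 u v w \in unitmx.
Proof.
move=> d0; pose B := (det3 u v w)^-1 *: (rows3 (cross v w) (cross w u) (cross u v))^T.
suff /mulmx1_unit [] : rows3 u v w *m B = 1%:M by [].
rewrite -scalemxAr; apply: (scalerI d0); rewrite scalerA mulfV // scale1r.
apply/matrixP => i j; rewrite !mxE sum_ord3 !mxE /det3.
by elim/ord3_ind: i; elim/ord3_ind: j; rewrite /= !vecE; ring.
Qed.

Definition csub_tuple A : 3.-tuple {mpoly K[3]} :=
  [tuple \sum_(i < 3) A i j *: 'X_i | j < 3].

Lemma csub_homog A f : f \mPo csub_tuple A \is 3.-homog.
Proof.
have hl j : tnth (csub_tuple A) j \is 1.-homog.
  rewrite tnth_mktuple rpred_sum // => i _; rewrite rpredZ //.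
  by rewrite dhomogX /= mdeg1.
have [c ->] := cubic_coefs f; rewrite /= /cubic_mpoly.
have hm a b d : 'X_[mon a b d] \mPo csub_tuple A \is (a + b + d).-homog.
  rewrite mpolyX_mon !rmorphM !rmorphXn /= !comp_mpolyXU.
  rewrite -!tnth_nth.
  by rewrite !dhomogM // -[X in X.-homog]mul1n dhomogMn.
rewrite !comp_mpolyD !comp_mpolyZ.
by rewrite !rpredD ?rpredZ //; apply: hm.
Qed.

(** The pullback of f along v |-> vA; hence [image_equation A f] is [csub (invmx A) f] by
    conversion. *)
Definition csub A f : cubic_form K := DHomog (csub_homog A f).

Lemma ev_csub A f v : ev (csub A f) v = ev f (v *m A).
Proof.
rewrite /ev /= comp_mpoly_meval; apply: meval_eq => j.
rewrite tnth_mktuple raddf_sum mxE; apply: eq_bigr => i _ /=.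
by rewrite mevalZ mevalXU mulrC.
Qed.

Lemma csubM A B f : csub A (csub B f) = csub (A *m B) f.
Proof. by apply: ev_inj => v; rewrite !ev_csub mulmxA. Qed.

Lemma csub1 f : csub 1%:M f = f.
Proof. by apply: ev_inj => v; rewrite !ev_csub mulmx1. Qed.

Lemma csubK A : A \in unitmx -> cancel (csub A) (csub (invmx A)).
Proof. by move=> uA f; rewrite csubM mulVmx // csub1. Qed.

Lemma csubVK A : A \in unitmx -> cancel (csub (invmx A)) (csub A).
Proof. by move=> uA f; rewrite csubM mulmxV // csub1. Qed.

Lemma csub_is_linear A : linear (csub A).
Proof. by move=> a f g; apply: ev_inj => v; rewrite !(evD, evZ, ev_csub). Qed.

HB.instance Definition _ A :=
  GRing.isLinear.Build K (cubic_form K) (cubic_form K) _ (csub A)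
    (csub_is_linear A).

Lemma dirder_csub A f v u : dirder (csub A f) v u = dirder f (v *m A) (u *m A).
Proof. by rewrite /dirder !ev_csub mulmxDl mulmxBl. Qed.

Lemma dirder2_csub A f v u : dirder2 (csub A f) v u = dirder2 f (v *m A) (u *m A).
Proof. by rewrite /dirder2 !ev_csub mulmxDl mulmxBl. Qed.

Lemma singular_atP f v :
  singular_at f v <-> [/\ v != 0, ev f v = 0 & forall u, dirder f v u = 0].
Proof.
split=> [[[v0 fv] h]|[v0 fv h]].
  by split=> // u; rewrite -dirderE big1 // => i _; rewrite h mulr0.
split=> // i; have := h (\row_j (j == i)%:R); rewrite -dirderE.
rewrite (bigD1 i) //= big1 ?mxE ?eqxx ?mul1r ?addr0 // => j ji.
by rewrite mxE (negPf ji) mul0r.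
Qed.

Lemma mulmx_unit_eq0 A v : A \in unitmx -> (v *m A == 0) = (v == 0).
Proof.
move=> uA; apply/eqP/eqP => [e|->]; last by rewrite mul0mx.
by rewrite -[v](mulmxK uA) e mul0mx.
Qed.

Lemma singular_at_csub A f v : A \in unitmx ->
  singular_at (csub A f) v <-> singular_at f (v *m A).
Proof.
move=> uA; split=> /singular_atP [v0 fv h]; apply/singular_atP; split.
- by rewrite mulmx_unit_eq0.
- by rewrite -ev_csub.
- by move=> u; rewrite -[u](mulmxKV uA) -dirder_csub.
- by rewrite -(mulmx_unit_eq0 _ uA).
- by rewrite ev_csub.
- by move=> u; rewrite dirder_csub.
Qed.

Lemma csub_eq0 A f : A \in unitmx -> (csub A f == 0) = (f == 0).
Proof.
move=> uA; apply/eqP/eqP => [e|->]; last by rewrite linear0.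
by rewrite -[f](csubK uA) e linear0.
Qed.

Lemma smooth_csub A f : A \in unitmx -> smooth (csub A f) <-> smooth f.
Proof.
move=> uA; split=> -[f0 h]; split; rewrite ?csub_eq0 // -?(csub_eq0 f uA) // => v.
  by rewrite -[v](mulmxKV uA) -singular_at_csub.
by rewrite singular_at_csub.
Qed.

End Substitution.

(** * Irreducible cubics are those that contain no line *)

Section Lines.
Variable K : numClosedFieldType.
Implicit Types (f g : cubic_form K) (u v w : 'rV[K]_3) (A B : 'M[K]_3).

Lemma csub_comp_invmx A f : A \in unitmx ->
  f = (csub A f) \mPo csub_tuple (invmx A) :> {mpoly K[3]}.
Proof. by move=> uA; rewrite -[LHS](congr1 val (csubK uA f)). Qed.

Lemma unit_meval_neq0 (p : {mpoly K[3]}) (v : 'I_3 -> K) :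
  p \is a GRing.unit -> p.@[v] != 0.
Proof. by move=> up; rewrite -unitfE; apply: (rmorph_unit (meval v)). Qed.

Lemma comp_meval_origin A (p : {mpoly K[3]}) :
  (p \mPo csub_tuple A).@[fun=> 0] = p.@[fun=> 0].
Proof.
rewrite comp_mpoly_meval; apply: meval_eq => j.
rewrite tnth_mktuple raddf_sum big1 // => i _ /=.
by rewrite mevalZ mevalXU mulr0.
Qed.

(** As A varies, the points (0, y, z)A run over an arbitrary line. This form of irreducibility
    speaks of values only and is visibly invariant under changes of coordinates. *)
Definition lineless f :=
  forall A, A \in unitmx -> ~ (forall y z, ev f (vec 0 y z *m A) = 0).

(** In coordinates where the line is x = 0, the form is x times a quadratic form; both factors
    vanish at the origin, so neither is a unit. *)
Lemma irreducible_lineless f : irreducible_mpoly f -> lineless f.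
Proof.
case=> _ _ irr A uA h.
have [c cE] := cubic_coefs (csub A f).
have hc k : (k < 4)%N -> c (6 + k)%N = 0.
  (* The monomials of index at least 6 are those free of x. *)
  pose c' k := if (k < 6)%N then 0 else c k.
  have c'0 x y z : cubic_val c' x y z = 0.
    rewrite -(h y z) -ev_csub cE evE /cubic_val /c' /=; ring.
  by move=> k4; rewrite -(cubic_val_eq0 c'0 (k := 6 + k)).
pose r : {mpoly K[3]} := c 0%N *: 'X_[mon 2 0 0] + c 1%N *: 'X_[mon 1 1 0]
  + c 2%N *: 'X_[mon 1 0 1] + c 3%N *: 'X_[mon 0 2 0] + c 4%N *: 'X_[mon 0 1 1]
  + c 5%N *: 'X_[mon 0 0 2].
have fE : mpoly_of_dhomog (csub A f) = 'X_i0 * r.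
  rewrite cE /= /cubic_mpoly (hc 0%N) // (hc 1%N) // (hc 2%N) // (hc 3%N) //.
  rewrite !scale0r !addr0 /r !mulrDr -!scalerAr !mpolyX_mon !expr0 !expr1 !exprS !expr0.
  by rewrite !(mulr1, mul1r) !mulrA.
have := csub_comp_invmx f uA; rewrite fE rmorphM /=.
case/irr => /(unit_meval_neq0 (fun=> 0)) /negP; apply; rewrite comp_meval_origin.
  by rewrite mevalXU.
by rewrite /r !mevalD !mevalZ !mpolyX_mon !mevalM !rmorphXn /= !mevalXU
  !expr0n /= !(mul0r, mulr0, addr0).
Qed.

Lemma linear_form_coefs (p : {mpoly K[3]}) : p \is 1.-homog ->
  exists a b c, p = a *: 'X_i0 + b *: 'X_i1 + c *: 'X_i2.
Proof.
move=> hp; exists p@_U_(i0), p@_U_(i1), p@_U_(i2).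
apply/mpolyP => m; have [dm|dm] := eqVneq (mdeg m) 1%N; last first.
  rewrite (dhomog_nemf_coeff hp dm).
  have hs : p@_U_(i0) *: 'X_i0 + p@_U_(i1) *: 'X_i1 + p@_U_(i2) *: 'X_i2
      \is 1.-homog by rewrite !rpredD ?rpredZ // dhomogX /= mdeg1.
  by rewrite (dhomog_nemf_coeff hs dm).
have /mdeg1P [i /eqP ->] : mdeg m == 1%N by apply/eqP.
rewrite !mcoeffD !mcoeffZ !mcoeffXU.
by elim/ord3_ind: i; rewrite /= !(mulr1, mulr0, addr0, add0r).
Qed.

Lemma msize_dhomog (d : nat) (p : {mpoly K[3]}) :
  p != 0 -> p \is d.-homog -> msize p = d.+1.
Proof.
move=> p0 hp; have := dhomog_uniq p0 hp (dhomog_msize hp) => ->.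
by rewrite prednK // lt0n msize_poly_eq0.
Qed.

Lemma msize1_unit (p : {mpoly K[3]}) : msize p = 1%N -> p \is a GRing.unit.
Proof.
move/eqP/msize_poly1P => [c c0 ->].
by rewrite (rmorph_unit (@mpolyC 3 K)) // unitfE.
Qed.

(** A proper factorization has factors of degrees 1 and 2, not known to be homogeneous. In the
    component of degree 3 only the top parts of the factors contribute, so the linear part of the
    first one divides f, and f vanishes on a line. *)
Lemma lineless_irreducible f : f != 0 -> lineless f -> irreducible_mpoly f.
Proof.
move=> f0 nl.
have f0' : mpoly_of_dhomog f != 0 by rewrite -(inj_eq val_inj) in f0.
have nolin q r : mpoly_of_dhomog f = q * r -> msize q = 2%N -> msize r = 3%N -> False.
  move=> fqr sq sr.
  have qE : q = pihomog mdeg 0 q + pihomog mdeg 1 q.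
    have := @pihomog_partitionE _ _ mdeg 2 q; rewrite !big_ord_recr big_ord0 /= add0r.
    by apply; rewrite sq.
  have rE : r = pihomog mdeg 0 r + pihomog mdeg 1 r + pihomog mdeg 2 r.
    have := @pihomog_partitionE _ _ mdeg 3 r; rewrite !big_ord_recr big_ord0 /= add0r.
    by apply; rewrite sr.
  have hom i j : pihomog mdeg 3 (pihomog mdeg i q * pihomog mdeg j r) =
      if (i + j == 3)%N then pihomog mdeg i q * pihomog mdeg j r else 0.
    have h := dhomogM (pihomogP mdeg i q) (pihomogP mdeg j r).
    case: eqP => e; first by rewrite pihomog_dE //; move: h; rewrite e.
    by rewrite (@pihomog_ne0 _ _ _ (i + j)) //; apply/eqP.
  have fE : mpoly_of_dhomog f = pihomog mdeg 1 q * pihomog mdeg 2 r.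
    rewrite -(pihomog_dE (dhomog_is_dhomog f)) /= fqr {1}qE {1}rE.
    by rewrite !mulrDl !mulrDr !pihomogD !hom /= !(add0r, addr0).
  have [a [b [c lE]]] := linear_form_coefs (pihomogP mdeg 1 q).
  have evf v : ev f v = (a * v 0 i0 + b * v 0 i1 + c * v 0 i2)
      * (pihomog mdeg 2 r).@[v 0].
    by rewrite /ev fE lE mevalM !mevalD !mevalZ !mevalXU.
  have fin A : A \in unitmx -> (forall y z, let v := vec 0 y z *m A in
      a * v 0 i0 + b * v 0 i1 + c * v 0 i2 = 0) -> False.
    by move=> uA h; apply: (nl A uA) => y z; rewrite evf h mul0r.
  (* The last two rows span the plane ax + by + cz = 0; the basis depends on the first nonzero
     coefficient. *)
  have [a0 | a0] := eqVneq a 0; last first.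
    apply: (fin (rows3 (vec 1 0 0) (vec (- b) a 0) (vec (- c) 0 a))).
      apply: rows3_unit; rewrite /det3 !vecE.
      by rewrite !(mul0r, mulr0, subr0, addr0, mul1r, sub0r) mulf_neq0.
    by move=> y z v; rewrite /v !mulv !vecE; ring.
  have [b0 | b0] := eqVneq b 0; last first.
    apply: (fin (rows3 (vec 0 1 0) (vec b (- a) 0) (vec 0 (- c) b))).
      apply: rows3_unit; rewrite /det3 !vecE.
      by rewrite !(mul0r, mulr0, subr0, addr0, mul1r, sub0r) oppr_eq0 mulf_neq0.
    by move=> y z v; rewrite /v !mulv !vecE; ring.
  apply: (fin (rows3 (vec 0 0 1) (vec 1 0 0) (vec 0 1 0))); last first.
    by move=> y z v; rewrite /v !mulv !vecE a0 b0; ring.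
  apply: rows3_unit; rewrite /det3 !vecE.
  by rewrite !(mul0r, mulr0, subr0, addr0, mul1r, oppr0, sub0r, add0r) oner_eq0.
split=> //.
  apply/negP => /(unit_meval_neq0 ((0 : 'rV_3) 0)); rewrite -/(ev f 0).
  by rewrite -[0 : 'rV_3](scale0r (0 : 'rV_3)) evZv expr0n mul0r eqxx.
move=> q r fqr.
have /norP [q0 r0] : ~~ ((q == 0) || (r == 0)) by rewrite -mulf_eq0 -fqr.
have := msizeM q0 r0; rewrite -fqr (msize_dhomog f0' (dhomog_is_dhomog f)).
rewrite -!msize_poly_eq0 in q0 r0 => e.
have : msize q = 1%N \/ msize q = 2%N /\ msize r = 3%N \/
  msize q = 3%N /\ msize r = 2%N \/ msize r = 1%N.
  by move: q0 r0 e; move: (msize q) (msize r) => m n; lia.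
case=> [sq | [[sq sr] | [[sq sr] | sr]]].
- by left; apply: msize1_unit.
- by case: (nolin q r).
- by case: (nolin r q); rewrite // mulrC.
- by right; apply: msize1_unit.
Qed.

End Lines.

(** * Tangent cones that split into two lines *)

Section Nodes.
Variable K : numClosedFieldType.
Implicit Types (f g : cubic_form K) (u v w : 'rV[K]_3) (A B : 'M[K]_3).

Lemma vlineZ (V : vectType K) (a : K) (v : V) : a != 0 -> <[a *: v]>%VS = <[v]>%VS.
Proof.
move=> a0; apply/eqP; rewrite eqEsubv -!memvE; apply/andP; split; apply/vlineP.
  by exists a.
by exists a^-1; rewrite scalerA mulVf // scale1r.
Qed.

Lemma vline_eqP (V : vectType K) (v w : V) : v != 0 -> <[v]>%VS = <[w]>%VS ->
  exists2 k, k != 0 & v = k *: w.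
Proof.
move=> v0 e; have /vlineP [k vE] : v \in <[w]>%VS by rewrite -e memv_line.
by exists k => //; apply: contraNneq v0 => k0; rewrite vE k0 scale0r.
Qed.

Lemma lineless_csub A f : A \in unitmx -> lineless (csub A f) <-> lineless f.
Proof.
move=> uA; split=> h B uB e.
  apply: (h (B *m invmx A)); first by rewrite unitmx_mul uB unitmx_inv.
  by move=> y z; rewrite ev_csub !mulmxA mulmxKV.
apply: (h (B *m A)); first by rewrite unitmx_mul uB.
by move=> y z; rewrite mulmxA -ev_csub.
Qed.

Lemma lineless_eq f :
  (forall l : 'cV[K]_3, l != 0 ->
     ~ (forall v, (v *m l) 0 0 = 0 -> ev f v = 0)) -> lineless f.
Proof.
(* The first column of the inverse of A is the equation of the line spanned by the last two rows of
   A. *)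
move=> h A uA e; apply: (h (col i0 (invmx A))).
  apply: contraTneq (uA) => l0; rewrite -unitmx_inv unitmxE.
  by rewrite (expand_det_col _ i0) big1 ?unitr0 // => i _;
     have /colP/(_ i) := l0; rewrite !mxE => ->; rewrite mul0r.
move=> v vl; rewrite -[v](mulmxKV uA) [v *m _]vec_eta.
rewrite colE mulmxA -colE mxE in vl.
by rewrite vl e.
Qed.

Definition linear_form (a : 'cV[K]_3) : {mpoly K[3]} := \sum_i a i 0 *: 'X_i.

Lemma linear_form_homog a : linear_form a \is 1.-homog.
Proof. by rewrite rpred_sum // => i _; rewrite rpredZ // dhomogX /= mdeg1. Qed.

Lemma meval_linear_form a u : (linear_form a).@[u 0] = (u *m a) 0 0.
Proof.
rewrite raddf_sum mxE; apply: eq_bigr => i _ /=.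
by rewrite mevalZ mevalXU mulrC.
Qed.

Lemma quadratic_part_homog f v : quadratic_part f v \is 2.-homog.
Proof.
rewrite rpred_sum // => i _; rewrite rpred_sum // => j _; rewrite rpredZ //.
by rewrite -mpolyXD dhomogX /= mdegD !mdeg1.
Qed.

(** Multiplication by ['X_i0] turns the equality of quadratic forms into one of cubic forms, which
    [ev_inj] reduces to values. The witnesses u and w show that the two linear forms are not
    proportional. *)
Lemma node_linear_forms f v (a b : 'cV[K]_3) :
  singular_at f v ->
  (forall u, dirder2 f v u = (u *m a) 0 0 * (u *m b) 0 0) ->
  (exists2 u : 'rV[K]_3, (u *m a) 0 0 = 0 & (u *m b) 0 0 != 0) ->
  (exists2 u : 'rV[K]_3, (u *m b) 0 0 = 0 & (u *m a) 0 0 != 0) ->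
  node f v.
Proof.
move=> sf qE [u ua ub] [w wb wa]; split=> //.
exists (DHomog (linear_form_homog a)), (DHomog (linear_form_homog b)); split.
  rewrite free_cons span_seq1 seq1_free; apply/andP; split.
    apply/vlineP => -[k /(congr1 (fun l : dhomog 3 K 1 => l.@[w 0]))] /=.
    rewrite mevalZ !meval_linear_form wb mulr0 => /eqP; exact/negP.
  apply/eqP => /(congr1 (fun l : dhomog 3 K 1 => l.@[u 0])) /=.
  by rewrite meval0 meval_linear_form => /eqP; exact/negP.
apply: (@mulfI _ ('X_i0 : {mpoly K[3]})).
  apply/eqP => /(congr1 (meval (fun=> 1))); rewrite mevalXU meval0.
  by apply/eqP; rewrite oner_eq0.
have hX : ('X_i0 : {mpoly K[3]}) \is 1.-homog by rewrite dhomogX /= mdeg1.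
have h1 := dhomogM hX (quadratic_part_homog f v).
have h2 := dhomogM hX (dhomogM (linear_form_homog a) (linear_form_homog b)).
apply: (congr1 val (_ : DHomog h1 = DHomog h2)).
apply: ev_inj => z; rewrite /ev /= !mevalM; congr (_ * _).
by rewrite dirder2E qE !meval_linear_form.
Qed.

(* Stated on values rather than polynomials, this transports along [csub]. *)
Definition split_node f v := singular_at f v /\ exists a b : 'cV[K]_3,
  [/\ forall u, dirder2 f v u = (u *m a) 0 0 * (u *m b) 0 0,
   exists2 u : 'rV[K]_3, (u *m a) 0 0 = 0 & (u *m b) 0 0 != 0 &
   exists2 u : 'rV[K]_3, (u *m b) 0 0 = 0 & (u *m a) 0 0 != 0].

Lemma split_node_node f v : split_node f v -> node f v.
Proof. by case=> sf [a [b [q h1 h2]]]; apply: (node_linear_forms sf q). Qed.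

Lemma split_node_csub A f v : A \in unitmx ->
  split_node f (v *m A) -> split_node (csub A f) v.
Proof.
move=> uA [sf [a [b [q [u ua ub] [w wb wa]]]]]; split.
  by rewrite singular_at_csub.
exists (A *m a), (A *m b); split.
- by move=> x; rewrite dirder2_csub q !mulmxA.
- by exists (u *m invmx A); rewrite mulmxA mulmxKV.
- by exists (w *m invmx A); rewrite mulmxA mulmxKV.
Qed.

End Nodes.

(** * The pencil spanned by N and C *)

(* Ideal membership with explicit cofactors: the premise is left to [ring]. *)
Section LinearCombinations.
Variable R : comNzRingType.

Lemma lincomb1 (a1 b1 : R) (e1 : a1 = b1) c1 x y : x - y = c1 * (a1 - b1) -> x = y.
Proof. by rewrite e1 subrr mulr0 => /eqP; rewrite subr_eq0 => /eqP. Qed.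

Lemma lincomb2 (a1 b1 a2 b2 : R) (e1 : a1 = b1) (e2 : a2 = b2) c1 c2 x y :
  x - y = c1 * (a1 - b1) + c2 * (a2 - b2) -> x = y.
Proof.
by rewrite e1 e2 !subrr !mulr0 addr0 => /eqP; rewrite subr_eq0 => /eqP.
Qed.

Lemma lincomb3 (a1 b1 a2 b2 a3 b3 : R) (e1 : a1 = b1) (e2 : a2 = b2) (e3 : a3 = b3)
    c1 c2 c3 x y :
  x - y = c1 * (a1 - b1) + c2 * (a2 - b2) + c3 * (a3 - b3) -> x = y.
Proof.
by rewrite e1 e2 e3 !subrr !mulr0 !addr0 => /eqP; rewrite subr_eq0 => /eqP.
Qed.

End LinearCombinations.
Arguments lincomb1 {R a1 b1} e1 c1 {x y}.
Arguments lincomb2 {R a1 b1 a2 b2} e1 e2 c1 c2 {x y}.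
Arguments lincomb3 {R a1 b1 a2 b2 a3 b3} e1 e2 e3 c1 c2 c3 {x y}.

Section StandardPencil.
Variable K : numClosedFieldType.
Implicit Types (f g : cubic_form K) (u v w : 'rV[K]_3) (A B : 'M[K]_3).

Definition cubic_of_seq (s : seq K) : cubic_form K := cubic_of (nth 0 s).

Definition cubicN := cubic_of_seq [:: -1; 0; 0; 0; 1; 0; -1; 0; 0; 0].
Definition cubicC := cubic_of_seq [:: 0; -1; 0; 0; 0; 1; 0; -1; 0; 0].
Definition cubicM t := cubic_of_seq [:: 0; -1; 0; 0; t; 1; 0; -1; 0; 0].
Definition cubicW t := cubicC + t *: cubicN.

Lemma evN x y z : ev cubicN (vec x y z) = x * y * z - x ^+ 3 - y ^+ 3.
Proof. by rewrite evE /cubic_val /=; ring. Qed.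
Lemma evC x y z : ev cubicC (vec x y z) = x * z ^+ 2 - y ^+ 2 * z - x ^+ 2 * y.
Proof. by rewrite evE /cubic_val /=; ring. Qed.
Lemma evM t x y z :
  ev (cubicM t) (vec x y z) = x * z ^+ 2 + t * (x * y * z) - y ^+ 2 * z - x ^+ 2 * y.
Proof. by rewrite evE /cubic_val /=; ring. Qed.

(* First z -> z - ty, then y -> y - tx. *)
Definition shear t := rows3 (vec 1 (- t) (t ^+ 2)) (vec 0 1 (- t)) (vec 0 0 1 : 'rV[K]_3).

Lemma shear_unit t : shear t \in unitmx.
Proof.
apply: rows3_unit; rewrite /det3 !vecE (_ : _ + _ = 1) ?oner_eq0 //.
by ring.
Qed.

Lemma csub_shear t : csub (shear t) (cubicW t) = cubicM t.
Proof.
apply: ev_inj => v; elim/(@vecP K): v => x y z.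
by rewrite ev_csub !mulv evD evZ evN evC evM; ring.
Qed.

Lemma col3_neq0 (l : 'cV[K]_3) : l != 0 ->
  l i2 0 != 0 \/ (l i2 0 = 0 /\ l i1 0 != 0) \/
  [/\ l i2 0 = 0, l i1 0 = 0 & l i0 0 != 0].
Proof.
move=> l0; have [e2|] := eqVneq (l i2 0) 0; last by left.
have [e1|] := eqVneq (l i1 0) 0; last by right; left.
right; right; split=> //; apply: contraNneq l0 => e0.
by apply/eqP/colP; elim/ord3_ind; rewrite !mxE.
Qed.

Lemma lineless_graphs f :
  (forall a b, ~ (forall x y, ev f (vec x y (a * x + b * y)) = 0)) ->
  (forall a, ~ (forall x z, ev f (vec x (a * x) z) = 0)) ->
  ~ (forall y z, ev f (vec 0 y z) = 0) -> lineless f.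
Proof.
move=> h2 h1 h0; apply: lineless_eq => l /col3_neq0 lc h.
have dot x y z : (vec x y z *m l) 0 0 = x * l i0 0 + y * l i1 0 + z * l i2 0.
  by rewrite mxE sum_ord3 !vecE.
case: lc => [l2 | [[l2 l1] | [l2 l1 l0]]].
- apply: (h2 (- l i0 0 / l i2 0) (- l i1 0 / l i2 0)) => x y; apply: h.
  by rewrite dot; field.
- apply: (h1 (- l i0 0 / l i1 0)) => x z; apply: h.
  by rewrite dot l2; field.
- by apply: h0 => y z; apply: h; rewrite dot l2 l1; ring.
Qed.

Lemma lineless_N : lineless cubicN.
Proof.
have n1 : (-1 : K) <> 0 by apply/eqP; rewrite oppr_eq0 oner_eq0.
apply: lineless_graphs => [a b h | a h | h]; apply: n1.
- by rewrite -(h 1 0) evN; ring.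
- have := h 1 1; have := h 1 0; rewrite !evN => e0 e1.
  have a0 : a = 0.
    by rewrite -[RHS](subrr (0 : K)) -{1}e1 -e0; ring.
  by rewrite -e0 a0; ring.
- by rewrite -(h 1 0) evN; ring.
Qed.

Lemma lineless_M t : lineless (cubicM t).
Proof.
have n1 : (-1 : K) <> 0 by apply/eqP; rewrite oppr_eq0 oner_eq0.
apply: lineless_graphs => [a b h | a h | h]; apply: n1.
- have := h 1 0; have := h 0 1; rewrite !evM => eb ea.
  have b0 : b = 0 by rewrite -[RHS]oppr0 -eb; ring.
  have a0 : a = 0.
    by apply/eqP; rewrite -sqrf_eq0 -ea; apply/eqP; ring.
  by rewrite -(h 1 1) evM a0 b0; ring.
- have := h 1 1; have := h 1 (-1); have := h 1 0; rewrite !evM => e0 e1 e2.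
  have : 2%:R = 0 :> K.
    by rewrite -[RHS]addr0 -{1}e1 -e2 -[LHS]addr0 -[X in _ + X](mulr0 2%:R) -e0; ring.
  by move/eqP; rewrite (negPf (two_neq0 K)).
- by rewrite -(h 1 1) evM; ring.
Qed.

Lemma lineless_scale a f : a != 0 -> lineless f -> lineless (a *: f).
Proof.
move=> a0 h A uA e; apply: (h A uA) => y z; apply: (mulfI a0).
by rewrite -evZ e mulr0.
Qed.

Lemma lineless_W t : lineless (cubicW t).
Proof. by rewrite -(lineless_csub _ (shear_unit t)) csub_shear; apply: lineless_M. Qed.

Lemma dirderM t x y z x' y' z' : dirder (cubicM t) (vec x y z) (vec x' y' z') =
  x' * (z ^+ 2 + t * y * z - 2%:R * x * y)
  + y' * (t * x * z - 2%:R * y * z - x ^+ 2)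
  + z' * (2%:R * x * z + t * x * y - y ^+ 2).
Proof. by rewrite /dirder vecN !vecD !evM; field. Qed.

Lemma dirderN x y z x' y' z' : dirder cubicN (vec x y z) (vec x' y' z') =
  x' * (y * z - 3%:R * x ^+ 2) + y' * (x * z - 3%:R * y ^+ 2) + z' * (x * y).
Proof. by rewrite /dirder vecN !vecD !evN; field. Qed.

Lemma singular_at_N v : singular_at cubicN v <-> exists2 k, k != 0 & v = k *: vec 0 0 1.
Proof.
rewrite singular_atP; elim/(@vecP K): v => x y z; split; last first.
  case=> k k0; rewrite vecZ !mulr0 mulr1 => ->; split.
  - by rewrite vec_eq0 !eqxx k0.
  - by rewrite evN; ring.
  - by elim/(@vecP K) => x' y' z'; rewrite dirderN; ring.
case=> v0 _ d; have := d (vec 0 0 1); have := d (vec 0 1 0); have := d (vec 1 0 0).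
rewrite !dirderN !(mul1r, mul0r, addr0, add0r) => e1 e2 /eqP; rewrite mulf_eq0.
have sq3 (a : K) : 3%:R * a ^+ 2 = 0 -> a = 0.
  by move/eqP; rewrite mulf_eq0 pnatr_eq0 sqrf_eq0 => /eqP.
move=> xy0; have [x0 y0] : x = 0 /\ y = 0.
  case/orP: xy0 => /eqP e0; split=> //; apply: sq3.
    by rewrite -[RHS]oppr0 -e2 e0; ring.
  by rewrite -[RHS]oppr0 -e1 e0; ring.
exists z; last by rewrite vecZ x0 y0 !mulr0 mulr1.
by move: v0; rewrite vec_eq0 x0 y0 eqxx.
Qed.

Definition singular_ptM t : 'rV[K]_3 := vec t (t ^+ 2 / 3%:R) 3%:R.

(** All coordinates of a singular point are nonzero. The three partial derivatives then give tz =
    3x, yz = x^2 and z^2 = -xy, which determine the point up to a scalar and force t^3 = -27. *)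
Lemma singular_at_M t v : singular_at (cubicM t) v ->
  t ^+ 3 = - 27%:R /\ exists2 k, k != 0 & v = k *: singular_ptM t.
Proof.
rewrite singular_atP; elim/(@vecP K): v => x y z [v0 _ d].
have := d (vec 0 0 1); have := d (vec 0 1 0); have := d (vec 1 0 0).
rewrite !dirderM !(mul1r, mul0r, addr0, add0r) => e1 e2 e3.
have sq (a : K) : a ^+ 2 = 0 -> a = 0 by move/eqP; rewrite sqrf_eq0 => /eqP.
have n0 : ~ (x = 0 /\ y = 0 /\ z = 0).
  by case=> ex [ey ez]; move: v0; rewrite ex ey ez vec_eq0 !eqxx.
have x0 : x != 0.
  apply/eqP => x0; have y0 : y = 0.
    by apply: sq; apply: (lincomb1 e3 (-1)); rewrite x0; ring.
  by apply: n0; split=> //; split=> //; apply: sq; rewrite -e1 x0 y0; ring.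
have y0 : y != 0.
  apply/eqP => y0; have z0 : z = 0 by apply: sq; rewrite -e1 y0; ring.
  by case/eqP: x0; apply: sq; apply: (lincomb1 e2 (-1)); rewrite y0 z0; ring.
have z0 : z != 0.
  apply/eqP => z0; case/eqP: x0; apply: sq.
  by apply: (lincomb1 e2 (-1)); rewrite z0; ring.
have n9 : (9%:R : K) != 0 by rewrite pnatr_eq0.
have n3 : (3%:R : K) != 0 by rewrite pnatr_eq0.
have tz : t * z = 3%:R * x.
  apply: (mulfI (mulf_neq0 (mulf_neq0 x0 y0) n3)).
  by apply: (lincomb3 e1 e2 e3 (4%:R * x) y (- (2%:R * z))); ring.
have yz : y * z = x ^+ 2.
  by apply: (mulfI y0); apply: (lincomb2 tz e2 (x * y / 2%:R) (- y / 2%:R)); field.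
have zz : z ^+ 2 = - (x * y).
  by apply: (mulfI x0); apply: (lincomb2 e1 tz x (- (x * y))); ring.
have xE : x = t * z / 3%:R by rewrite tz mulrC mulKf.
have yE : y = t ^+ 2 * z / 9%:R.
  by apply: (mulIf z0); rewrite yz xE; field.
split; last first.
  exists (z / 3%:R); first by rewrite mulf_neq0 // invr_eq0.
  by rewrite vecZ {1}xE {1}yE; congr vec; field.
apply: (mulIf (expf_neq0 2 z0)).
move: zz; rewrite {1}xE {1}yE => zz.
by apply: (lincomb1 zz 27%:R); field.
Qed.

Lemma singular_at_ptM t : t ^+ 3 = - 27%:R -> singular_at (cubicM t) (singular_ptM t).
Proof.
move=> t3; rewrite singular_atP /singular_ptM; split.
- by rewrite vec_eq0 !negb_and (pnatr_eq0 K 3) !orbT.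
- by rewrite evM; apply: (lincomb1 t3 (t / 3%:R)); field.
- elim/(@vecP K) => x' y' z'; rewrite dirderM.
  by apply: (lincomb1 t3 (x' / 3%:R + z' * (2%:R * t / 9%:R))); field.
Qed.

Lemma cube_root_unity : {w : K | w ^+ 2 + w + 1 = 0}.
Proof.
exists ((-1 + sqrtC (- 3%:R)) / 2%:R).
by apply: (lincomb1 (sqrtCK (- 3%:R)) (4%:R^-1)); field.
Qed.

(** For a primitive cube root of unity w, p^2 + q^2 + r^2 - pq - qr - rp = (p + wq + w^2 r)(p + w^2
    q + wr), and these two tangents are distinct. *)
Lemma split_node_ptM t : t ^+ 3 = - 27%:R -> split_node (cubicM t) (singular_ptM t).
Proof.
move=> t3; split; first exact: singular_at_ptM.
have [w w1] := cube_root_unity.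
have t0 : t != 0.
  apply: contra_eq_neq t3 => ->; rewrite expr0n /= eq_sym oppr_eq0.
  by rewrite pnatr_eq0.
have n3 : (3%:R : K) != 0 by rewrite pnatr_eq0.
have w2 : w != w ^+ 2.
  apply/eqP => e; have e2 : 2%:R * w = -1 by apply: (lincomb2 w1 e 1 1); ring.
  have : 3%:R = 0 :> K by apply: (lincomb2 w1 e2 4%:R (- 2%:R * w - 1)); ring.
  by apply/eqP.
(* In the coordinates p = x/t, q = 3y/t^2, r = z/3 the Hessian at the singular
   point is 18t (p^2+q^2+r^2-pq-qr-rp). *)
pose a : 'cV[K]_3 := (18%:R * t) *: (vec t^-1 (3%:R * w / t ^+ 2) (w ^+ 2 / 3%:R))^T.
pose b : 'cV[K]_3 := (vec t^-1 (3%:R * w ^+ 2 / t ^+ 2) (w / 3%:R))^T.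
have aE x y z : (vec x y z *m a) 0 0 =
    (18%:R * t) * (x / t + y * (3%:R * w / t ^+ 2) + z * (w ^+ 2 / 3%:R)).
  by rewrite mxE sum_ord3 !mxE /=; ring.
have bE x y z : (vec x y z *m b) 0 0 =
    x / t + y * (3%:R * w ^+ 2 / t ^+ 2) + z * (w / 3%:R).
  by rewrite mxE sum_ord3 !mxE /=; ring.
exists a, b; split.
- elim/(@vecP K) => x y z; rewrite aE bE /dirder2 vecN !vecD !evM.
  pose p := x / t; pose q := 3%:R * y / t ^+ 2; pose r := z / 3%:R.
  apply: (lincomb2 w1 t3 (- (18%:R * t * ((w - 1) * (q ^+ 2 + r ^+ 2)
      + p * q + p * r + (w ^+ 2 - w + 1) * q * r)))
    (- (2%:R / 3%:R) / t * x ^+ 2 - 6%:R / t ^+ 3 * y ^+ 2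
      + 2%:R / t ^+ 2 * x * y + 2%:R / 3%:R / t * y * z + 2%:R / 3%:R * x * z)).
  by rewrite /p /q /r; field; rewrite t0.
(* The point p = -w, q = 1, r = 0 lies on the first tangent; replacing w by w^2 gives the point of
   the second. *)
- exists (vec (- w * t) (t ^+ 2 / 3%:R) 0); rewrite ?aE ?bE; first by field.
  rewrite (_ : _ + _ = w ^+ 2 - w) ?subr_eq0 1?eq_sym //.
  by field; rewrite t0.
- exists (vec (- w ^+ 2 * t) (t ^+ 2 / 3%:R) 0); rewrite ?aE ?bE; first by field.
  rewrite (_ : _ * _ = 18%:R * t * (w - w ^+ 2)); last by field; rewrite t0.
  by rewrite !mulf_neq0 ?subr_eq0 ?pnatr_eq0.
Qed.

Definition stdV : {vspace cubic_form K} := (<[cubicN]> + <[cubicC]>)%VS.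

Lemma stdVP f : f \in stdV <-> exists a b, f = a *: cubicN + b *: cubicC.
Proof.
split=> [/memv_addP [_ /vlineP [a ->] [_ /vlineP [b ->] ->]] | [a [b ->]]].
  by exists a, b.
by apply/memv_addP; exists (a *: cubicN); [apply/vlineP; exists a|
  exists (b *: cubicC) => //; apply/vlineP; exists b].
Qed.

Lemma std_member f : f \in stdV -> f != 0 ->
  (exists2 a, a != 0 & f = a *: cubicN) \/ (exists2 a, a != 0 & exists t, f = a *: cubicW t).
Proof.
case/stdVP => a [b ->]; have [-> | b0 _] := eqVneq b 0.
  rewrite scale0r addr0 => h; left; exists a => //.
  by apply: contraNneq h => ->; rewrite scale0r.
right; exists b => //; exists (a / b).
by rewrite /cubicW scalerDr scalerA mulrC divfK // addrC.
Qed.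

Lemma cubicN_neq0 : cubicN != 0.
Proof.
apply/eqP => /(congr1 (fun f => ev f (vec 1 0 0))) /eqP.
rewrite ev0 evN (_ : _ - _ = -1) ?oppr_eq0 ?oner_eq0 //; by ring.
Qed.

Lemma cubicW_neq0 t : cubicW t != 0.
Proof.
apply/eqP => /(congr1 (fun f => ev f (vec 0 1 (- t - 1)))).
rewrite ev0 evD evZ evC evN => e; have /eqP : 1 = 0 :> K.
  by apply: (lincomb1 e 1); ring.
by rewrite oner_eq0.
Qed.

Lemma split_node_N : split_node cubicN (vec 0 0 1).
Proof.
split; first by rewrite singular_at_N; exists 1; rewrite ?oner_eq0 ?scale1r.
pose a : 'cV[K]_3 := (vec 2%:R 0 0)^T.
pose b : 'cV[K]_3 := (vec 0 1 0)^T.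
have aE x y z : (vec x y z *m a) 0 0 = 2%:R * x.
  by rewrite mxE sum_ord3 !mxE /=; ring.
have bE x y z : (vec x y z *m b) 0 0 = y.
  by rewrite mxE sum_ord3 !mxE /=; ring.
exists a, b; split.
- elim/(@vecP K) => x y z; rewrite aE bE /dirder2 vecN !vecD !evN; ring.
- by exists (vec 0 1 0); rewrite ?aE ?bE ?mulr0 ?oner_eq0.
- by exists (vec 1 0 0); rewrite ?aE ?bE ?mulr1 ?two_neq0.
Qed.

Lemma singular_at_W t v : singular_at (cubicW t) v ->
  t ^+ 3 = - 27%:R /\ exists2 k, k != 0 & v = k *: (singular_ptM t *m shear t).
Proof.
have uU := shear_unit t; rewrite -[v](mulmxKV uU) -singular_at_csub // csub_shear.
case/singular_at_M => t3 [k k0 e]; split=> //; exists k => //.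
by rewrite e scalemxAl.
Qed.

Lemma split_node_W t : t ^+ 3 = - 27%:R -> split_node (cubicW t) (singular_ptM t *m shear t).
Proof.
move=> /split_node_ptM; rewrite -csub_shear => h.
rewrite -[cubicW t](csubK (shear_unit t)); apply: split_node_csub.
  by rewrite unitmx_inv shear_unit.
by rewrite mulmxK ?shear_unit.
Qed.

Lemma singular_at_scale a f v : a != 0 ->
  singular_at (a *: f) v <-> singular_at f v.
Proof.
move=> a0; have dirderZ u : dirder (a *: f) v u = a * dirder f v u.
  by rewrite /dirder !evZ; field.
rewrite !singular_atP evZ; split=> -[v0 e d]; split=> //.
- by apply/eqP; rewrite -[_ == 0](mulrI_eq0 _ (lregP a0)) e.
- by move=> u; apply/eqP; rewrite -[_ == 0](mulrI_eq0 _ (lregP a0)) -dirderZ d.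
- by rewrite e mulr0.
- by move=> u; rewrite dirderZ d mulr0.
Qed.

Lemma split_node_scale a f v : a != 0 -> split_node f v -> split_node (a *: f) v.
Proof.
move=> a0 [sf [b [c [q [u ub uc] [w wc wb]]]]]; split.
  by rewrite singular_at_scale.
exists (a *: b), c; split.
- by move=> x; rewrite -scalemxAr mxE -mulrA -q /dirder2 !evZ; ring.
- by exists u; rewrite // -scalemxAr mxE ub mulr0.
- by exists w; rewrite // -scalemxAr mxE mulf_neq0.
Qed.

Lemma std_singular_nodal f : f \in stdV -> f != 0 -> singular f ->
  exists v, split_node f v /\ forall w, singular_at f w -> <[w]>%VS = <[v]>%VS.
Proof.
move=> fV f0 [_ [w sw]]; case: (std_member fV f0) => [[a a0 fE] | [a a0 [t fE]]].
  exists (vec 0 0 1); rewrite fE; split.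
    exact/split_node_scale/split_node_N.
  move=> v; rewrite singular_at_scale // => /singular_at_N [k k0 ->].
  exact: vlineZ.
move: sw; rewrite fE singular_at_scale // => /singular_at_W [t3 _].
exists (singular_ptM t *m shear t); split; first exact/split_node_scale/split_node_W.
move=> v; rewrite singular_at_scale // => /singular_at_W [_ [k k0 ->]].
exact: vlineZ.
Qed.

Lemma std_lineless f : f \in stdV -> f != 0 -> lineless f.
Proof.
move=> fV f0; case: (std_member fV f0) => [[a a0 ->] | [a a0 [t ->]]].
  exact/lineless_scale/lineless_N.
exact/lineless_scale/lineless_W.
Qed.

(** The ideal of the two forms contains x^6, and modulo x it contains y^3. *)
Lemma std_base x y z : ev cubicN (vec x y z) = 0 -> ev cubicC (vec x y z) = 0 ->
  x = 0 /\ y = 0.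
Proof.
rewrite evN evC => eN eC.
have x0 : x = 0.
  apply/eqP; rewrite -sqrf_eq0 -[_ == 0](expf_eq0 _ 3) -exprM; apply/eqP.
  by apply: (lincomb2 eN eC (- (x ^+ 3 + x * y * z)) (x * y ^+ 2)); ring.
split=> //; apply/eqP; rewrite -[_ == 0](expf_eq0 _ 3); apply/eqP.
by apply: (lincomb1 eN (-1)); rewrite x0; ring.
Qed.

End StandardPencil.

(** * Pencils that are standard in some coordinates *)

Section Transport.
Variable K : numClosedFieldType.
Implicit Types (f g : cubic_form K) (u v w : 'rV[K]_3) (A B : 'M[K]_3).
Implicit Types (V : {vspace cubic_form K}).

Local Notation stdV := (stdV K).
Local Notation cubicN := (cubicN K).
Local Notation cubicC := (cubicC K).

(** A is a frame in which V acquires the equations of [stdV]; its last row is the base point. *)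
Definition std_coord A V :=
  A \in unitmx /\ forall f, (f \in V) = (csub A f \in stdV).

Lemma std_coord_exists A : A \in unitmx -> exists V, std_coord A V.
Proof.
move=> uA; exists (<[csub (invmx A) cubicN]> + <[csub (invmx A) cubicC]>)%VS; split=> // f.
apply/idP/idP => [/memv_addP [_ /vlineP [a ->] [_ /vlineP [b ->] ->]] | ].
  by rewrite linearD !linearZ /= !csubVK //; apply/stdVP; exists a, b.
case/stdVP => a [b e]; rewrite -[f](csubK uA) e linearD !linearZ /=.
by rewrite memv_add // memvZ ?memv_line.
Qed.

Lemma mem_csubV A V f : std_coord A V -> (csub (invmx A) f \in V) = (f \in stdV).
Proof. by case=> uA ->; rewrite csubVK. Qed.

Lemma cubicN_std : cubicN \in stdV.
Proof. by apply/stdVP; exists 1, 0; rewrite scale1r scale0r addr0. Qed.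

Lemma cubicW_std t : cubicW t \in stdV.
Proof. by apply/stdVP; exists t, 1; rewrite scale1r addrC. Qed.

Lemma cubicC_std : cubicC \in stdV.
Proof. by apply/stdVP; exists 0, 1; rewrite scale1r scale0r add0r. Qed.

Lemma evW (t x y z : K) : ev (cubicW t) (vec x y z) =
  x * z ^+ 2 - y ^+ 2 * z - x ^+ 2 * y + t * (x * y * z - x ^+ 3 - y ^+ 3).
Proof. by rewrite evD evZ evN evC. Qed.

Lemma cubicW_inj (s t a : K) : cubicW s = a *: cubicW t -> s = t.
Proof.
move=> e.
have e1 := congr1 (fun f => ev f (vec 0 1 1)) e.
have e2 := congr1 (fun f => ev f (vec 0 1 0)) e.
move: e1 e2; rewrite !evZ !evW => e1 e2.
have a1 : a = 1 by apply: (lincomb2 e1 e2 1 (-1)); ring.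
by apply: (lincomb1 e2 (-1)); rewrite a1; ring.
Qed.

Lemma cubicW_neq_N (t a : K) : cubicW t != a *: cubicN.
Proof.
apply/eqP => e.
have := congr1 (fun f => ev f (vec 0 1 1)) e.
have := congr1 (fun f => ev f (vec 0 1 0)) e.
rewrite !evZ !evW !evN => e1 e2.
have /eqP : 1 = 0 :> K by apply: (lincomb2 e1 e2 1 (-1)); ring.
by rewrite oner_eq0.
Qed.

Lemma dim_std A V : std_coord A V -> \dim V = 2%N.
Proof.
case=> uA h.
have VE : V = <<[:: csub (invmx A) cubicN; csub (invmx A) cubicC]>>%VS.
  apply/vspaceP => f; rewrite h span_cons span_seq1.
  apply/idP/idP => [/stdVP [a [b e]]|].
    rewrite -[f](csubK uA) e linearD !linearZ /=.
    by rewrite memv_add // memvZ ?memv_line.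
  case/memv_addP => [_ /vlineP [a ->] [_ /vlineP [b ->] ->]].
  by rewrite linearD !linearZ /= !csubVK //; apply/stdVP; exists a, b.
have : free [:: csub (invmx A) cubicN; csub (invmx A) cubicC].
  have uV : invmx A \in unitmx by rewrite unitmx_inv.
  rewrite free_cons span_seq1 seq1_free csub_eq0 //; apply/andP; split; last first.
    by have := cubicW_neq0 (0 : K); rewrite /cubicW scale0r addr0.
  apply/vlineP => -[a]; rewrite -linearZ => /(can_inj (csubVK uA)) e.
  have := cubicW_neq_N 0 a^-1; rewrite e /cubicW scale0r addr0 scalerA mulVf ?scale1r ?eqxx //.
  by apply: contraNneq (cubicN_neq0 K) => a0; rewrite e a0 scale0r.
by rewrite /free VE => /eqP ->.
Qed.

Definition singular_params : seq K :=
  let w := sval (cube_root_unity K) in [:: - 3%:R; - 3%:R * w; - 3%:R * w ^+ 2].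

Lemma singular_paramsP (t : K) : (t \in singular_params) = (t ^+ 3 == - 27%:R).
Proof.
rewrite /singular_params; case: (cube_root_unity K) => w w1 /=.
have -> : (t ^+ 3 == - 27%:R) = ((t + 3%:R) * (t + 3%:R * w) * (t + 3%:R * w ^+ 2) == 0).
  rewrite -subr_eq0; congr (_ == 0).
  apply: (lincomb1 w1 (- (3%:R * t ^+ 2 + 9%:R * t * w + 27%:R * (w - 1)))); ring.
by rewrite !inE !mulf_eq0 -orbA !addr_eq0 !mulNr.
Qed.

Lemma singular_params_uniq : uniq singular_params.
Proof.
rewrite /singular_params; case: (cube_root_unity K) => w w1 /=.
have n3 : (3%:R : K) != 0 by rewrite pnatr_eq0.
have w0 : w != 0.
  apply/eqP => e; have /eqP : 1 = 0 :> K by apply: (lincomb1 w1 1); rewrite e; ring.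
  by rewrite oner_eq0.
have wn1 : w != 1.
  by apply: contraNneq n3 => e; apply/eqP; apply: (lincomb1 w1 1); rewrite e; ring.
have h1 : (- 3%:R == - 3%:R * w) = false.
  rewrite -{1}[- 3%:R]mulr1 (inj_eq (mulfI _)) ?oppr_eq0 // eq_sym.
  exact: negPf.
have h2 : (- 3%:R == - 3%:R * w ^+ 2) = false.
  rewrite -{1}[- 3%:R]mulr1 (inj_eq (mulfI _)) ?oppr_eq0 // eq_sym.
  apply/eqP => e; have e2 : w = - 2%:R by apply: (lincomb2 w1 e 1 (-1)); ring.
  by case/eqP: n3; apply: (lincomb2 e e2 1 (- w + 2%:R)); ring.
have h3 : (- 3%:R * w == - 3%:R * w ^+ 2) = false.
  rewrite (inj_eq (mulfI _)) ?oppr_eq0 // -{1}[w]mulr1 (inj_eq (mulfI w0)) eq_sym.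
  exact: negPf.
by rewrite !inE h1 h2 h3.
Qed.

Lemma ev_std_base A V v : std_coord A V -> base_point V v ->
  exists2 k, k != 0 & v = k *: (vec 0 0 1 *m A).
Proof.
move=> hA [v0 hv]; have [uA h] := hA.
have e f : f \in stdV -> f != 0 -> ev f (v *m invmx A) = 0.
  move=> fV f0; rewrite -ev_csub; apply: hv; split.
    by rewrite (mem_csubV _ hA).
  by rewrite csub_eq0 // unitmx_inv.
have C0 : cubicC != 0 by have := cubicW_neq0 (0 : K); rewrite /cubicW scale0r addr0.
have := e _ cubicN_std (cubicN_neq0 K); have := e _ cubicC_std C0.
rewrite [v *m _]vec_eta => eC eN.
have [x0 y0] := std_base eN eC.
have vE : v *m invmx A = ((v *m invmx A) 0 i2) *: vec 0 0 1.
  by rewrite {1}[v *m _]vec_eta x0 y0 vecZ !mulr0 mulr1.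
exists ((v *m invmx A) 0 i2).
  by apply: contraNneq v0 => z0; rewrite -[v](mulmxKV uA) vE z0 scale0r mul0mx.
by rewrite -{1}[v](mulmxKV uA) {1}vE scalemxAl.
Qed.

Lemma std_base_point A V : std_coord A V -> base_point V (vec 0 0 1 *m A).
Proof.
case=> uA h; split.
  by rewrite mulmx_unit_eq0 // vec_eq0 oner_eq0 !andbF.
move=> f [fV _]; have := fV; rewrite h => /stdVP [a [b e]].
rewrite -/(ev _ _) -ev_csub e evD !evZ evN evC; ring.
Qed.

Definition singular_lines A : seq {vspace cubic_form K} :=
  <[csub (invmx A) cubicN]>%VS ::
  [seq <[csub (invmx A) (cubicW t)]>%VS | t <- singular_params].

Lemma singular_std_lines A V f : std_coord A V -> f \in V -> f != 0 ->
  singular f -> <[f]>%VS \in singular_lines A.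
Proof.
move=> [uA h] fV f0 [_ [v]]; rewrite -[f](csubK uA) singular_at_csub ?unitmx_inv //.
rewrite h in fV; have f0' : csub A f != 0 by rewrite csub_eq0.
case: (std_member fV f0') => [[a a0 ->] | [a a0 [t ->]]].
  by move=> _; rewrite linearZ vlineZ // inE eqxx.
rewrite singular_at_scale // => /singular_at_W [t3 _].
rewrite linearZ vlineZ // inE; apply/orP; right.
by apply/mapP; exists t; rewrite // singular_paramsP t3.
Qed.

Lemma std_special A V : std_coord A V -> special_pencil V.
Proof.
move=> hA; have [uA h] := hA; split.
- exact: dim_std hA.
- exists (vec 0 0 1 *m A); split; first exact: std_base_point.
  by move=> w /(ev_std_base hA) [k k0 ->]; apply: vlineZ.
- exists (singular_lines A) => f [fV f0] fl; split=> // v sv.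
  by case/negP: fl; apply: (singular_std_lines hA) => //; split=> //; exists v.
- move=> f [fV f0]; apply: lineless_irreducible => //.
  by rewrite -(lineless_csub f uA); apply: std_lineless; rewrite ?csub_eq0 // -h.
Qed.

Lemma uniq_singular_lines A : A \in unitmx -> uniq (singular_lines A).
Proof.
move=> uA; have uV : invmx A \in unitmx by rewrite unitmx_inv.
have Wn t : csub (invmx A) (cubicW t) != 0 by rewrite csub_eq0 // cubicW_neq0.
rewrite /singular_lines cons_uniq map_inj_uniq ?singular_params_uniq ?andbT; last first.
  move=> s t /(vline_eqP (Wn s)) [k _]; rewrite -linearZ.
  by move/(can_inj (csubVK uA))/cubicW_inj.
apply/mapP => -[t _ /esym /(vline_eqP (Wn t)) [k _]]; rewrite -linearZ.
by move/(can_inj (csubVK uA)) => e; have := cubicW_neq_N t k; rewrite e eqxx.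
Qed.

Lemma std_exactly_four A V : std_coord A V -> exactly_singular_members 4 V.
Proof.
move=> hA; have [uA h] := hA; have uV : invmx A \in unitmx by rewrite unitmx_inv.
exists (singular_lines A); split=> [||L] //; first exact: uniq_singular_lines.
split=> [|[f [[fV f0] sf ->]]]; last exact: (singular_std_lines hA).
have mem f v : f \in stdV -> f != 0 -> singular_at f v ->
    member V (csub (invmx A) f) /\ singular (csub (invmx A) f).
  move=> fV f0 sf; have f0' : csub (invmx A) f != 0 by rewrite csub_eq0.
  split; split; rewrite ?(mem_csubV _ hA) //.
  by exists (v *m A); rewrite singular_at_csub // mulmxK.
rewrite inE => /orP [/eqP -> | /mapP [t]].
  have [sN _] := split_node_N K.
  have [m s] := mem _ _ cubicN_std (cubicN_neq0 K) sN.
  by exists (csub (invmx A) cubicN).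
rewrite singular_paramsP => /eqP t3 ->.
have [sW _] := split_node_W t3.
have [m s] := mem _ _ (cubicW_std t) (cubicW_neq0 t) sW.
by exists (csub (invmx A) (cubicW t)).
Qed.

Lemma std_nodal A V f : std_coord A V -> member V f -> singular f -> nodal_cubic f.
Proof.
move=> hA mf sf; have [uA h] := hA; split.
  by have [_ _ _] := std_special hA; apply.
have uV : invmx A \in unitmx by rewrite unitmx_inv.
have [fV f0] := mf; case: sf => _ [v sv].
have f0' : csub A f != 0 by rewrite csub_eq0.
have fV' : csub A f \in stdV by rewrite -h.
have sf' : singular (csub A f).
  by split=> //; exists (v *m invmx A); rewrite singular_at_csub // mulmxKV.
have [w [nw uw]] := std_singular_nodal fV' f0' sf'.
exists (w *m A); split.
  apply: split_node_node; rewrite -[f](csubK uA).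
  by apply: split_node_csub => //; rewrite mulmxK.
move=> x sx; have : singular_at (csub A f) (x *m invmx A).
  by rewrite singular_at_csub // mulmxKV.
have x0 : x != 0 by case: sx => -[].
have x0' : x *m invmx A != 0 by rewrite mulmx_unit_eq0.
move/uw => /(vline_eqP x0') [k k0 e].
by rewrite -[x](mulmxKV uA) e -scalemxAl vlineZ.
Qed.

Lemma std_equivalent A B V W :
  std_coord A V -> std_coord B W -> projectively_equivalent V W.
Proof.
move=> [uA hA] [uB hB].
have uAB : invmx A *m B \in unitmx by rewrite unitmx_mul unitmx_inv uA uB.
have imE f : image_equation (invmx A *m B) f = csub (invmx (invmx A *m B)) f by [].
have iE : invmx (invmx A *m B) = invmx B *m A.
  rewrite -[LHS]mulmx1 -(mulVmx uA) mulmxA -[RHS]mul1mx -(mulVmx uAB) -!mulmxA.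
  by rewrite [B *m _]mulmxA mulmxV // mul1mx.
exists (invmx A *m B); split=> // g; rewrite hB.
split=> [h | [f [fV e]]].
  exists (csub (invmx A) (csub B g)); split; first by rewrite hA csubVK.
  rewrite imE iE; congr mpoly_of_dhomog.
  by rewrite -csubM csubVK // csubK.
have {e} -> : g = csub (invmx (invmx A *m B)) f by apply: val_inj; exact: (etrans e (imE f)).
by rewrite iE -csubM csubVK // -hA.
Qed.

End Transport.

(** * Normal forms of a smooth cubic *)

(** Characteristic 0 supplies enough test points. The point 0 is exempt because dehomogenizations
    are compared only where a coordinate is invertible; the factor 'X compensates for it. *)
Lemma poly_eq0_horner (K : numDomainType) (p : {poly K}) :
  (forall x, x != 0 -> p.[x] = 0) -> p = 0.
Proof.
move=> h; suff /eqP : 'X * p = 0 by rewrite mulf_eq0 polyX_eq0 => /eqP.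
pose rs := [seq (n%:R : K) | n <- iota 0 (size ('X * p))].
apply: (@roots_geq_poly_eq0 _ _ rs); last by rewrite size_map size_iota.
  apply/allP => _ /mapP [n _ ->]; rewrite rootE hornerM hornerX.
  by have [-> | /h ->] := eqVneq (n%:R : K) 0; rewrite ?mul0r ?mulr0.
by rewrite map_inj_uniq ?iota_uniq // => m n /eqP; rewrite eqr_nat => /eqP.
Qed.

(** * Two plane cubics have a common zero *)

Section Closed.
Variable K : numClosedFieldType.

Lemma cubic_root (a b c : K) : exists z, z ^+ 3 + a * z ^+ 2 + b * z + c = 0.
Proof.
have [z e] := @solve_monicpoly K 3 (fun i => nth 0 [:: - c; - b; - a] i) isT.
by exists z; rewrite e !big_ord_recr big_ord0 /=; ring.
Qed.

Lemma quadratic_split (a b : K) : exists w1 w2, a = - (w1 + w2) /\ b = w1 * w2.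
Proof.
exists ((- a + sqrtC (a ^+ 2 - 4%:R * b)) / 2%:R),
  ((- a - sqrtC (a ^+ 2 - 4%:R * b)) / 2%:R); split; first by field.
by apply: (lincomb1 (sqrtCK (a ^+ 2 - 4%:R * b)) 4%:R^-1); field.
Qed.

Lemma cubic_split (a b c : K) : exists w1 w2 w3, [/\ a = - (w1 + w2 + w3),
  b = w1 * w2 + w1 * w3 + w2 * w3 & c = - (w1 * w2 * w3)].
Proof.
have [z ez] := cubic_root a b c.
have [w1 [w2 [e1 e2]]] := quadratic_split (a + z) (b + z * (a + z)).
exists z, w1, w2; split.
- by apply: (lincomb1 e1 1); ring.
- by apply: (lincomb2 e1 e2 (- z) 1); ring.
- by apply: (lincomb3 ez e1 e2 1 0 (- z)); ring.
Qed.

(* The product of l z^2 + q z + c over the roots z of z^3 + h1 z^2 + h2 z + h3. *)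
Definition resultant23 (R : comNzRingType) (l q c h1 h2 h3 : R) : R :=
  l ^+ 3 * h3 ^+ 2 + l ^+ 2 * q * (- (h2 * h3)) + l ^+ 2 * c * (h2 ^+ 2 - (h1 * h3) *+ 2)
  + l * q ^+ 2 * (h1 * h3) + l * q * c * (- (h1 * h2) + h3 *+ 3)
  + l * c ^+ 2 * (h1 ^+ 2 - h2 *+ 2) + q ^+ 3 * (- h3) + q ^+ 2 * c * h2
  - q * c ^+ 2 * h1 + c ^+ 3.

Lemma resultant23_root (l q c h1 h2 h3 : K) : resultant23 l q c h1 h2 h3 = 0 ->
  exists z, l * z ^+ 2 + q * z + c = 0 /\ z ^+ 3 + h1 * z ^+ 2 + h2 * z + h3 = 0.
Proof.
have [w1 [w2 [w3 [-> -> ->]]]] := cubic_split h1 h2 h3.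
rewrite (_ : resultant23 _ _ _ _ _ _ = (l * w1 ^+ 2 + q * w1 + c) *
  (l * w2 ^+ 2 + q * w2 + c) * (l * w3 ^+ 2 + q * w3 + c)); last first.
  by rewrite /resultant23; ring.
move/eqP; rewrite !mulf_eq0 => /orP [/orP [] |] /eqP e.
- by exists w1; split=> //; ring.
- by exists w2; split=> //; ring.
- by exists w3; split=> //; ring.
Qed.

Lemma horner_resultant23 (l q c h1 h2 h3 : {poly K}) (x : K) :
  (resultant23 l q c h1 h2 h3).[x] =
  resultant23 l.[x] q.[x] c.[x] h1.[x] h2.[x] h3.[x].
Proof.
by rewrite /resultant23 !(hornerMn, hornerE).
Qed.

(** If the arguments are binary forms of degrees 1, 2, 3, 1, 2, 3, the resultant is a binary form of
    degree 9, the Bezout number of two cubics. *)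
Lemma resultant23_hom (k l q c h1 h2 h3 : K) :
  resultant23 (k * l) (k ^+ 2 * q) (k ^+ 3 * c) (k * h1) (k ^+ 2 * h2) (k ^+ 3 * h3)
  = k ^+ 9 * resultant23 l q c h1 h2 h3.
Proof. by rewrite /resultant23; ring. Qed.

Section BinaryForms.
Variable S : comNzRingType.
Definition bin1 (a b x y : S) := a * x + b * y.
Definition bin2 (a b c x y : S) := a * x ^+ 2 + b * x * y + c * y ^+ 2.
Definition bin3 (a b c d x y : S) :=
  a * x ^+ 3 + b * x ^+ 2 * y + c * x * y ^+ 2 + d * y ^+ 3.

Lemma bin1_hom a b k x y : bin1 a b (k * x) (k * y) = k * bin1 a b x y.
Proof. by rewrite /bin1; ring. Qed.
Lemma bin2_hom a b c k x y : bin2 a b c (k * x) (k * y) = k ^+ 2 * bin2 a b c x y.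
Proof. by rewrite /bin2; ring. Qed.
Lemma bin3_hom a b c d k x y :
  bin3 a b c d (k * x) (k * y) = k ^+ 3 * bin3 a b c d x y.
Proof. by rewrite /bin3; ring. Qed.
End BinaryForms.

Lemma horner_bin1 (a b x y : {poly K}) t :
  (bin1 a b x y).[t] = bin1 a.[t] b.[t] x.[t] y.[t].
Proof. by rewrite /bin1 !hornerE. Qed.
Lemma horner_bin2 (a b c x y : {poly K}) t :
  (bin2 a b c x y).[t] = bin2 a.[t] b.[t] c.[t] x.[t] y.[t].
Proof. by rewrite /bin2 !hornerE. Qed.
Lemma horner_bin3 (a b c d x y : {poly K}) t :
  (bin3 a b c d x y).[t] = bin3 a.[t] b.[t] c.[t] d.[t] x.[t] y.[t].
Proof. by rewrite /bin3 !hornerE. Qed.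

(** If the dehomogenization p has a root x, then (x : 1) is a zero. If p is a nonzero constant c,
    then R is c y^n and the zero is (1 : 0). *)
Lemma homogeneous_zero (R : K -> K -> K) (n : nat) (p q : {poly K}) : (0 < n)%N ->
  (forall k x y, R (k * x) (k * y) = k ^+ n * R x y) ->
  (forall x, R x 1 = p.[x]) -> (forall y, R 1 y = q.[y]) ->
  exists x y, ~ (x = 0 /\ y = 0) /\ R x y = 0.
Proof.
move=> n0 hom pE qE; have [/eqP /size_poly1P [c c0 pc] | sp] := eqVneq (size p) 1%N.
  exists 1, 0; split; first by case=> /eqP; rewrite oner_eq0.
  have : q - c *: 'X^n = 0.
    apply: poly_eq0_horner => y y0; rewrite !hornerE -qE.
    have := hom y y^-1 1; rewrite mulfV // mulr1 pE pc hornerC => ->.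
    by rewrite mulrC subrr.
  move/subr0_eq => qc; rewrite qE qc !hornerE expr0n.
  by case: n n0 {hom qc} => //= n _; rewrite mulr0.
have /closed_rootP [x /rootP e] := sp.
by exists x, 1; split; [case=> _ /eqP; rewrite oner_eq0 | rewrite pE].
Qed.

(** Projection from (0:0:1). One may assume that g does not vanish there and, after subtracting a
    multiple of g, that f does; then f is at most quadratic in z and g, divided by its
    z^3-coefficient, is monic in z, so [resultant23] applies. *)
Lemma common_zero (f g : cubic_form K) :
  exists v, [/\ v != 0, ev f v = 0 & ev g v = 0].
Proof.
wlog g0 : f g / ev g (vec 0 0 1) != 0 => [th|].
  have [g0 | g0] := eqVneq (ev g (vec 0 0 1)) 0; last exact: th.
  have [f0 | f0] := eqVneq (ev f (vec 0 0 1)) 0.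
    by exists (vec 0 0 1); split=> //; rewrite vec_eq0 oner_eq0 !andbF.
  by have [v [v0 hf hg]] := th g f f0; exists v.
wlog f0 : f / ev f (vec 0 0 1) = 0 => [th|].
  pose k := ev f (vec 0 0 1) / ev g (vec 0 0 1).
  have [|v [v0 fv gv]] := th (f - k *: g).
    by rewrite evB evZ divfK // subrr.
  exists v; split=> //; apply: (lincomb2 fv gv 1 k).
  by rewrite evB evZ; ring.
have [c fE] := cubic_coefs f; have [d gE] := cubic_coefs g.
have c9 : c 9%N = 0 by rewrite -f0 fE evE /cubic_val; ring.
have d9 : d 9%N != 0.
  by apply: contraNneq g0 => e; apply/eqP; rewrite gE evE /cubic_val e; ring.
pose e k := d k / d 9%N.
(* The ring is left general so that the values over {poly K} at ('X, 1) and (1, 'X) are the two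
   dehomogenizations. *)
pose res (S : comNzRingType) (i : K -> S) (x y : S) := resultant23
  (bin1 (i (c 5%N)) (i (c 8%N)) x y)
  (bin2 (i (c 2%N)) (i (c 4%N)) (i (c 7%N)) x y)
  (bin3 (i (c 0%N)) (i (c 1%N)) (i (c 3%N)) (i (c 6%N)) x y)
  (bin1 (i (e 5%N)) (i (e 8%N)) x y)
  (bin2 (i (e 2%N)) (i (e 4%N)) (i (e 7%N)) x y)
  (bin3 (i (e 0%N)) (i (e 1%N)) (i (e 3%N)) (i (e 6%N)) x y).
have [x [y [xy0 /resultant23_root [z [e1 e2]]]]] :
    exists x y, ~ (x = 0 /\ y = 0) /\ res K id x y = 0.
  apply: (@homogeneous_zero _ 9 (res {poly K} polyC 'X 1) (res {poly K} polyC 1 'X)) => //.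
  - by move=> k x y; rewrite /res !bin1_hom !bin2_hom !bin3_hom resultant23_hom.
  - by move=> x; rewrite /res horner_resultant23 !horner_bin1 !horner_bin2
      !horner_bin3 !hornerE.
  - by move=> y; rewrite /res horner_resultant23 !horner_bin1 !horner_bin2
      !horner_bin3 !hornerE.
rewrite /bin1 /bin2 /bin3 /e /= in e1 e2.
exists (vec x y z); split.
- by apply/negP; rewrite vec_eq0 => /and3P [/eqP x0 /eqP y0 _];
  apply: xy0.
- by rewrite fE evE -[RHS]e1 /cubic_val c9 /=; ring.
- by rewrite gE evE; apply: (lincomb1 e2 (d 9%N)); rewrite /cubic_val /=; field.
Qed.

End Closed.

(** * Flexes and the Weierstrass equation *)

Section Weierstrass.
Variable K : numClosedFieldType.
Implicit Types (f g : cubic_form K) (u v w : 'rV[K]_3) (A B : 'M[K]_3).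

Lemma det2 (M : 'M[K]_2) : \det M = M 0 0 * M 1 1 - M 0 1 * M 1 0.
Proof.
rewrite (expand_det_row _ 0) !big_ord_recl big_ord0 /cofactor !det_mx11 !mxE.
rewrite addr0 /= expr0 expr1 mul1r mulN1r mulrN.
by congr (_ * _ - _ * _); congr (M _ _); apply: val_inj.
Qed.

Lemma det_rows3 u v w : \det (rows3 u v w) = det3 u v w.
Proof.
rewrite (expand_det_row _ i0) sum_ord3 /cofactor !det2 !mxE /= /det3.
have l1 : lift i0 0 = i1 by apply: val_inj.
have l2 : lift i0 1 = i2 by apply: val_inj.
have l3 : lift i1 0 = i0 by apply: val_inj.
have l4 : lift i1 1 = i2 by apply: val_inj.
have l5 : lift i2 0 = i0 by apply: val_inj.
have l6 : lift i2 1 = i1 by apply: val_inj.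
by rewrite !l1 !l2 !l3 !l4 !l5 !l6 /=; ring.
Qed.

Lemma det3_kernel u v w : det3 u v w = 0 ->
  exists2 z : 'rV[K]_3, z != 0 &
  [/\ (u *m z^T) 0 0 = 0, (v *m z^T) 0 0 = 0 & (w *m z^T) 0 0 = 0].
Proof.
rewrite -det_rows3 -det_tr => /eqP /det0P [z z0 e]; exists z => //.
have {e}e i : (row i (rows3 u v w) *m z^T) 0 0 = 0.
  have /rowP/(_ i) := e; rewrite [X in _ = X]mxE => <-; rewrite [RHS]mxE mxE.
  by apply: eq_bigr => j _; rewrite !mxE mulrC.
by have := (e i0, e i1, e i2); rewrite !rowK => -[[-> ->] ->].
Qed.

Lemma cross_eq0 u v : u != 0 -> cross u v = 0 -> exists k, v = k *: u.
Proof.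
elim/(@vecP K): u => x y z; elim/(@vecP K): v => x' y' z' u0 /eqP.
rewrite /cross vec_eq0 !vecE => /and3P [/eqP e1 /eqP e2 /eqP e3].
move: u0; rewrite vec_eq0 !negb_and => /orP [x0 | /orP [y0 | z0]].
- exists (x' / x); rewrite vecZ; congr vec; apply: (mulfI x0).
  + by field.
  + by apply: (lincomb1 e3 1); field.
  + by apply: (lincomb1 e2 (-1)); field.
- exists (y' / y); rewrite vecZ; congr vec; apply: (mulfI y0).
  + by apply: (lincomb1 e3 (-1)); field.
  + by field.
  + by apply: (lincomb1 e1 1); field.
- exists (z' / z); rewrite vecZ; congr vec; apply: (mulfI z0).
  + by apply: (lincomb1 e2 1); field.
  + by apply: (lincomb1 e1 (-1)); field.
  + by field.
Qed.

Lemma complete_basis u v : cross u v != 0 -> exists w, det3 u v w != 0.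
Proof.
have dE w : det3 u v w = cross u v 0 i0 * w 0 i0 + cross u v 0 i1 * w 0 i1
    + cross u v 0 i2 * w 0 i2 by rewrite /det3 /cross !vecE; ring.
move: (cross u v) dE => cr dE.
rewrite [cr]vec_eta vec_eq0 !negb_and => /orP [h | /orP [h | h]].
- by exists (vec 1 0 0); rewrite dE !vecE !mulr0 !addr0 mulr1.
- by exists (vec 0 1 0); rewrite dE !vecE !mulr0 addr0 add0r mulr1.
- by exists (vec 0 0 1); rewrite dE !vecE !mulr0 !add0r mulr1.
Qed.

Section Hessian.
Variable c : nat -> K.

(** Second partial derivatives of a cubic are linear forms; these are their coefficient columns. *)
Definition hess_x : 'cV[K]_3 := (vec (6%:R * c 0%N) (2%:R * c 1%N) (2%:R * c 2%N))^T.
Definition hess_xy : 'cV[K]_3 := (vec (2%:R * c 1%N) (2%:R * c 3%N) (c 4%N))^T.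
Definition hess_xz : 'cV[K]_3 := (vec (2%:R * c 2%N) (c 4%N) (2%:R * c 5%N))^T.
Definition hess_y : 'cV[K]_3 := (vec (2%:R * c 3%N) (6%:R * c 6%N) (2%:R * c 7%N))^T.
Definition hess_yz : 'cV[K]_3 := (vec (c 4%N) (2%:R * c 7%N) (2%:R * c 8%N))^T.
Definition hess_z : 'cV[K]_3 := (vec (2%:R * c 5%N) (2%:R * c 8%N) (6%:R * c 9%N))^T.

Definition hess_row1 v := vec ((v *m hess_x) 0 0) ((v *m hess_xy) 0 0) ((v *m hess_xz) 0 0).
Definition hess_row2 v := vec ((v *m hess_xy) 0 0) ((v *m hess_y) 0 0) ((v *m hess_yz) 0 0).
Definition hess_row3 v := vec ((v *m hess_xz) 0 0) ((v *m hess_yz) 0 0) ((v *m hess_z) 0 0).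

Lemma hessian_form : exists h : cubic_form K,
  forall v, ev h v = det3 (hess_row1 v) (hess_row2 v) (hess_row3 v).
Proof.
pose l := @linear_form K.
pose h := l hess_x * (l hess_y * l hess_z - l hess_yz * l hess_yz)
  - l hess_xy * (l hess_xy * l hess_z - l hess_yz * l hess_xz)
  + l hess_xz * (l hess_xy * l hess_yz - l hess_y * l hess_xz).
have lh a : l a \is 1.-homog by apply: linear_form_homog.
have hh : h \is 3.-homog.
  have l2 a b : l a * l b \is 2.-homog by apply: (dhomogM (lh a) (lh b)).
  have l3 a (q : {mpoly K[3]}) : q \is 2.-homog -> l a * q \is 3.-homog.
    by move=> hq; apply: (dhomogM (lh a) hq).
  by rewrite !(rpredD, rpredN) // l3 // rpredB.
exists (DHomog hh) => v; rewrite /ev /= /h !(mevalD, mevalN, mevalM).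
by rewrite !meval_linear_form /det3 !vecE.
Qed.

Definition dotv u v := u 0 i0 * v 0 i0 + u 0 i1 * v 0 i1 + u 0 i2 * v 0 i2.

Lemma ev_hessian v u a s :
  ev (cubic_of c) (a *: v + s *: u) = a ^+ 3 * ev (cubic_of c) v
   + a ^+ 2 * s / 2%:R * (v 0 i0 * dotv (hess_row1 v) u
        + v 0 i1 * dotv (hess_row2 v) u + v 0 i2 * dotv (hess_row3 v) u)
   + a * s ^+ 2 / 2%:R * (u 0 i0 * dotv (hess_row1 v) u
        + u 0 i1 * dotv (hess_row2 v) u + u 0 i2 * dotv (hess_row3 v) u)
   + s ^+ 3 * ev (cubic_of c) u.
Proof.
elim/(@vecP K): v => x y z; elim/(@vecP K): u => x' y' z'.
rewrite !vecZ vecD !evE /dotv !vecE.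
have dE (a1 a2 a3 b1 b2 b3 : K) :
    (vec a1 a2 a3 *m (vec b1 b2 b3)^T) 0 0 = a1 * b1 + a2 * b2 + a3 * b3.
  by rewrite mxE sum_ord3 ![_^T _ _]mxE !vecE.
by rewrite !dE /cubic_val; field.
Qed.

Lemma dirder_hessian v u : dirder (cubic_of c) v u =
  (u 0 i0 * dotv (hess_row1 v) v + u 0 i1 * dotv (hess_row2 v) v
   + u 0 i2 * dotv (hess_row3 v) v) / 2%:R.
Proof.
elim/(@vecP K): v => x y z; elim/(@vecP K): u => x' y' z'.
rewrite /dirder vecN !vecD !evE /dotv !vecE.
have dE (a1 a2 a3 b1 b2 b3 : K) :
    (vec a1 a2 a3 *m (vec b1 b2 b3)^T) 0 0 = a1 * b1 + a2 * b2 + a3 * b3.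
  by rewrite mxE sum_ord3 ![_^T _ _]mxE !vecE.
by rewrite !dE /cubic_val; field.
Qed.

End Hessian.

(* A zero v of both f and its Hessian is a flex: the tangent line is spanned by
   v and a vector u killed by the Hessian matrix. *)
Lemma flex f : smooth f -> exists v u, cross u v != 0 /\
  forall a s, ev f (a *: v + s *: u) = s ^+ 3 * ev f u.
Proof.
have [c ->] := cubic_coefs f => -[_ sm].
have [h hE] := hessian_form c.
have [v [v0 fv]] := common_zero (cubic_of c) h; rewrite hE => /det3_kernel.
have dotE u w : (u *m w^T) 0 0 = dotv u w by rewrite mxE sum_ord3 !mxE.
case=> u u0; rewrite !dotE => -[e1 e2 e3].
exists v, u; split; last first.
  by move=> a s; rewrite ev_hessian fv e1 e2 e3; ring.
apply/eqP => /(cross_eq0 u0) [k vE]; apply: (sm v); apply/singular_atP.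
split=> // w; rewrite dirder_hessian.
have dk z : dotv z u = 0 -> dotv z v = 0.
  move=> e; rewrite vE; apply: (lincomb1 e k).
  by rewrite /dotv ![(k *: u) _ _]mxE; ring.
by rewrite !dk //; ring.
Qed.

(** G is a mere function of the coordinates, so a further substitution is checked by [ring] on
    values. *)
Definition nform f (G : K -> K -> K -> K) := exists A, A \in unitmx /\
  forall x y z, ev f (vec x y z *m A) = G x y z.

Lemma nform_sub f G a1 a2 a3 b1 b2 b3 c1 c2 c3 (H : K -> K -> K -> K) : nform f G ->
  det3 (vec a1 a2 a3) (vec b1 b2 b3) (vec c1 c2 c3) != 0 ->
  (forall x y z, H x y z = G (x * a1 + y * b1 + z * c1)
     (x * a2 + y * b2 + z * c2) (x * a3 + y * b3 + z * c3)) -> nform f H.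
Proof.
move=> [A [uA h]] d HE.
exists (rows3 (vec a1 a2 a3) (vec b1 b2 b3) (vec c1 c2 c3) *m A); split.
  by rewrite unitmx_mul rows3_unit.
by move=> x y z; rewrite mulmxA !mulv h HE.
Qed.

Lemma smooth_csub_nform f g A : smooth f -> A \in unitmx ->
  (forall v, ev f (v *m A) = ev g v) -> smooth g.
Proof.
move=> sf uA h; have -> : g = csub A f by apply: ev_inj => v; rewrite ev_csub h.
by rewrite smooth_csub.
Qed.

Lemma dirder_cubic_of (c : nat -> K) x y z x' y' z' :
  dirder (cubic_of c) (vec x y z) (vec x' y' z') =
  x' * (3%:R * c 0%N * x ^+ 2 + 2%:R * c 1%N * x * y + 2%:R * c 2%N * x * z
     + c 3%N * y ^+ 2 + c 4%N * y * z + c 5%N * z ^+ 2)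
  + y' * (c 1%N * x ^+ 2 + 2%:R * c 3%N * x * y + c 4%N * x * z
     + 3%:R * c 6%N * y ^+ 2 + 2%:R * c 7%N * y * z + c 8%N * z ^+ 2)
  + z' * (c 2%N * x ^+ 2 + c 4%N * x * y + 2%:R * c 5%N * x * z
     + c 7%N * y ^+ 2 + 2%:R * c 8%N * y * z + 3%:R * c 9%N * z ^+ 2).
Proof. by rewrite /dirder vecN !vecD !evE /cubic_val; field. Qed.

Definition weier p q (x y z : K) :=
  y ^+ 2 * z - x ^+ 3 - p * x * z ^+ 2 - q * z ^+ 3.

(** In the basis (u, P, w) the flex is (0:1:0) and its tangent z = 0, where f restricts to a
    multiple of x^3. Completing the square in y and the cube in x does the rest. *)
Lemma weierstrass f : smooth f -> exists p q, nform f (weier p q).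
Proof.
move=> sf; have [P [u [up hP]]] := flex sf.
have [w dw] := complete_basis up.
pose A := rows3 u P w; have uA : A \in unitmx by apply: rows3_unit.
have [c cE] := cubic_coefs (csub A f).
have hz x y : cubic_val c x y 0 = x ^+ 3 * ev f u.
  by rewrite -evE -cE ev_csub mul_vec_rows3 scale0r addr0 addrC hP.
have sm : smooth (cubic_of c) by rewrite -cE smooth_csub.
have c6 : c 6%N = 0 by apply: (lincomb1 (hz 0 1) 1); rewrite /cubic_val; ring.
have c0 : c 0%N = ev f u by apply: (lincomb1 (hz 1 0) 1); rewrite /cubic_val; ring.
have [c1 c3] : c 1%N = 0 /\ c 3%N = 0.
  have e1 := hz 1 1; have e2 := hz (-1) 1; rewrite /cubic_val c0 c6 in e1 e2.
  by split; [apply: (lincomb2 e1 e2 (2%:R^-1) (2%:R^-1))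
    | apply: (lincomb2 e1 e2 (2%:R^-1) (- 2%:R^-1))]; field.
(* Smoothness on the line z = 0: c7 = 0 would make the flex singular, and c0 = 0 would split off the
   line z = 0, which meets the residual conic in a singular point. *)
have nsing x y : vec x y 0 != 0 -> c 0%N * x = 0 ->
    c 2%N * x ^+ 2 + c 4%N * x * y + c 7%N * y ^+ 2 = 0 -> False.
  move=> v0 e1 e2; case: sm => _ /(_ (vec x y 0)); apply; apply/singular_atP; split=> //.
    by rewrite evE; apply: (lincomb1 e1 (x ^+ 2)); rewrite /cubic_val c1 c3 c6; ring.
  elim/(@vecP K) => x' y' z'; rewrite dirder_cubic_of.
  by apply: (lincomb2 e1 e2 (3%:R * x' * x) z'); rewrite c1 c3 c6; ring.
have n7 : c 7%N != 0.
  apply/eqP => e; apply: (nsing 0 1); rewrite ?e ?vec_eq0 ?oner_eq0 ?andbF //; ring.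
have n0 : c 0%N != 0.
  apply/eqP => e.
  have [y1 [y2 [h1 h2]]] := quadratic_split (c 4%N / c 7%N) (c 2%N / c 7%N).
  apply: (nsing 1 y1); rewrite ?e ?vec_eq0 ?oner_eq0 ?mul0r //.
  by apply: (lincomb2 h1 h2 (c 7%N * y1) (c 7%N)); field.
pose b2 := c 2%N - c 4%N ^+ 2 / (4%:R * c 7%N).
pose b5 := c 5%N - c 4%N * c 8%N / (2%:R * c 7%N).
pose b9 := c 9%N - c 8%N ^+ 2 / (4%:R * c 7%N).
have nf1 : nform f (fun x y z => c 0%N * x ^+ 3 + c 7%N * y ^+ 2 * z
    + b2 * x ^+ 2 * z + b5 * x * z ^+ 2 + b9 * z ^+ 3).
  apply: (@nform_sub f (cubic_val c) 1 (- c 4%N / (2%:R * c 7%N)) 0 0 1 0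
    0 (- c 8%N / (2%:R * c 7%N)) 1).
  - by exists A; split=> // x y z; rewrite -ev_csub cE evE.
  - by rewrite /det3 !vecE (_ : _ + _ = 1) ?oner_eq0 //; ring.
  - by move=> x y z; rewrite /cubic_val c1 c3 c6 /b2 /b5 /b9; field.
have [al eal] := cubic_root 0 0 (c 0%N)^-1.
have al0 : al != 0.
  apply: contraNneq (invr_neq0 n0) => e; apply/eqP.
  by apply: (lincomb1 eal 1); rewrite e; ring.
have al3 : c 0%N * al ^+ 3 = -1 by apply: (lincomb1 eal (c 0%N)); field.
(* With al these normalize the coefficients of x^3 and y^2 z to -1 and 1 and remove x^2 z. *)
pose ga := (c 7%N)^-1; pose be := - b2 * ga / (3%:R * c 0%N).
exists (- (3%:R * c 0%N * al * be ^+ 2 + 2%:R * b2 * al * be * ga + b5 * al * ga ^+ 2)),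
  (- (c 0%N * be ^+ 3 + b2 * be ^+ 2 * ga + b5 * be * ga ^+ 2 + b9 * ga ^+ 3)).
apply: (@nform_sub f _ al 0 0 0 1 0 be 0 ga _ nf1).
  rewrite /det3 !vecE (_ : _ + _ = al * ga) ?mulf_neq0 ?invr_eq0 //.
  by ring.
move=> x y z; rewrite /weier.
apply: (lincomb1 al3 (- x ^+ 3)); rewrite /be /ga; field.
by rewrite n0 n7.
Qed.

End Weierstrass.

(** * From the Weierstrass equation to the standard form *)

Section CyclicForm.
Variable K : numClosedFieldType.
Implicit Types (f g : cubic_form K) (u v w : 'rV[K]_3) (A B : 'M[K]_3).

(** The conditions say x^3 + px + q = (x - r)^3 + (mx + n)^2: the line y = mx + n is an inflectional
    tangent, at x = r. Eliminating n and r leaves an equation of degree 8 for m, one solution for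
    each finite flex; for p = 0 the horizontal tangent m = 0 is taken. *)
Lemma cube_plus_square (p q : K) : exists m n r,
  [/\ m ^+ 2 = 3%:R * r, 2%:R * m * n + 3%:R * r ^+ 2 = p & n ^+ 2 - r ^+ 3 = q].
Proof.
have [p0 | p0] := eqVneq p 0.
  exists 0, (sqrtC q), 0; split; [ring | rewrite p0; ring |].
  by rewrite sqrtCK; ring.
have [m em] := @solve_monicpoly K 8 (fun i => nth 0
  [:: 27%:R * p ^+ 2; 0; - 108%:R * q; 0; - 18%:R * p] i) isT.
move: em; rewrite !big_ord_recr big_ord0 /= => em.
have m0 : m != 0.
  apply: contraNneq p0 => m0; rewrite -sqrf_eq0; apply/eqP.
  by apply: (lincomb1 em (- 27%:R^-1)); rewrite m0; field.
exists m, ((p - m ^+ 4 / 3%:R) / (2%:R * m)), (m ^+ 2 / 3%:R); split; try by field.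
by apply: (lincomb1 em (- (108%:R * m ^+ 2)^-1 )); field.
Qed.

Lemma smooth_nform f (c : nat -> K) : smooth f -> nform f (cubic_val c) -> smooth (cubic_of c).
Proof.
move=> sf [A [uA h]]; apply: (smooth_csub_nform sf uA) => v.
by elim/(@vecP K): v => x y z; rewrite h evE.
Qed.

Lemma smooth_gradient (c : nat -> K) v : smooth (cubic_of c) -> v != 0 ->
  ev (cubic_of c) v = 0 -> ~ (forall u, dirder (cubic_of c) v u = 0).
Proof. by move=> [_ sm] v0 e d; apply: (sm v); apply/singular_atP. Qed.

(** The factors y, z and y + ax + bz are the tangents at three flexes on the line x = 0. If b = 0
    they are concurrent at (0:0:1), which is then a singular point. *)
Lemma flexes_form f : smooth f -> exists a b, b != 0 /\
  nform f (fun x y z => y * z * (y + a * x + b * z) - x ^+ 3).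
Proof.
move=> sf; have [p [q nf]] := weierstrass sf.
have [m [n [r [e1 e2 e3]]]] := cube_plus_square p q.
pose a := 2%:R * m; pose b := 2%:R * (n + m * r).
have nf1 : nform f (fun x y z => y * z * (y + a * x + b * z) - x ^+ 3).
  apply: (@nform_sub _ f _ 1 m 0 0 1 0 r (n + m * r) 1 _ nf).
    by rewrite /det3 !vecE (_ : _ + _ = 1) ?oner_eq0 //; ring.
  move=> x y z; rewrite /weier -e2 -e3 /a /b.
  by apply: (lincomb1 e1 (- (x + r * z) ^+ 2 * z)); ring.
exists a, b; split=> //; apply/eqP => b0.
have nf2 : nform f (cubic_val (nth 0 [:: -1; 0; 0; 0; a; 0; 0; 1; 0; 0])).
  apply: (@nform_sub _ f _ 1 0 0 0 1 0 0 0 1 _ nf1).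
    by rewrite /det3 !vecE (_ : _ + _ = 1) ?oner_eq0 //; ring.
  by move=> x y z; rewrite /cubic_val b0 /=; ring.
apply: (smooth_gradient (smooth_nform sf nf2) (v := vec 0 0 1)).
- by rewrite vec_eq0 oner_eq0 !andbF.
- by rewrite evE /cubic_val /=; ring.
- by elim/(@vecP K) => x y z; rewrite dirder_cubic_of /=; ring.
Qed.

Lemma cube_rootP (a : K) : exists r, r ^+ 3 = a.
Proof. by have [z e] := cubic_root 0 0 (- a); exists z; apply: (lincomb1 e 1); ring. Qed.

(** Up to scalars, the three flex tangents become -ax + w^i y + w^(2i) z, whose product is -a^3 x^3
    + y^3 + z^3 + 3axyz; the cube of the line through the flexes only changes the coefficient of
    x^3. For al = 0 the point (1:0:0) is singular. *)
Lemma diag_form f : smooth f -> exists a al, al != 0 /\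
  nform f (fun x y z => al * x ^+ 3 + y ^+ 3 + z ^+ 3 + 3%:R * a * x * y * z).
Proof.
move=> sf; have [a [b [b0 nf]]] := flexes_form sf.
have [w w1] := cube_root_unity K.
have n3 : (3%:R : K) != 0 by rewrite pnatr_eq0.
have w2 : 2%:R * w + 1 != 0.
  apply: contraNneq n3 => e; apply/eqP; apply: (lincomb2 w1 e 4%:R (- (2%:R * w + 1))).
  by ring.
have [k k3] := cube_rootP (- 27%:R * b).
have k0 : k != 0.
  apply/eqP => k0; have /eqP : 27%:R * b = 0 by apply: (lincomb1 k3 1); rewrite k0; ring.
  by rewrite mulf_eq0 (negPf b0) pnatr_eq0.
pose al := 27%:R * b - a ^+ 3.
have nf1 : nform f (fun x y z => al * x ^+ 3 + y ^+ 3 + z ^+ 3 + 3%:R * a * x * y * z).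
  apply: (@nform_sub _ f _ k (- k * a / 3%:R) (- k * a / (3%:R * b))
     0 (k / 3%:R) (k * (- 1 - w) / (3%:R * b)) 0 (k / 3%:R) (k * w / (3%:R * b)) _ nf).
    rewrite /det3 !vecE (_ : _ + _ = k ^+ 3 * (2%:R * w + 1) / (9%:R * b)).
      by rewrite !mulf_neq0 ?expf_neq0 // invr_eq0 mulf_neq0 // pnatr_eq0.
    by field; rewrite b0.
  move=> x y z; rewrite /al.
  apply: (lincomb2 w1 k3 (- k ^+ 3 * (- a * x + y + z) * (y - z) ^+ 2 / (27%:R * b))
    ((al * x ^+ 3 + y ^+ 3 + z ^+ 3 + 3%:R * a * x * y * z) / (27%:R * b))).
  by rewrite /al; field; rewrite b0.
exists a, al; split=> //; apply/eqP => al0.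
have nf2 : nform f (cubic_val (nth 0 [:: 0; 0; 0; 0; 3%:R * a; 0; 1; 0; 0; 1])).
  apply: (@nform_sub _ f _ 1 0 0 0 1 0 0 0 1 _ nf1).
    by rewrite /det3 !vecE (_ : _ + _ = 1) ?oner_eq0 //; ring.
  by move=> x y z; rewrite /cubic_val al0 /=; ring.
apply: (smooth_gradient (smooth_nform sf nf2) (v := vec 1 0 0)).
- by rewrite vec_eq0 oner_eq0.
- by rewrite evE /cubic_val /=; ring.
- by elim/(@vecP K) => x y z; rewrite dirder_cubic_of /=; ring.
Qed.

Lemma M_form f : smooth f -> exists t, nform f (fun x y z => ev (cubicM t) (vec x y z)).
Proof.
move=> sf; have [a [al [al0 nf]]] := diag_form sf.
have [w w1] := cube_root_unity K.
have n3 : (3%:R : K) != 0 by rewrite pnatr_eq0.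
have w2 : w - 1 != 0.
  apply: contraNneq n3 => e; apply/eqP; apply: (lincomb2 w1 e 1 (- w - 2%:R)).
  by ring.
have w21 : 2%:R * w + 1 != 0.
  apply: contraNneq n3 => e; apply/eqP; apply: (lincomb2 w1 e 4%:R (- (2%:R * w + 1))).
  by ring.
have w0 : w != 0.
  apply/eqP => e; have /eqP : 1 = 0 :> K by apply: (lincomb1 w1 1); rewrite e; ring.
  by rewrite oner_eq0.
have w3 : w + 1 != 0.
  apply: contraNneq w0 => e; rewrite -sqrf_eq0.
  by apply/eqP; apply: (lincomb2 w1 e 1 (-1)); ring.
(* With w^2+w+1 = 0, the form be1 x^3 + y^3 + ga z^3 + de x y z, where
   be1 = -(w^2 + w ga) and de = (w^2-1) + (w-1) ga, becomes a combination of
   x^2y + y^2z + z^2x and xyz in the coordinates permuted by the cyclic group. *)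
have [ga ega] : exists ga, al * (w - 1) ^+ 3 * (w + 1 + ga) ^+ 3 =
    - (27%:R * a ^+ 3 * (w ^+ 2 + w * ga) * ga).
  have [ga e] := cubic_root (3%:R * (w + 1) + 27%:R * a ^+ 3 * w / (al * (w - 1) ^+ 3))
    (3%:R * (w + 1) ^+ 2 + 27%:R * a ^+ 3 * w ^+ 2 / (al * (w - 1) ^+ 3)) ((w + 1) ^+ 3).
  exists ga; apply: (lincomb1 e (al * (w - 1) ^+ 3)).
  by field; rewrite al0 w2.
have ga0 : ga != 0.
  apply/eqP => e; have : al * (w - 1) ^+ 3 * (w + 1) ^+ 3 = 0.
    by move: ega; rewrite e addr0 !mulr0 oppr0.
  by apply/eqP; rewrite !mulf_neq0 ?expf_neq0.
pose de := (w - 1) * (w + 1 + ga); pose be := - (w ^+ 2 + w * ga).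
have [l3 el3] := cube_rootP ga.
have l30 : l3 != 0 by apply: contraNneq ga0 => e; rewrite -el3 e expr0n.
(* The scalings l1 of x and l3 of z must satisfy both equations; they are compatible iff al de^3 =
   27 a^3 be ga, which is the equation that defines ga. For a = 0 it says de = 0. *)
have [l1 [e1 e2]] : exists l1, al * l1 ^+ 3 = be /\ 3%:R * a * l1 * l3 = de.
  have [a0 | a0] := eqVneq a 0.
    have d0 : w + 1 + ga = 0.
      apply/eqP; rewrite -[_ == 0](expf_eq0 _ 3); apply/eqP.
      apply: (mulfI (mulf_neq0 al0 (expf_neq0 3 w2))); rewrite ega a0; ring.
    have [l1 e] := cube_rootP (be / al); exists l1; rewrite e.
    by split; [field | rewrite a0 /de d0; ring].
  exists (de / (3%:R * a * l3)); split; last by field; rewrite a0 l30.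
  have -> : al * (de / (3%:R * a * l3)) ^+ 3 = al * de ^+ 3 / (27%:R * a ^+ 3 * l3 ^+ 3).
    by field; rewrite a0 l30.
  rewrite el3 /de exprMn mulrA ega /be; field; rewrite ga0 a0 //.
have nf1 : nform f (fun x y z => be * x ^+ 3 + y ^+ 3 + ga * z ^+ 3 + de * x * y * z).
  have l10 : l1 != 0.
    apply/eqP => l10; have ga1 : w * (w + ga) = 0.
      by apply: (lincomb1 e1 1); rewrite l10 /be; ring.
    have {}ga1 : w + ga = 0 by apply: (mulfI w0); rewrite ga1 mulr0.
    have : al * (w - 1) ^+ 3 = 0.
      apply: (lincomb2 ega ga1 1 (- al * (w - 1) ^+ 3 * ((w + ga) ^+ 2
        + 3%:R * (w + ga) + 3%:R) - 27%:R * a ^+ 3 * w * ga)); ring.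
    by apply/eqP; rewrite mulf_neq0 ?expf_neq0.
  apply: (@nform_sub _ f _ l1 0 0 0 1 0 0 0 l3 _ nf).
    by rewrite /det3 !vecE (_ : _ + _ = l1 * l3) ?mulf_neq0 //; ring.
  by move=> x y z; rewrite -e1 -e2 -el3; ring.
pose v2 := - 1 - w.
pose s := (2%:R * w + 1) * (1 - ga); pose ta := be + 1 + ga.
(* The rows of the substitution are the eigenvectors (1, w^i, w^(2i)) of the cyclic permutation. *)
have nf2 : nform f (fun x y z => 3%:R * s * (x ^+ 2 * y + y ^+ 2 * z + z ^+ 2 * x)
    + 9%:R * ta * x * y * z).
  apply: (@nform_sub _ f _ 1 1 1 1 w v2 1 v2 w _ nf1).
    rewrite /det3 !vecE (_ : _ + _ = - 3%:R * (2%:R * w + 1)); last first.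
      by rewrite /v2; ring.
    by rewrite mulf_neq0 ?oppr_eq0.
  move=> x y z; rewrite /s /ta /be /de /v2.
  apply: (lincomb1 w1 (- (((w - 1) * y ^+ 3 + (v2 - 1) * z ^+ 3 + 3%:R * x * y ^+ 2
    - 6%:R * x * y * z + 3%:R * x * z ^+ 2 - 3%:R * w * y ^+ 2 * z
    - 3%:R * v2 * y * z ^+ 2)
    + ga * ((w - 1) * z ^+ 3 + (v2 - 1) * y ^+ 3 + 3%:R * x * z ^+ 2
    - 6%:R * x * y * z + 3%:R * x * y ^+ 2 - 3%:R * w * y * z ^+ 2
    - 3%:R * v2 * y ^+ 2 * z)
    - de * (x + y + z) * (y - z) ^+ 2
    - 3%:R * (x ^+ 2 * y + y ^+ 2 * z + z ^+ 2 * x)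
    - 3%:R * (x * y ^+ 2 + y * z ^+ 2 + z * x ^+ 2)))).
  by rewrite /de /v2; ring.
(* For s = 0 the form is a multiple of xyz, singular at (1:0:0). *)
have s0 : s != 0.
  rewrite mulf_neq0 //; apply/eqP => g1.
  have nf3 : nform f (cubic_val (nth 0 [:: 0; 0; 0; 0; 9%:R * ta; 0; 0; 0; 0; 0])).
    apply: (@nform_sub _ f _ 1 0 0 0 1 0 0 0 1 _ nf2).
      by rewrite /det3 !vecE (_ : _ + _ = 1) ?oner_eq0 //; ring.
    by move=> x y z; rewrite /cubic_val /s g1 /=; ring.
  apply: (smooth_gradient (smooth_nform sf nf3) (v := vec 1 0 0)).
  - by rewrite vec_eq0 oner_eq0.
  - by rewrite evE /cubic_val /=; ring.
  - by elim/(@vecP K) => x y z; rewrite dirder_cubic_of /=; ring.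
have [k ek] := cube_rootP (3%:R * s)^-1.
have k0 : k != 0.
  apply: contraNneq (invr_neq0 (mulf_neq0 n3 s0)) => e.
  by rewrite -ek e expr0n.
exists (3%:R * ta / s).
(* The signs turn x^2 y + y^2 z + z^2 x into xz^2 - y^2 z - x^2 y. *)
apply: (@nform_sub _ f _ k 0 0 0 (- k) 0 0 0 (- k) _ nf2).
  by rewrite /det3 !vecE (_ : _ + _ = k ^+ 3) ?expf_neq0 //; ring.
move=> x y z; rewrite evM.
apply: (lincomb1 ek (- (3%:R * s * (x * z ^+ 2 - x ^+ 2 * y - y ^+ 2 * z)
  + 9%:R * ta * x * y * z))).
by field; rewrite s0.
Qed.

Lemma special_form f : smooth f -> exists t A, A \in unitmx /\ csub A f = cubicW t.
Proof.
move=> /M_form [t [A [uA h]]]; have uU := shear_unit t.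
exists t, (invmx (shear t) *m A); rewrite unitmx_mul unitmx_inv uU; split=> //.
rewrite -csubM; apply: (can_inj (csubK uU)); rewrite csubVK // csub_shear.
by apply: ev_inj; elim/(@vecP K) => x y z; rewrite -h ev_csub.
Qed.

Lemma smooth_in_special f : smooth f ->
  exists V : {vspace cubic_form K}, special_pencil V /\ member V f.
Proof.
move=> sf; have [t [A [uA e]]] := special_form sf.
have [V hV] := std_coord_exists uA; exists V; split; first exact: std_special hV.
by case: hV => _ h; split; [rewrite h e cubicW_std | case: sf].
Qed.

End CyclicForm.

(** * Special pencils *)

Section Norm.
Variable K : fieldType.
Implicit Types a b F : {poly K}.

(* The norm of a(x) + b(x) y on the curve y^2 = F(x). *)
Definition cnorm F a b := a ^+ 2 - b ^+ 2 * F.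

Lemma horner_cnorm F a b x : (cnorm F a b).[x] = a.[x] ^+ 2 - b.[x] ^+ 2 * F.[x].
Proof. by rewrite /cnorm !hornerE. Qed.

Lemma size_sqr a : size (a ^+ 2) = (2 * size a).-1.
Proof.
have [-> | a0] := eqVneq a 0; first by rewrite expr0n size_poly0.
by rewrite expr2 size_mul // mul2n addnn.
Qed.

(** The degree of a^2 is even and that of b^2 F is odd, so the leading terms cannot cancel. *)
Lemma size_cnorm F a b : size F = 4%N ->
  size (cnorm F a b) = maxn (2 * size a).-1 (if b == 0%R then 0 else (2 * size b).+2).
Proof.
move=> sF; have F0 : F != 0 by rewrite -size_poly_eq0 sF.
have sb : size (b ^+ 2 * F) = (if b == 0%R then 0 else (2 * size b).+2)%N.
  case: eqP => [->|/eqP b0]; first by rewrite expr0n mul0r size_poly0.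
  rewrite size_mul ?expf_neq0 // size_sqr sF.
  have : (0 < size b)%N by rewrite lt0n size_poly_eq0.
  lia.
rewrite /cnorm -sb; have := size_sqr a; set A := a ^+ 2; set B := b ^+ 2 * F => sA.
have [e | ne] := eqVneq (size A) (size B).
  have [b0 | b0] := eqVneq b 0.
    by rewrite /B b0 expr0n mul0r subr0 /= sA size_poly0 maxn0.
  have [a0 | a0] := eqVneq a 0.
    by rewrite /A a0 expr0n sub0r size_polyN size_poly0 max0n.
  move: e; rewrite sA sb (negPf b0).
  have : (0 < size a)%N by rewrite lt0n size_poly_eq0.
  lia.
rewrite -sA; case: (ltngtP (size A) (size B)) ne => // h _.
  rewrite addrC size_polyDl ?size_polyN //.
by rewrite size_polyDl ?size_polyN.
Qed.

(* At a simple root r of F the two terms of the norm have orders of different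
   parity, so they cannot cancel. *)
Lemma dvdp_cnorm_simple_root F r k a b : root F r -> F^`().[r] != 0 ->
  ('X - r%:P) ^+ (2 * k) %| cnorm F a b ->
  ('X - r%:P) ^+ k %| a /\ ('X - r%:P) ^+ k %| b.
Proof.
move=> Fr F'r; have [G FG] : exists G, F = G * ('X - r%:P).
  by have /factor_theorem := Fr.
have Gr : G.[r] != 0.
  by apply: contraNneq F'r => e; rewrite FG derivM derivXsubC !hornerE e; apply/eqP; ring.
elim: k a b => [|k IH] a b; first by rewrite muln0 expr0 !dvd1p.
have X0 : 'X - r%:P != 0 :> {poly K} by rewrite polyXsubC_eq0.
rewrite mulnS exprD => h.
have ra : root a r.
  have : root (cnorm F a b) r.
    by rewrite -dvdp_XsubCl; apply: dvdp_trans h; rewrite expr2 -mulrA dvdp_mulr.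
  by rewrite /cnorm rootE !hornerE (rootP Fr) mulr0 subr0 sqrf_eq0.
have /factor_theorem [a1 aE] := ra.
have rb : root b r.
  have : ('X - r%:P) ^+ 2 %| b ^+ 2 * F.
    have -> : b ^+ 2 * F = a1 ^+ 2 * ('X - r%:P) ^+ 2 - cnorm F a b.
      by rewrite /cnorm aE; ring.
    by rewrite dvdp_sub ?dvdp_mulIr // (dvdp_trans _ h) ?dvdp_mulIl.
  rewrite FG mulrA expr2 dvdp_mul2r // dvdp_XsubCl rootM (rootE G) (negPf Gr) orbF.
  by rewrite rootE horner_exp sqrf_eq0.
have /factor_theorem [b1 bE] := rb.
have nE : cnorm F a b = cnorm F a1 b1 * ('X - r%:P) ^+ 2 by rewrite /cnorm aE bE; ring.
move: h; rewrite nE mulrC dvdp_mul2r ?expf_neq0 // => /IH [h1 h2].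
by rewrite aE bE exprSr !dvdp_mul.
Qed.

End Norm.

(** * A second member restricted to a Weierstrass cubic *)

Section Base.
Variable K : numClosedFieldType.

Lemma single_root_poly (p : {poly K}) r : (forall x, root p x -> x = r) ->
  exists2 k, k != 0 & p = k *: ('X - r%:P) ^+ (size p).-1.
Proof.
move=> h; have p0 : p != 0.
  apply/eqP => p0; have /eqP : 1 = 0 :> K.
    by rewrite -[LHS](addrK r) (h (1 + r)) ?subrr // p0 root0.
  by rewrite oner_eq0.
have [s ps] := closed_field_poly_normal p.
have sr : s = nseq (size s) r.
  apply/all_pred1P/allP => z zs /=; apply/eqP/h; rewrite ps rootZ ?lead_coef_eq0 //.
  by rewrite root_prod_XsubC.
have pE : p = lead_coef p *: ('X - r%:P) ^+ (size s).
  by rewrite {1}ps {1}sr big_nseq iter_mulr_1.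
exists (lead_coef p); rewrite ?lead_coef_eq0 //.
have : size p = (size s).+1.
  by rewrite pE size_scale ?lead_coef_eq0 // size_exp_XsubC.
by move=> ->.
Qed.

Definition weier_poly (p q : K) : {poly K} := Poly [:: q; p; 0; 1].

Lemma size_weier_poly p q : size (weier_poly p q) = 4%N.
Proof. by rewrite (PolyK (c := 1)) //= oner_eq0. Qed.

Lemma horner_weier_poly p q x : (weier_poly p q).[x] = x ^+ 3 + p * x + q.
Proof. by rewrite horner_Poly /=; ring. Qed.

Lemma deriv_Poly5 (a b c d e x : K) :
  (Poly [:: a; b; c; d; e])^`().[x] =
  b + 2%:R * c * x + 3%:R * d * x ^+ 2 + 4%:R * e * x ^+ 3.
Proof. by rewrite /= !cons_poly_def !derivE !hornerE /=; ring. Qed.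

Lemma deriv_Poly4 (a b c d x : K) :
  (Poly [:: a; b; c; d])^`().[x] = b + 2%:R * c * x + 3%:R * d * x ^+ 2.
Proof. by rewrite /= !cons_poly_def !derivE !hornerE /=; ring. Qed.

Variables (p q : K) (c : nat -> K).

(* The restriction of the form c to the affine curve y^2 = x^3 + px + q is
   [even_part] + [odd_part] y. *)
Definition even_part := Poly [:: c 9%N + q * c 7%N; c 5%N + q * c 3%N + p * c 7%N;
  c 2%N + p * c 3%N; c 0%N + c 7%N; c 3%N].
Definition odd_part := Poly [:: c 8%N + q * c 6%N; c 4%N + p * c 6%N; c 1%N; c 6%N].

Lemma cubic_val_norm_form x y : y ^+ 2 = (weier_poly p q).[x] ->
  cubic_val c x y 1 = even_part.[x] + odd_part.[x] * y.
Proof.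
rewrite horner_weier_poly !horner_Poly /cubic_val /= => e.
by apply: (lincomb1 e (c 3%N * x + c 7%N + c 6%N * y)); ring.
Qed.

Let n := cnorm (weier_poly p q) even_part odd_part.

Lemma root_n x : root n x -> exists y, y ^+ 2 = (weier_poly p q).[x] /\ cubic_val c x y 1 = 0.
Proof.
move=> /rootP; rewrite /n horner_cnorm => e.
pose y := sqrtC (weier_poly p q).[x]; have yE : y ^+ 2 = (weier_poly p q).[x] by rewrite sqrtCK.
have /eqP : (even_part.[x] + odd_part.[x] * y) * (even_part.[x] + odd_part.[x] * - y) = 0.
  by apply: (lincomb2 e yE 1 (- odd_part.[x] ^+ 2)); ring.
rewrite mulf_eq0 => /orP [] /eqP h; [exists y | exists (- y)];
by rewrite cubic_val_norm_form ?sqrrN // yE.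
Qed.

Variable P : 'rV[K]_3.
Hypothesis base : forall x y z, vec x y z != 0 -> weier p q x y z = 0 ->
  cubic_val c x y z = 0 -> exists k, vec x y z = k *: P.
Hypothesis sm : forall x, (weier_poly p q).[x] = 0 -> (weier_poly p q)^`().[x] != 0.

Lemma base_affine x y : y ^+ 2 = (weier_poly p q).[x] -> cubic_val c x y 1 = 0 ->
  exists k, vec x y 1 = k *: P.
Proof.
rewrite horner_weier_poly => e h; apply: base => //.
  by rewrite vec_eq0 oner_eq0 !andbF.
by rewrite /weier; apply: (lincomb1 e 1); ring.
Qed.

(** Here (0:1:0) is the base point, so there is no common zero in the affine part and the norm is a
    nonzero constant. Hence c is constant on the affine curve, that is, a multiple of z^3 modulo the
    Weierstrass form. *)
Lemma base_flex : c 6%N = 0 ->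
  exists e k, forall x y z, cubic_val c x y z = e * weier p q x y z + k * z ^+ 3.
Proof.
move=> c6; have [k0 Pk] : exists k, vec 0 1 0 = k *: P.
  apply: base; rewrite ?vec_eq0 ?oner_eq0 ?andbF //; first by rewrite /weier; ring.
  by rewrite /cubic_val c6; ring.
have sn : size n = 1%N.
  apply/eqP; apply/negPn/negP => /closed_rootP [x /root_n [y [e1 e2]]].
  have [k Pk'] := base_affine e1 e2.
  have k00 : k0 != 0.
    apply/eqP => e; have : vec 0 1 0 == 0 :> 'rV[K]_3 by rewrite Pk e scale0r.
    by rewrite vec_eq0 oner_eq0 andbF.
  have : vec x y 1 = (k / k0) *: vec 0 1 0 by rewrite Pk scalerA divfK.
  by rewrite vecZ => /vec_inj [_ _ /eqP]; rewrite mulr0 oner_eq0.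
move: sn; rewrite /n size_cnorm ?size_weier_poly // => sn.
have b0 : odd_part = 0.
  have [// | b0] := eqVneq odd_part 0; move: sn; rewrite (negPf b0).
  by rewrite -size_poly_eq0 in b0; lia.
have sa : size even_part = 1%N.
  by move: sn; rewrite b0 eqxx maxn0; case: (size even_part) => [|[|m]] //; rewrite mulnS.

have ca i : (0 < i)%N -> even_part`_i = 0 by move=> i0; rewrite nth_default // sa.
have cb i : odd_part`_i = 0 by rewrite b0 coef0.
have := (ca 1%N isT, ca 2%N isT, ca 3%N isT, ca 4%N isT).
have := (cb 0%N, cb 1%N, cb 2%N).
rewrite !coef_Poly /= => -[[e0 e1] e2] [[[a1 a2] a3] a4].
have c3 : c 3%N = 0 by [].
have c0 : c 0%N = - c 7%N by apply: (lincomb1 a3 1); ring.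
have c2 : c 2%N = 0 by apply: (lincomb2 a2 c3 1 (- p)); ring.
have c5 : c 5%N = - p * c 7%N by apply: (lincomb2 a1 c3 1 (- q)); ring.
have c1 : c 1%N = 0 by [].
have c4 : c 4%N = 0 by apply: (lincomb2 e1 c6 1 (- p)); ring.
have c8 : c 8%N = 0 by apply: (lincomb2 e0 c6 1 (- q)); ring.
exists (c 7%N), (c 9%N + q * c 7%N) => x y z.
by rewrite /cubic_val /weier c0 c1 c2 c3 c4 c5 c6 c8; ring.
Qed.

(** The norm has degree 9 and a single root r, so c is tangent to the curve at the base point (r,
    y0); la is chosen to cancel the gradients. The list contains the coefficients of [weier]. *)
Lemma base_not_flex : c 6%N != 0 -> exists la k, k != 0 /\
  forall c', (forall i, c' i = c i - la *
     nth 0 [:: -1; 0; 0; 0; 0; - p; 0; 1; 0; - q] i) ->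
  exists2 Q, Q = k *: P & singular_at (cubic_of c') Q.
Proof.
move=> c6.
have sb : size odd_part = 4%N by rewrite (PolyK (c := 1)).
have b0 : odd_part != 0 by rewrite -size_poly_eq0 sb.
have sn : size n = 10%N.
  rewrite size_cnorm ?size_weier_poly // (negPf b0) sb.
  have : (size even_part <= 5)%N by apply: size_Poly.
  by case: (size even_part) => [|[|[|[|[|[|m]]]]]].
have /closed_rootP [r nr] : size n != 1%N by rewrite sn.
have [y0 [ey ez]] := root_n nr; have [k Pk] := base_affine ey ez.
have k0 : k != 0.
  apply/eqP => e; have : vec r y0 1 == 0 by rewrite Pk e scale0r.
  by rewrite vec_eq0 oner_eq0 !andbF.
have uniq_zero x y : y ^+ 2 = (weier_poly p q).[x] -> cubic_val c x y 1 = 0 -> x = r /\ y = y0.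
  move=> e1 e2; have [k' Pk'] := base_affine e1 e2.
  have : vec x y 1 = (k' / k) *: vec r y0 1 by rewrite Pk scalerA divfK.
  by rewrite vecZ mulr1 => /vec_inj [-> -> <-]; rewrite !mul1r.
have [m m0 nE] : exists2 m, m != 0 & n = m *: ('X - r%:P) ^+ (size n).-1.
  by apply: single_root_poly => x /root_n [y [e1 e2]]; case: (uniq_zero x y e1 e2).
rewrite sn /= in nE.
(* At a point with y0 = 0 the factor of order 8 in the norm would make [odd_part], of degree 3,
   divisible by a fourth power. *)
have y00 : y0 != 0.
  apply/eqP => y00; have Fr : root (weier_poly p q) r by rewrite rootE -ey y00 expr0n.
  have h8 : ('X - r%:P) ^+ (2 * 4) %| cnorm (weier_poly p q) even_part odd_part.
    by rewrite -/n nE dvdpZr // (exprD _ 8 1) dvdp_mulr.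
  have [_ /(dvdp_leq b0)] := dvdp_cnorm_simple_root Fr (sm (rootP Fr)) h8.
  by rewrite size_exp_XsubC sb.
have dn : n^`().[r] = 0.
  have [u nu] : exists u, n = ('X - r%:P) * (('X - r%:P) * u).
    by exists (m *: ('X - r%:P) ^+ 7); rewrite nE !exprS -!scalerAr.
  rewrite nu derivM derivXsubC hornerD !hornerM !hornerXsubC subrr.
  by rewrite !(mul0r, mulr0) addr0.
have zn : n.[r] = 0 by apply/rootP.
(* Otherwise the conjugate point (r, -y0) would be a second common zero. *)
have br : odd_part.[r] != 0.
  apply/eqP => br; have ar : even_part.[r] = 0.
    by apply: (lincomb2 ez br 1 (- y0)); rewrite cubic_val_norm_form //; ring.
  have h1 : (- y0) ^+ 2 = (weier_poly p q).[r] by rewrite sqrrN.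
  have h2 : cubic_val c r (- y0) 1 = 0 by rewrite cubic_val_norm_form // ar br mul0r addr0.
  have [_ e] := uniq_zero _ _ h1 h2.
  have /eqP : 2%:R * y0 = 0 by apply: (lincomb1 e (-1)); ring.
  by rewrite mulf_eq0 (negPf y00) pnatr_eq0.
pose gx := 3%:R * c 0%N * r ^+ 2 + 2%:R * c 1%N * r * y0 + 2%:R * c 2%N * r
     + c 3%N * y0 ^+ 2 + c 4%N * y0 + c 5%N.
pose gy := c 1%N * r ^+ 2 + 2%:R * c 3%N * r * y0 + c 4%N * r
     + 3%:R * c 6%N * y0 ^+ 2 + 2%:R * c 7%N * y0 + c 8%N.
(* The norm is the product of c and its conjugate, and the conjugate is nonzero at the base point
   since [odd_part.[r]] and y0 are. So the double root makes c stationary along the tangent vector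
   (2 y0, F'(r)) of the curve. *)
have tang : gx * (2%:R * y0) + gy * (3%:R * r ^+ 2 + p) = 0.
  apply: (mulfI br); rewrite mulr0.
  have aE : even_part.[r] = - odd_part.[r] * y0.
    by apply: (lincomb1 ez 1); rewrite cubic_val_norm_form //; ring.
  have bE : odd_part.[r] = (c 8%N + q * c 6%N) + (c 4%N + p * c 6%N) * r + c 1%N * r ^+ 2
      + c 6%N * r ^+ 3 by rewrite horner_Poly /=; ring.
  have dnE : n^`().[r] = 2%:R * even_part.[r] * even_part^`().[r]
      - 2%:R * odd_part.[r] * odd_part^`().[r] * (weier_poly p q).[r]
      - odd_part.[r] ^+ 2 * (weier_poly p q)^`().[r].
    rewrite /n /cnorm !(derivB, derivM, expr2) !(hornerD, hornerN, hornerM).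
    by ring.
  move: dnE; rewrite dn aE -ey deriv_Poly5 !deriv_Poly4 => dnE.
  move: ey; rewrite horner_weier_poly => ey.
  apply: (lincomb3 dnE ey bE 1
    (odd_part.[r] * (2%:R * y0 * c 3%N + c 6%N * (3%:R * r ^+ 2 + p)))
    (- odd_part.[r] * (3%:R * r ^+ 2 + p))).
  by rewrite /gx /gy; ring.
(* The ratio of the y-derivatives of c and of [weier] at the base point. *)
pose la := gy / (2%:R * y0).
exists la, k; split=> // c' c'E; exists (vec r y0 1) => //.
move: ey; rewrite horner_weier_poly => ey.
apply/singular_atP; split.
- by rewrite vec_eq0 oner_eq0 !andbF.
- by rewrite evE; apply: (lincomb2 ez ey 1 (- la)); rewrite /cubic_val !c'E /=; ring.
- elim/(@vecP K) => x' y' z'; rewrite dirder_cubic_of !c'E /=.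
  apply: (lincomb3 ez ey tang (3%:R * z') (- 3%:R * z' * la) ((x' - z' * r) / (2%:R * y0))).
  by rewrite /la /gx /gy /cubic_val; field.
Qed.

End Base.

(** * A member of the pencil is singular at the base point *)

Section SingularMember.
Variable K : numClosedFieldType.
Implicit Types (f g : cubic_form K) (u v w : 'rV[K]_3) (A B : 'M[K]_3).
Implicit Types (V : {vspace cubic_form K}).

Lemma lineless_line f u v : lineless f -> cross u v != 0 ->
  ~ (forall s t, ev f (s *: u + t *: v) = 0).
Proof.
move=> lf /complete_basis [w d] e; apply: (lf (rows3 w u v)).
  apply: rows3_unit; rewrite (_ : det3 w u v = det3 u v w) // /det3; ring.
by move=> y z; rewrite mul_vec_rows3 scale0r add0r e.
Qed.

Lemma pencil_basis V : \dim V = 2%N -> exists f g,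
  (forall h, h \in V <-> exists a b, h = a *: f + b *: g) /\
  (forall a b, a *: f + b *: g = 0 -> a = 0 /\ b = 0).
Proof.
move=> dV; have := vbasisP V; case: (vbasis V) => s /= /eqP; rewrite dV.
case: s => [|f [|g [|? ?]]] //= _ /andP [/eqP sV fr]; exists f, g; split.
  move=> h; rewrite -sV span_cons span_seq1; split.
    by case/memv_addP => [_ /vlineP [a ->] [_ /vlineP [b ->] ->]]; exists a, b.
  by case=> a [b ->]; rewrite memv_add // memvZ ?memv_line.
move=> a b e; move: fr; rewrite free_cons span_seq1 seq1_free => /andP [fg g0].
have [a0 | a0] := eqVneq a 0.
  split=> //; move: e; rewrite a0 scale0r add0r => /eqP.
  by rewrite scaler_eq0 (negPf g0) orbF => /eqP.
case/vlineP: fg; exists (- b / a).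
apply: (scalerI a0); rewrite scalerA mulrC divfK // scaleNr.
by apply/eqP; rewrite -addr_eq0 e.
Qed.

(** The members f + n g for natural n span infinitely many lines, and only finitely many lines are
    excluded. *)
Lemma pencil_smooth_basis V : special_pencil V -> exists f g, smooth f /\
  (forall h, h \in V <-> exists a b, h = a *: f + b *: g) /\
  (forall a b, a *: f + b *: g = 0 -> a = 0 /\ b = 0).
Proof.
case=> /pencil_basis [f [g [fgV fr]]] _ [s hs] _.
pose m (n : nat) := f + n%:R *: g.
have m0 n : m n != 0.
  apply/eqP => e; have [] := fr 1 n%:R; rewrite ?scale1r // => /eqP.
  by rewrite oner_eq0.
have minj : injective (fun n => <[m n]>%VS).
  move=> i j /(vline_eqP (m0 i)) [k k0 e].
  have [e1 e2] : 1 - k = 0 /\ i%:R - k * j%:R = 0.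
    apply: fr; apply: ev_inj => v; have := congr1 (fun h => ev h v) e.
    by rewrite /m ev0 !(evD, evZ) => ev_e; apply: (lincomb1 ev_e 1); ring.
  move/subr0_eq: e1 e2 => <-; rewrite mul1r => /subr0_eq /eqP.
  by rewrite eqr_nat => /eqP.
have [n hn] : exists n, <[m n]>%VS \notin s.
  pose r := [seq <[m n]>%VS | n <- iota 0 (size s).+1].
  have [/allP h | /allPn [L /mapP [n _ ->] hn]] := boolP (all (mem s) r); last by exists n.
  have := uniq_leq_size (_ : uniq r) h.
  by rewrite map_inj_uniq ?iota_uniq // size_map size_iota ltnn => /(_ isT).
exists (m n), g; split.
  apply: hs hn; split=> //; apply/fgV; exists 1, n%:R.
  by rewrite scale1r.
split=> [h | a b].
  rewrite fgV; split=> -[a [b ->]].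
    by exists a, (b - a * n%:R); apply: ev_inj => v; rewrite /m !(evD, evZ); ring.
  by exists a, (a * n%:R + b); apply: ev_inj => v; rewrite /m !(evD, evZ); ring.
rewrite /m scalerDr scalerA -addrA -scalerDl => /fr [a0].
by rewrite a0 mul0r add0r.
Qed.

Lemma pencil_singular V : special_pencil V -> exists f N P,
  [/\ singular_at N P, smooth f, ev f P = 0,
    forall w, w != 0 -> ev N w = 0 -> ev f w = 0 -> exists k, w = k *: P &
  (forall h, h \in V <-> exists a b, h = a *: N + b *: f) /\
  (forall a b, a *: N + b *: f = 0 -> a = 0 /\ b = 0)].
Proof.
move=> sV; have [f [g [sf [fgV fr]]]] := pencil_smooth_basis sV.
have [_ [P [bP uP]] _ irr] := sV.
have fV : f \in V by apply/fgV; exists 1, 0; rewrite scale1r scale0r addr0.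
have gV : g \in V by apply/fgV; exists 0, 1; rewrite scale1r scale0r add0r.
have f0 : f != 0 by case: sf.
have g0 : g != 0.
  by apply/eqP => g0; have [|_ /eqP] := fr 0 1; rewrite ?g0 ?scaler0 ?scale0r ?addr0 ?oner_eq0.
have [P0 eP] := bP.
have fP : ev f P = 0 by apply: eP.
have base w : w != 0 -> ev f w = 0 -> ev g w = 0 -> exists k, w = k *: P.
  move=> w0 fw gw; have /uP : base_point V w.
    split=> // h [/fgV [a [b ->]] _].
    by rewrite -/(ev _ _) evD !evZ fw gw !mulr0 addr0.
  by move/(vline_eqP w0) => [k _ ->]; exists k.
have [p [q [A [uA nf]]]] := weierstrass sf.
have [c gE] := cubic_coefs (csub A g).
pose es : seq K := [:: -1; 0; 0; 0; 0; - p; 0; 1; 0; - q].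
have fE : csub A f = cubic_of (nth 0 es).
  apply: ev_inj; elim/(@vecP K) => x y z.
  by rewrite ev_csub nf evE /weier /cubic_val /=; ring.
have ug x y z : ev g (vec x y z *m A) = cubic_val c x y z by rewrite -ev_csub gE evE.
pose P' := P *m invmx A.
have base' x y z : vec x y z != 0 -> weier p q x y z = 0 ->
    cubic_val c x y z = 0 -> exists k, vec x y z = k *: P'.
  move=> v0 e1 e2; have [|||k kE] := base (vec x y z *m A).
  - by rewrite mulmx_unit_eq0.
  - by rewrite nf.
  - by rewrite ug.
  by exists k; rewrite /P' scalemxAl -kE mulmxK.
have sm x : (weier_poly p q).[x] = 0 -> (weier_poly p q)^`().[x] != 0.
  rewrite horner_weier_poly => e; apply/eqP => e'.
  have [_ sE] : smooth (cubic_of (nth 0 es)) by rewrite -fE smooth_csub.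
  move: e'; rewrite deriv_Poly4 => e'.
  apply: (sE (vec x 0 1)); apply/singular_atP; split.
  - by rewrite vec_eq0 oner_eq0 !andbF.
  - by rewrite evE; apply: (lincomb1 e (-1)); rewrite /cubic_val /=; ring.
  - elim/(@vecP K) => x' y' z'; rewrite dirder_cubic_of /=.
    by apply: (lincomb2 e e' (- 3%:R * z') (- x' + z' * x)); ring.
(* If c6 = 0, some member is a multiple of z^3 and contains the line z = 0, against
   irreducibility. *)
have [c6 | c6] := eqVneq (c 6%N) 0.
  have [e [k E]] := base_flex base' c6.
  have h0 : g - e *: f != 0.
    apply/eqP => h0; have [|_ /eqP] := fr (- e) 1; last by rewrite oner_eq0.
    by rewrite scale1r scaleNr addrC.
  have hV : g - e *: f \in V by rewrite memvB // memvZ.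
  have := irreducible_lineless (irr _ (conj hV h0)).
  rewrite -(lineless_csub _ uA) => /lineless_line - /(_ (vec 1 0 0) (vec 0 1 0)) [].
    by rewrite /cross !vecE vec_eq0 !(mulr0, mulr1, mul0r, subr0) oner_eq0 !andbF.
  move=> s t; rewrite !vecZ vecD ev_csub evB evZ nf ug E; ring.
have [la [k [k0 hN]]] := base_not_flex base' sm c6.
pose c' i := c i - la * nth 0 es i.
have [Q QE sQ] := hN c' (fun=> erefl).
pose N := g - la *: f.
have NE : csub A N = cubic_of c'.
  apply: ev_inj; elim/(@vecP K) => x y z.
  rewrite ev_csub evB evZ ug nf evE /weier /c' /cubic_val /=; ring.
have QA : Q *m A = k *: P by rewrite QE -scalemxAl mulmxKV.
exists f, N, (k *: P); split=> //.
- by rewrite -QA -singular_at_csub // NE.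
- by rewrite evZv fP mulr0.
- move=> w w0 Nw fw; have [|k' ->] := base w w0 fw.
    by move: Nw; rewrite evB evZ fw mulr0 subr0.
  by exists (k' / k); rewrite scalerA divfK.
split=> [h | a b].
  rewrite fgV; split=> -[a [b ->]].
    by exists b, (a + la * b); apply: ev_inj => v; rewrite /N !(evB, evD, evZ); ring.
  by exists (b - la * a), a; apply: ev_inj => v; rewrite /N !(evB, evD, evZ); ring.
move=> e; have [e1 e2] : b - la * a = 0 /\ a = 0.
  apply: fr; apply: ev_inj => v; have := congr1 (fun h => ev h v) e.
  by rewrite /N ev0 !(evB, evD, evZ) => ev_e; apply: (lincomb1 ev_e 1); ring.
by split=> //; apply: (lincomb2 e1 e2 1 la); ring.
Qed.

End SingularMember.

(** * Normal forms of nodal and cuspidal cubics *)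

Section DoublePoints.
Variable K : numClosedFieldType.
Implicit Types (f g : cubic_form K) (u v w : 'rV[K]_3) (A B : 'M[K]_3).
Implicit Types (V : {vspace cubic_form K}).

(** As [nform], with P kept at (0:0:1); accordingly [nformP_sub] allows only substitutions that fix
    this point. *)
Definition nformP f P (G : K -> K -> K -> K) := exists A, [/\ A \in unitmx,
  exists2 k, k != 0 & vec 0 0 1 *m A = k *: P &
  forall x y z, ev f (vec x y z *m A) = G x y z].

Lemma nformP_sub f P G a1 a2 a3 b1 b2 b3 c3 (H : K -> K -> K -> K) : nformP f P G ->
  (a1 * b2 - a2 * b1) * c3 != 0 ->
  (forall x y z, H x y z = G (x * a1 + y * b1) (x * a2 + y * b2)
     (x * a3 + y * b3 + z * c3)) -> nformP f P H.
Proof.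
move=> [A [uA [k k0 kE] h]] d HE.
exists (rows3 (vec a1 a2 a3) (vec b1 b2 b3) (vec 0 0 c3) *m A); split.
- rewrite unitmx_mul rows3_unit // /det3 !vecE.
  by rewrite (_ : _ + _ = (a1 * b2 - a2 * b1) * c3) //; ring.
- exists (c3 * k).
    by rewrite mulf_neq0 //; apply: contraNneq d => ->; rewrite mulr0.
  rewrite mulmxA !mulv !mul0r !add0r !mulr0 mul1r -scalerA -kE scalemxAl vecZ.
  by rewrite !mulr0 mulr1.
- by move=> x y z; rewrite mulmxA !mulv h HE !mulr0 !addr0.
Qed.

Lemma vertex_basis P : P != 0 -> exists A, A \in unitmx /\ vec 0 0 1 *m A = P.
Proof.
elim/(@vecP K): P => x y z; rewrite vec_eq0 !negb_and => /orP [x0 | /orP [y0 | z0]].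
- exists (rows3 (vec 0 1 0) (vec 0 0 1) (vec x y z)); split.
    by apply: rows3_unit; rewrite /det3 !vecE (_ : _ + _ = x) //; ring.
  by rewrite !mulv; congr vec; ring.
- exists (rows3 (vec 0 0 1) (vec 1 0 0) (vec x y z)); split.
    by apply: rows3_unit; rewrite /det3 !vecE (_ : _ + _ = y) //; ring.
  by rewrite !mulv; congr vec; ring.
- exists (rows3 (vec 1 0 0) (vec 0 1 0) (vec x y z)); split.
    by apply: rows3_unit; rewrite /det3 !vecE (_ : _ + _ = z) //; ring.
  by rewrite !mulv; congr vec; ring.
Qed.

Lemma nformP_lineless f P G x1 y1 z1 x2 y2 z2 : lineless f -> nformP f P G ->
  cross (vec x1 y1 z1) (vec x2 y2 z2) != 0 ->
  ~ (forall s t, G (s * x1 + t * x2) (s * y1 + t * y2) (s * z1 + t * z2) = 0).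
Proof.
move=> lf [A [uA _ h]] c0 e; have := lf; rewrite -(lineless_csub _ uA).
move/lineless_line => /(_ _ _ c0); apply => s t.
by rewrite !vecZ vecD ev_csub h e.
Qed.

Lemma double_point_form N P : lineless N -> singular_at N P ->
  exists (c : nat -> K), nformP N P (fun x y z =>
    z * (c 2%N * x ^+ 2 + c 4%N * x * y + c 7%N * y ^+ 2)
    + (c 0%N * x ^+ 3 + c 1%N * x ^+ 2 * y + c 3%N * x * y ^+ 2 + c 6%N * y ^+ 3)).
Proof.
move=> lN sN; have [P0 _ _] := (singular_atP N P).1 sN.
have [A [uA AP]] := vertex_basis P0.
have [c NE] := cubic_coefs (csub A N).
have /singular_atP [_ e d] : singular_at (cubic_of c) (vec 0 0 1).
  by rewrite -NE singular_at_csub // AP.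
exists c, A; split=> //; first by exists 1; rewrite ?oner_eq0 ?scale1r.
have c9 : c 9%N = 0 by apply: (lincomb1 e 1); rewrite evE /cubic_val; ring.
have c5 : c 5%N = 0 by apply: (lincomb1 (d (vec 1 0 0)) 1); rewrite dirder_cubic_of; ring.
have c8 : c 8%N = 0 by apply: (lincomb1 (d (vec 0 1 0)) 1); rewrite dirder_cubic_of; ring.
by move=> x y z; rewrite -ev_csub NE evE /cubic_val c5 c8 c9; ring.
Qed.

Definition cusp_form (x y z : K) := y ^+ 2 * z - x ^+ 3.
Definition node_form (x y z : K) := x * y * z - x ^+ 3 - y ^+ 3.

(** One tangent is moved to y = 0. If there is a second one, adding a linear form in x and y to z
    absorbs x^2 y and xy^2. If the tangent is double, the same absorbs xy^2 and y^3, and a shift of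
    x absorbs x^2 y. The coefficients to be normalized are nonzero because N contains no line. *)
Lemma classify_double_point N P : lineless N -> singular_at N P ->
  nformP N P node_form \/ nformP N P cusp_form.
Proof.
move=> lN /(double_point_form lN) [c nf].
have {c nf} [c [c2 nf]] : exists c : nat -> K, c 2%N = 0 /\ nformP N P (fun x y z =>
    z * (c 2%N * x ^+ 2 + c 4%N * x * y + c 7%N * y ^+ 2)
    + (c 0%N * x ^+ 3 + c 1%N * x ^+ 2 * y + c 3%N * x * y ^+ 2 + c 6%N * y ^+ 3)).
  have [c2 | c2] := eqVneq (c 2%N) 0; first by exists c.
  (* (t : 1) is a root of the tangent cone; the substitution (x, y) |-> (tx + y, x) moves it to (1 :
     0). *)
  have [t [t' [e1 e2]]] := quadratic_split (c 4%N / c 2%N) (c 7%N / c 2%N).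
  have ht : c 2%N * t ^+ 2 + c 4%N * t + c 7%N = 0.
    by apply: (lincomb2 e1 e2 (c 2%N * t) (c 2%N)); field.
  pose d : nat -> K := nth 0
    [:: c 0%N * t ^+ 3 + c 1%N * t ^+ 2 + c 3%N * t + c 6%N;
        3%:R * c 0%N * t ^+ 2 + 2%:R * c 1%N * t + c 3%N; 0;
        3%:R * c 0%N * t + c 1%N; 2%:R * c 2%N * t + c 4%N; 0;
        c 0%N; c 2%N].
  exists d; split=> //.
  apply: (@nformP_sub N P _ t 1 0 1 0 0 1 _ nf).
    by rewrite (_ : _ * _ = -1) ?oppr_eq0 ?oner_eq0 //; ring.
  move=> x y z; rewrite /d /=; apply: (lincomb1 ht (- z * x ^+ 2)); ring.
have [c4 | c4] := eqVneq (c 4%N) 0; [right | left].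
  (* Without quadratic part the cubic is a binary form, hence a union of lines through P. *)
  have c7 : c 7%N != 0.
    apply/eqP => c7.
    have [x [y [xy0 e]]] : exists x y, ~ (x = 0 /\ y = 0) /\
      c 0%N * x ^+ 3 + c 1%N * x ^+ 2 * y + c 3%N * x * y ^+ 2 + c 6%N * y ^+ 3 = 0.
      have [c6 | c6] := eqVneq (c 6%N) 0.
        exists 0, 1; split; first by case=> _ /eqP; rewrite oner_eq0.
        by rewrite c6; ring.
      have [y e] := cubic_root (c 3%N / c 6%N) (c 1%N / c 6%N) (c 0%N / c 6%N).
      exists 1, y; split; first by case=> /eqP; rewrite oner_eq0.
      by apply: (lincomb1 e (c 6%N)); field.
    apply: (nformP_lineless (x1 := x) (y1 := y) (z1 := 0) (x2 := 0) (y2 := 0) (z2 := 1) lN nf).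
      rewrite /cross !vecE vec_eq0; apply/negP => /and3P [/eqP h1 /eqP h2 _].
      by apply: xy0; split; [apply: (lincomb1 h2 (-1)) | apply: (lincomb1 h1 1)]; ring.
    by move=> s t; apply: (lincomb1 e (s ^+ 3)); rewrite c2 c4 c7; ring.
  have c0 : c 0%N != 0.
    apply/eqP => c0.
    apply: (nformP_lineless (x1 := 1) (y1 := 0) (z1 := 0) (x2 := 0) (y2 := 0) (z2 := 1) lN nf).
      by rewrite /cross !vecE vec_eq0 !(mulr0, mulr1, subr0, sub0r, oppr0) oppr_eq0 oner_eq0 !andbF.
    by move=> s t; rewrite c0 c2 c4; ring.
  have [al eal] := cube_rootP (- (c 0%N)^-1).
  have al0 : al != 0.
    apply: contraNneq (invr_neq0 c0) => e; apply/eqP; apply: (lincomb1 eal 1).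
    by rewrite e; ring.
  pose h := c 1%N / (3%:R * c 0%N).
  apply: (@nformP_sub N P _ al 0
    (- (c 3%N - c 1%N * c 1%N / (3%:R * c 0%N)) * al / c 7%N)
    (- h) 1
    (- (c 6%N - c 3%N * h + c 1%N * h ^+ 2 - c 0%N * h ^+ 3) / c 7%N)
    (c 7%N)^-1 _ nf).
    by rewrite mulr1 mul0r subr0 mulf_neq0 ?invr_eq0.
  move=> x y z; rewrite /cusp_form c2 c4 /h.
  by apply: (lincomb1 eal (- c 0%N * x ^+ 3)); field; rewrite c0 c7.
pose h := c 7%N / c 4%N.
have [d nf1] : exists d : nat -> K, nformP N P (fun x y z => x * y * z
    + d 0%N * x ^+ 3 + d 6%N * y ^+ 3).
  exists (nth 0 [:: c 0%N; 0; 0; 0; 0; 0;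
    c 6%N - c 3%N * h + c 1%N * h ^+ 2 - c 0%N * h ^+ 3]).
  apply: (@nformP_sub N P _ 1 0 (- (c 1%N - 3%:R * c 0%N * h) / c 4%N) (- h) 1
    (- (c 3%N - 2%:R * c 1%N * h + 3%:R * c 0%N * h ^+ 2) / c 4%N) (c 4%N)^-1 _ nf).
    by rewrite mulr1 mul0r subr0 mul1r invr_eq0.
  by move=> x y z; rewrite c2 /= /h; field.
have d0 : d 0%N != 0.
  apply/eqP => d0.
  apply: (nformP_lineless (x1 := 1) (y1 := 0) (z1 := 0) (x2 := 0) (y2 := 0) (z2 := 1) lN nf1).
    by rewrite /cross !vecE vec_eq0 !(mulr0, mulr1, subr0, sub0r, oppr0) oppr_eq0 oner_eq0 !andbF.
  by move=> s t; rewrite d0; ring.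
have d6 : d 6%N != 0.
  apply/eqP => d6.
  apply: (nformP_lineless (x1 := 0) (y1 := 1) (z1 := 0) (x2 := 0) (y2 := 0) (z2 := 1) lN nf1).
    by rewrite /cross !vecE vec_eq0 !(mulr0, mulr1, subr0) oner_eq0.
  by move=> s t; rewrite d6; ring.
have [al eal] := cube_rootP (- (d 0%N)^-1).
have [be ebe] := cube_rootP (- (d 6%N)^-1).
have al0 : al != 0.
  apply: contraNneq (invr_neq0 d0) => e; apply/eqP; apply: (lincomb1 eal 1).
  by rewrite e; ring.
have be0 : be != 0.
  apply: contraNneq (invr_neq0 d6) => e; apply/eqP; apply: (lincomb1 ebe 1).
  by rewrite e; ring.
apply: (@nformP_sub N P _ al 0 0 0 be 0 (al * be)^-1 _ nf1).
  by rewrite mul0r subr0 mulfV ?mulf_neq0 // oner_eq0.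
move=> x y z; rewrite /node_form.
by apply: (lincomb2 eal ebe (- d 0%N * x ^+ 3) (- d 6%N * y ^+ 3)); field; rewrite d0 d6 al0 be0.
Qed.

End DoublePoints.

(** * Every special pencil is standard in suitable coordinates *)

Section Uniqueness.
Variable K : numClosedFieldType.
Implicit Types (f g : cubic_form K) (u v w : 'rV[K]_3) (A B : 'M[K]_3).
Implicit Types (V : {vspace cubic_form K}).

Lemma zero_only_root_coef (p : {poly K}) i : (forall x, p.[x] = 0 -> x = 0) ->
  p`_i != 0 -> forall j, j != i -> p`_j = 0.
Proof.
move=> h; have [k k0 ->] : exists2 k, k != 0 & p = k *: ('X - 0%:P) ^+ (size p).-1.
  by apply: single_root_poly => x /rootP; apply: h.
rewrite subr0 !coefZ !coefXn; have [-> | _] := eqVneq i (size p).-1; last by rewrite mulr0 eqxx.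
by move=> _ j ji; rewrite coefZ coefXn (negPf ji) mulr0.
Qed.

(** On the parametrized nodal cubic both s = 0 and s = oo lie over the node, the only common zero.
    So the restriction of f is a monomial, and the hypothesis on [dirder] says that the coefficient
    d5 of s^8 is nonzero. The vanishing of the others leaves f = d5 C + d4 N. *)
Lemma node_std V N f A :
  (forall h, h \in V <-> exists a b, h = a *: N + b *: f) ->
  A \in unitmx ->
  (forall x y z, ev N (vec x y z *m A) = node_form x y z) ->
  (forall x y z, vec x y z != 0 -> node_form x y z = 0 ->
     ev f (vec x y z *m A) = 0 -> x = 0 /\ y = 0) ->
  ev f (vec 0 0 1 *m A) = 0 ->
  dirder f (vec 0 0 1 *m A) (vec 1 0 0 *m A) != 0 ->
  std_coord A V.
Proof.
move=> hV uA hN hz; rewrite -dirder_csub -ev_csub.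
have [d fE] := cubic_coefs (csub A f); rewrite fE dirder_cubic_of evE => e9 d5.
have d9 : d 9%N = 0 by apply: (lincomb1 e9 1); rewrite /cubic_val; ring.
have {}d5 : d 5%N != 0.
  by apply: contraNneq d5 => ->; apply/eqP; ring.
(* The value of f at (s^2, s, s^3 + 1); the coefficients of 1 and s^9 are d9 = 0. *)
pose g : {poly K} := Poly [:: 0; d 8%N; d 7%N + d 5%N; d 6%N + d 4%N;
  d 3%N + d 2%N + 2%:R * d 8%N; d 1%N + d 7%N + 2%:R * d 5%N; d 0%N + d 4%N;
  d 2%N + d 8%N; d 5%N].
have groot s : g.[s] = 0 -> s = 0.
  move=> gs; apply/eqP/negP => /negP s0.
  have [||| e _] := hz (s ^+ 2) s (s ^+ 3 + 1).
  - by rewrite vec_eq0 (negPf s0) andbF.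
  - by rewrite /node_form; ring.
  - rewrite -ev_csub fE evE -[RHS]gs horner_Poly /cubic_val d9 /=; ring.
  by move/eqP: e; rewrite sqrf_eq0 (negPf s0).
have g8 : g`_8 != 0 by rewrite coef_Poly.
have gj := zero_only_root_coef groot g8.
have := (gj 1%N isT, gj 2%N isT, gj 3%N isT, gj 4%N isT).
have := (gj 5%N isT, gj 6%N isT, gj 7%N isT).
rewrite !coef_Poly /= => -[[g5 g6] g7] [[[g1 g2] g3] g4].
have NE : csub A N = cubicN K.
  by apply: ev_inj; elim/(@vecP K) => x y z; rewrite ev_csub hN evN.
have CE : csub A f = d 5%N *: cubicC K + d 4%N *: cubicN K.
  have d8 : d 8%N = 0 by [].
  have d7 : d 7%N = - d 5%N by apply: (lincomb1 g2 1); ring.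
  have d6 : d 6%N = - d 4%N by apply: (lincomb1 g3 1); ring.
  have d2 : d 2%N = 0 by apply: (lincomb2 g7 d8 1 (-1)); ring.
  have d3 : d 3%N = 0 by apply: (lincomb3 g4 d8 d2 1 (- 2%:R) (-1)); ring.
  have d1 : d 1%N = - d 5%N by apply: (lincomb2 g5 d7 1 (-1)); ring.
  have d0 : d 0%N = - d 4%N by apply: (lincomb1 g6 1); ring.
  rewrite fE; apply: ev_inj; elim/(@vecP K) => x y z.
  by rewrite evD !evZ evC evN evE /cubic_val d0 d1 d2 d3 d6 d7 d8 d9; ring.
split=> // h; apply/idP/idP => [/hV [a [b ->]] | /stdVP [a [b e]]].
  apply/stdVP; exists (a + b * d 4%N), (b * d 5%N); rewrite linearD !linearZ /= NE CE.
  by apply: ev_inj => v; rewrite !(evD, evZ); ring.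
apply/hV; exists (a - b / d 5%N * d 4%N), (b / d 5%N).
apply: (can_inj (csubK uA)); rewrite e linearD !linearZ /= NE CE.
by apply: ev_inj => v; rewrite !(evD, evZ); field.
Qed.

Lemma special_std V : special_pencil V -> exists A, std_coord A V.
Proof.
move=> sV; have [f [N [P [sN sf fP base [hV fr]]]]] := pencil_singular sV.
have [_ _ _ irr] := sV.
have memV a b : ~ (a = 0 /\ b = 0) -> lineless (a *: N + b *: f).
  move=> ab; apply/irreducible_lineless/irr; split; first by apply/hV; exists a, b.
  by apply/eqP => /fr.
have lN : lineless N.
  have := memV 1 0; rewrite scale1r scale0r addr0; apply.
  by case=> /eqP; rewrite oner_eq0.
have zeros A k G : A \in unitmx -> vec 0 0 1 *m A = k *: P -> k != 0 ->
    (forall x y z, ev N (vec x y z *m A) = G x y z) ->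
    forall x y z, vec x y z != 0 -> G x y z = 0 ->
     ev f (vec x y z *m A) = 0 -> x = 0 /\ y = 0.
  move=> uA AP k0 hN x y z v0 Gv fv.
  have [||| k' e] := base (vec x y z *m A).
  - by rewrite mulmx_unit_eq0.
  - by rewrite hN.
  - by [].
  have : vec x y z = (k' / k) *: vec 0 0 1.
    apply: (can_inj (mulmxK uA)); rewrite e -scalemxAl AP scalerA divfK //.
  by rewrite vecZ !mulr0 => /vec_inj [].
have fA A k : vec 0 0 1 *m A = k *: P -> ev f (vec 0 0 1 *m A) = 0.
  by move=> ->; rewrite evZv fP mulr0.
case: (classify_double_point lN sN) => -[A [uA [k k0 AP] hN]].
  have hz := zeros A k _ uA AP k0 hN.
  (* In the other case the exchange S of x and y replaces s by 1/s. The derivatives along both axes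
     cannot vanish, since f is smooth at the base point. *)
  have [d5 | d5] := eqVneq (dirder f (vec 0 0 1 *m A) (vec 1 0 0 *m A)) 0; last first.
    by exists A; apply: node_std d5 => //; apply: fA AP.
  pose S := rows3 (vec 0 1 0) (vec 1 0 0) (vec 0 0 1 : 'rV[K]_3).
  have SE x y z : vec x y z *m S = vec y x z.
    by rewrite !mulv; congr vec; ring.
  exists (S *m A); apply: (@node_std V N f) => //.
  - rewrite unitmx_mul uA andbT rows3_unit // /det3 !vecE.
    by rewrite (_ : _ + _ = -1) ?oppr_eq0 ?oner_eq0 //; ring.
  - by move=> x y z'; rewrite mulmxA SE hN /node_form; ring.
  - move=> x y z' v0 nz; rewrite mulmxA SE => fz.
    have [||| -> ->] // := hz y x z'.
      by move: v0; rewrite !vec_eq0 andbCA.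
    by rewrite -nz /node_form; ring.
  - by rewrite mulmxA SE; apply: fA AP.
  rewrite !mulmxA !SE; apply/eqP => d8.
  case: sf => _ /(_ (vec 0 0 1 *m A)); apply.
  rewrite -singular_at_csub //; apply/singular_atP.
  have e9 := fA A k AP.
  move: d5 d8 e9; rewrite -!dirder_csub -ev_csub.
  have [d ->] := cubic_coefs (csub A f); rewrite !dirder_cubic_of => d5 d8 e9; split=> //.
    by rewrite vec_eq0 oner_eq0 !andbF.
  elim/(@vecP K) => x' y' z'; rewrite dirder_cubic_of.
  by move: e9; rewrite evE /cubic_val => e9; apply: (lincomb3 d5 d8 e9 x' y' (3%:R * z')); ring.
have hz := zeros A k _ uA AP k0 hN.
have [d fE] := cubic_coefs (csub A f).
have fd x y z' : ev f (vec x y z' *m A) = cubic_val d x y z' by rewrite -ev_csub fE evE.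
have d6 : d 6%N != 0.
  apply/eqP => d6; have [|||_ /eqP] := hz 0 1 0; last by rewrite oner_eq0.
  - by rewrite vec_eq0 oner_eq0 !andbF.
  - by rewrite /cusp_form; ring.
  - by rewrite fd /cubic_val d6; ring.
(* The value of f at the points (s^2, s^3, 1) of the cuspidal cubic. Only s = 0 is a zero, so g is
   d6 s^9 and d0 N + f = d6 y^3, a triple line. *)
pose g : {poly K} := Poly [:: d 9%N; 0; d 5%N; d 8%N; d 2%N; d 4%N; d 0%N + d 7%N;
  d 1%N; d 3%N; d 6%N].
have groot s : g.[s] = 0 -> s = 0.
  move=> gs; apply/eqP/negP => /negP s0.
  have [||| e _] := hz (s ^+ 2) (s ^+ 3) 1.
  - by rewrite vec_eq0 oner_eq0 !andbF.
  - by rewrite /cusp_form; ring.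
  - by rewrite fd -[RHS]gs horner_Poly /cubic_val /=; ring.
  by move/eqP: e; rewrite sqrf_eq0 (negPf s0).
have g9 : g`_9 != 0 by rewrite coef_Poly.
have gj := zero_only_root_coef groot g9.
have := (gj 0%N isT, gj 2%N isT, gj 3%N isT, gj 4%N isT).
have := (gj 5%N isT, gj 6%N isT, gj 7%N isT, gj 8%N isT).
rewrite !coef_Poly /= => -[[[d4 g6] d1] d3] [[[d9 d5] d8] d2].
exfalso; have l : lineless (d 0%N *: N + 1 *: f).
  by apply: memV => -[_ /eqP]; rewrite oner_eq0.
have := l; rewrite -(lineless_csub _ uA).
move=> /lineless_line - /(_ (vec 1 0 0) (vec 0 0 1)) [].
  by rewrite /cross !vecE vec_eq0 !(mulr0, mulr1, subr0, sub0r, oppr0) oppr_eq0 oner_eq0 !andbF.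
move=> s t; rewrite !vecZ vecD ev_csub evD !evZ hN fd /cubic_val /cusp_form.
rewrite d1 d2 d3 d4 d5 d8 d9.
by apply: (lincomb1 g6 0); ring.
Qed.

End Uniqueness.

(** * Non-isotriviality *)

Section CoordinateRing.
Variable K : numClosedFieldType.
Variable F : {poly K}.
Hypothesis sF : size F = 4%N.
Implicit Types (a b c d : {poly K}) (g h : K -> K -> K).

Definition affine_repr h a b :=
  forall x y, y ^+ 2 = F.[x] -> h x y = a.[x] + b.[x] * y.

Definition regular h := exists a b, affine_repr h a b.

(** The degree of the norm is the order of the pole at the only point at infinity: 2 for x and 3 for
    y. *)
Definition pole_order h (m : nat) :=
  exists a b, affine_repr h a b /\ size (cnorm F a b) = m.+1.

(** Comparing the values at (x, y) and (x, -y) separates the two parts. *)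
Lemma affine_repr_uniq h a b c d :
  affine_repr h a b -> affine_repr h c d -> a = c /\ b = d.
Proof.
move=> h1 h2.
have e x y : y ^+ 2 = F.[x] -> (a - c).[x] = 0 /\ (b - d).[x] * y = 0.
  move=> yE; have e1 := h1 x y yE; have e2 := h2 x y yE.
  have yE' : (- y) ^+ 2 = F.[x] by rewrite sqrrN.
  have e3 := h1 x (- y) yE'; have e4 := h2 x (- y) yE'.
  rewrite e1 in e2; rewrite e3 in e4; rewrite !hornerD !hornerN.
  split; first by apply: (lincomb2 e2 e4 2%:R^-1 2%:R^-1); field.
  by apply: (lincomb2 e2 e4 2%:R^-1 (- 2%:R^-1)); field.
have sq x : exists y, y ^+ 2 = F.[x] by exists (sqrtC F.[x]); rewrite sqrtCK.
split; apply/subr0_eq.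
  by apply: poly_eq0_horner => x _; have [y /e []] := sq x.
have F0 : F != 0 by rewrite -size_poly_eq0 sF.
apply/eqP; suff /eqP : (b - d) * F = 0 by rewrite mulf_eq0 (negPf F0) orbF.
apply: poly_eq0_horner => x _; have [y yE] := sq x; have [_ e0] := e _ _ yE.
by rewrite hornerM -yE expr2 mulrA e0 mul0r.
Qed.

Lemma affine_repr_mul g h a b c d : affine_repr g a b -> affine_repr h c d ->
  affine_repr (fun x y => g x y * h x y) (a * c + b * d * F) (a * d + b * c).
Proof.
move=> h1 h2 x y yE; rewrite h1 // h2 // !(hornerD, hornerM).
by apply: (lincomb1 yE (b.[x] * d.[x])); ring.
Qed.

Lemma affine_repr_add g h a b c d : affine_repr g a b -> affine_repr h c d ->
  affine_repr (fun x y => g x y + h x y) (a + c) (b + d).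
Proof. by move=> h1 h2 x y yE; rewrite h1 // h2 // !hornerD; ring. Qed.

Lemma affine_repr_const k : affine_repr (fun _ _ => k) k%:P 0.
Proof. by move=> x y _; rewrite hornerC horner0 mul0r addr0. Qed.

Lemma regular_mul g h : regular g -> regular h -> regular (fun x y => g x y * h x y).
Proof.
by move=> [a [b hg]] [c [d hh]]; exists (a * c + b * d * F), (a * d + b * c);
  apply: affine_repr_mul.
Qed.

Lemma regular_add g h : regular g -> regular h -> regular (fun x y => g x y + h x y).
Proof.
by move=> [a [b hg]] [c [d hh]]; exists (a + c), (b + d); apply: affine_repr_add.
Qed.

Lemma regular_const k : regular (fun _ _ => k).
Proof. by exists k%:P, 0; apply: affine_repr_const. Qed.

Lemma regular_ext g h : (forall x y, y ^+ 2 = F.[x] -> g x y = h x y) ->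
  regular g -> regular h.
Proof. by move=> e [a [b hg]]; exists a, b => x y yE; rewrite -e // hg. Qed.

Lemma regular_mpoly (p : {mpoly K[3]}) : regular (fun x y => p.@[vec x y 1 0]).
Proof.
apply: (@regular_ext (fun x y =>
  \sum_(m <- msupp p) p@_m * (x ^+ m i0 * y ^+ m i1))).
  move=> x y _; rewrite mevalE; apply: eq_bigr => m _.
  by rewrite prod_ord3 !vecE expr1n mulr1.
have hx : regular (fun x _ => x).
  by exists 'X, 0 => x y _; rewrite hornerX horner0 mul0r addr0.
have hy : regular (fun _ y => y).
  by exists 0, 1 => x y _; rewrite horner0 add0r (hornerC 1) mul1r.
have he g k : regular g -> regular (fun x y => g x y ^+ k).
  move=> hg; elim: k => [|k IH].
    by apply: regular_ext (regular_const 1) => x y _; rewrite expr0.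
  by apply: regular_ext (regular_mul hg IH) => x y _; rewrite exprS.
elim: (msupp p) => [|m s IH].
  by apply: regular_ext (regular_const 0) => x y _; rewrite big_nil.
apply: regular_ext (regular_add (regular_mul (regular_const p@_m)
  (regular_mul (he _ (m i0) hx) (he _ (m i1) hy))) IH) => x y _.
by rewrite big_cons.
Qed.

Lemma pole_order_ext g h m : (forall x y, y ^+ 2 = F.[x] -> g x y = h x y) ->
  pole_order g m -> pole_order h m.
Proof. by move=> e [a [b [hg s]]]; exists a, b; split=> // x y yE; rewrite -e // hg. Qed.

Lemma pole_order_uniq h m n : pole_order h m -> pole_order h n -> m = n.
Proof.
move=> [a [b [h1 s1]]] [c [d [h2 s2]]].
have [ac bd] := affine_repr_uniq h1 h2; move: s1; rewrite ac bd s2.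
by case.
Qed.

Lemma pole_order_nonzero h m : pole_order h m ->
  ~ (forall x y, y ^+ 2 = F.[x] -> h x y = 0).
Proof.
move=> [a [b [h1 s1]]] h0.
have h2 : affine_repr h 0 0 by move=> x y yE; rewrite h0 // !horner0 mul0r addr0.
have [a0 b0] := affine_repr_uniq h1 h2; move: s1.
by rewrite a0 b0 /cnorm expr0n mul0r subrr size_poly0.
Qed.

Lemma pole_order_mul g h m n : pole_order g m -> pole_order h n ->
  pole_order (fun x y => g x y * h x y) (m + n).
Proof.
move=> [a [b [h1 s1]]] [c [d [h2 s2]]].
exists (a * c + b * d * F), (a * d + b * c); split; first exact: affine_repr_mul.
have -> : cnorm F (a * c + b * d * F) (a * d + b * c) = cnorm F a b * cnorm F c d.
  by rewrite /cnorm; ring.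
by rewrite size_mul ?s1 ?s2 -?size_poly_eq0 ?s1 ?s2 // addSn addnS.
Qed.

Lemma pole_order_const k : k != 0 -> pole_order (fun _ _ => k) 0.
Proof.
move=> k0; exists k%:P, 0; split; first exact: affine_repr_const.
by rewrite size_cnorm // eqxx maxn0 size_polyC k0.
Qed.

(** The pole order of a + by is the larger of 2 deg a and 2 deg b + 3, so what remains is arithmetic
    on sizes. *)
Lemma pole_order_add g h m n : pole_order g m -> pole_order h n -> (m < n)%N ->
  pole_order (fun x y => g x y + h x y) n.
Proof.
move=> [a [b [h1 s1]]] [c [d [h2 s2]]] mn.
exists (a + c), (b + d); split; first exact: affine_repr_add.
move: s1 s2; rewrite !size_cnorm //.
have b0 : (b == 0) = (size b == 0%N) by rewrite size_poly_eq0.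
have d0 : (d == 0) = (size d == 0%N) by rewrite size_poly_eq0.
have bd0 : (b + d == 0) = (size (b + d)%R == 0%N) by rewrite size_poly_eq0.
rewrite b0 d0 bd0 => s1 s2.
have la : (size (a + c)%R <= maxn (size a) (size c))%N := size_polyD a c.
have lb : (size (b + d)%R <= maxn (size b) (size d))%N := size_polyD b d.
have ea : (size a < size c)%N -> size (a + c)%R = size c.
  by move=> h'; rewrite addrC size_polyDl.
have eb : (size b < size d)%N -> size (b + d)%R = size d.
  by move=> h'; rewrite addrC size_polyDl.
move: (size a) (size b) (size c) (size d) (size (a + c)%R) (size (b + d)%R)
  s1 s2 la lb ea eb => A B C D E G.
have mx (x y z : nat) : maxn x y = z -> [/\ x <= z, y <= z & x = z \/ y = z]%N.
  by move=> <-; rewrite leq_maxl leq_maxr; split=> //; case: leqP; [right | left].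
have xm (x y z : nat) : (x <= z)%N -> (y <= z)%N -> x = z \/ y = z -> maxn x y = z.
  by move=> xz yz [e | e]; [rewrite -e in yz * | rewrite -e in xz *];
    [apply/maxn_idPl | apply/maxn_idPr].
have dbl (x y z : nat) : (z <= maxn x y)%N -> (z <= x)%N \/ (z <= y)%N.
  by rewrite leq_max => /orP.
move=> /mx [s1a s1b _] /mx [s2a s2b s2c] /dbl la /dbl lb ea eb.
have B2 : (2 * B <= m)%N by case: (B) s1b => [|B'] //=; lia.
have D2 : (2 * D <= n)%N by case: (D) s2b => [|D'] //=; lia.
have G2 : (2 * G + (G != 0) <= n)%N.
  by move: s1b s2b; case: lb; case: (G) => [|G'] //;
    case: (B) => [|B']; case: (D) => [|D'] //=; lia.
(* Whichever of c and d carries the pole of order n strictly dominates its counterpart in g, and its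
   size survives in the sum. *)
case: s2c => s2c.
  have EC : E = C by apply: ea; lia.
  apply: xm; last by left; rewrite EC.
    by rewrite EC.
  by case: (G) G2 => [|G'] //=; lia.
have D0 : (0 < D)%N by case: (D) s2c.
have DE : (2 * D).+2 = n.+1 by case: (D) D0 s2c.
have GD : G = D.
  by apply: eb; case: (B) s1b => [|B'] //=; lia.
apply: xm; last by right; rewrite GD; case: (D) D0 DE.
  by case: la; lia.
by rewrite GD.
Qed.

Lemma pole_order_poly h m (P : {poly K}) : pole_order h m -> (0 < m)%N -> P != 0 ->
  pole_order (fun x y => P.[h x y]) (m * (size P).-1).
Proof.
move=> hm m0; elim/poly_ind: P => [|Q c IH]; first by rewrite eqxx.
have [-> | Q0] := eqVneq Q 0.
  rewrite mul0r add0r polyC_eq0 size_polyC => c0; rewrite c0 muln0.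
  by apply: pole_order_ext (pole_order_const c0) => x y _; rewrite hornerC.
move=> _; rewrite size_MXaddC (negPf Q0) /=.
have sQ : (0 < size Q)%N by rewrite lt0n size_poly_eq0.
have e : (m * size Q = m * (size Q).-1 + m)%N by rewrite -{1}(prednK sQ) mulnS addnC.
have hQ := pole_order_mul (IH Q0) hm; rewrite -e in hQ.
have [-> | c0] := eqVneq c 0.
  by apply: pole_order_ext hQ => x y _; rewrite !hornerE.
have lt : (0 < m * size Q)%N by rewrite muln_gt0 m0.
apply: pole_order_ext (pole_order_add (pole_order_const c0) hQ lt) => x y _.
by rewrite hornerMXaddC addrC.
Qed.

Lemma regular_pole_order h : regular h ->
  (exists k, forall x y, y ^+ 2 = F.[x] -> h x y = k) \/
  (exists m, (0 < m)%N /\ pole_order h m).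
Proof.
move=> [a [b hh]]; case s: (size (cnorm F a b)) => [|[|m]].
- left; exists 0 => x y yE; rewrite hh //.
  move: s; rewrite size_cnorm // => s.
  have a0 : a = 0 by apply/eqP; rewrite -size_poly_eq0; case: (size a) s => // n; lia.
  have b0 : b = 0.
    have [// | b0] := eqVneq b 0; move: s; rewrite (negPf b0); lia.
  by rewrite a0 b0 !horner0 mul0r addr0.
- left; exists a`_0 => x y yE; rewrite hh //.
  move: s; rewrite size_cnorm // => s.
  have b0 : b = 0.
    have [// | b0] := eqVneq b 0; move: s; rewrite (negPf b0); lia.
  have sa : (size a <= 1)%N by case: (size a) s => [|[|n]] //; lia.
  by rewrite b0 horner0 mul0r addr0 {1}(size1_polyC sa) hornerC.
- by right; exists m.+1; split=> //; exists a, b.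
Qed.

End CoordinateRing.

(** * Locally regular functions, and isomorphisms of affine curves *)

Section Integral.
Variable K : numClosedFieldType.
Variable F : {poly K}.
Hypothesis sF : size F = 4%N.

(* The polynomials in x that are denominators of X form an ideal without a
   common root. *)
Lemma regular_local (X : K -> K -> K) :
  (forall x0 y0, y0 ^+ 2 = F.[x0] -> exists g h, [/\ regular F g, regular F h,
     g x0 y0 != 0 & forall x y, y ^+ 2 = F.[x] -> g x y * X x y = h x y]) ->
  regular F X.
Proof.
move=> hX; pose I (d : {poly K}) := regular F (fun x y => d.[x] * X x y).
have hpoly (d : {poly K}) : regular F (fun x _ => d.[x]).
  by exists d, 0 => x y _; rewrite horner0 mul0r addr0.
have Icomb e1 d1 e2 d2 : I d1 -> I d2 -> I (e1 * d1 + e2 * d2).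
  move=> h1 h2; apply: regular_ext (regular_add (regular_mul (hpoly e1) h1)
    (regular_mul (hpoly e2) h2)) => x y _.
  by rewrite hornerD !hornerM; ring.
have Inz x0 : exists2 d, I d & d.[x0] != 0.
  pose y0 := sqrtC F.[x0]; have y0E : y0 ^+ 2 = F.[x0] by rewrite sqrtCK.
  have y0E' : (- y0) ^+ 2 = F.[x0] by rewrite sqrrN.
  (* The norm of g is a denominator in x alone; it is nonzero at x0 iff g is nonzero at both points
     above x0. If neither local denominator is, their sum is. *)
  have [g [h [rg rh g0 gX]]] : exists g h, [/\ regular F g, regular F h,
     g x0 y0 != 0 /\ g x0 (- y0) != 0
     & forall x y, y ^+ 2 = F.[x] -> g x y * X x y = h x y].
    have [g1 [h1 [rg1 rh1 n1 e1]]] := hX _ _ y0E.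
    have [g2 [h2 [rg2 rh2 n2 e2]]] := hX _ _ y0E'.
    have [z1 | z1] := eqVneq (g1 x0 (- y0)) 0; last by exists g1, h1; split.
    have [z2 | z2] := eqVneq (g2 x0 y0) 0; last by exists g2, h2; split.
    exists (fun x y => g1 x y + g2 x y), (fun x y => h1 x y + h2 x y).
    split; [exact: regular_add | exact: regular_add | | ].
      by rewrite z1 z2 addr0 add0r.
    by move=> x y yE; rewrite mulrDl e1 // e2.
  have [a [b gE]] := rg; exists (cnorm F a b).
    have rc : regular F (fun x y => a.[x] - b.[x] * y).
      by exists a, (- b) => x y _; rewrite hornerN mulNr.
    apply: regular_ext (regular_mul rc rh) => x y yE.
    rewrite -gX // gE // horner_cnorm.
    by apply: (lincomb1 yE (- b.[x] ^+ 2 * X x y)); ring.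
  have -> : (cnorm F a b).[x0] = g x0 y0 * g x0 (- y0).
    rewrite !gE // horner_cnorm.
    by apply: (lincomb1 y0E (b.[x0] ^+ 2)); ring.
  by case: g0 => *; rewrite mulf_neq0.
have [d0 Id0 nz] := Inz 0.
have d00 : d0 != 0 by apply: contraNneq nz => ->; rewrite horner0.
(* Euclidean descent: a denominator with a root x0 is replaced by its remainder in the division of
   another one that is nonzero at x0. *)
have : exists2 k, k != 0 & I k%:P.
  move: {2}(size d0) (leqnn (size d0)) => n; elim: n d0 Id0 d00 {nz} => [|n IH] d Id d0.
    by rewrite leqn0 size_poly_eq0 (negPf d0).
  move=> sd; have [/eqP /size_poly1P [k k0 dk] | s1] := eqVneq (size d) 1%N.
    by exists k; rewrite // -dk.
  have /closed_rootP [x0 /rootP dx0] := s1; have [d1 Id1 d1x] := Inz x0.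
  have rE : d1 %% d = 1 * d1 + (- (d1 %/ d)) * d.
    by rewrite {2}(divp_eq d1 d) mul1r mulNr addrAC subrr add0r.
  apply: (IH (d1 %% d)).
  - by rewrite rE; apply: Icomb.
  - apply: contraNneq d1x => r0; move: rE; rewrite r0 mul1r mulNr => /esym /subr0_eq ->.
    by rewrite hornerM dx0 mulr0.
  - by rewrite -ltnS (leq_trans _ sd) // ltn_modp.
case=> k k0 Ik; apply: regular_ext (regular_mul (regular_const F k^-1) Ik) => x y _.
by rewrite hornerC mulrA mulVf // mul1r.
Qed.

Lemma pole_order_x : pole_order F (fun x _ => x) 2.
Proof.
exists 'X, 0; split; first by move=> x y _; rewrite hornerX horner0 mul0r addr0.
by rewrite size_cnorm // eqxx maxn0 size_polyX.
Qed.

(** If X and Y have pole orders m and n, the equation between them gives 2n = 3m. As x, of order 2,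
    is a polynomial in X and Y, this forces m = 2 and n = 3, the orders of x and y. *)
Lemma affine_coordinates (p' q' : K) (X Y : K -> K -> K) (A B : {poly K}) :
  regular F X -> regular F Y ->
  (forall x y, y ^+ 2 = F.[x] -> Y x y ^+ 2 = (weier_poly p' q').[X x y]) ->
  (forall x y, y ^+ 2 = F.[x] -> x = A.[X x y] + B.[X x y] * Y x y) ->
  exists al be ga de ep, [/\ al != 0, ga != 0 & forall x y, y ^+ 2 = F.[x] ->
    X x y = al * x + be /\ Y x y = ga * y + de * x + ep].
Proof.
move=> rX rY hY hx.
have notconst k : ~ (forall x y, y ^+ 2 = F.[x] -> x = k).
  move=> e; have := pole_order_x.
  have [k0 | k0] := eqVneq k 0.
    by move/pole_order_nonzero; apply; rewrite k0 in e.
  move=> h2; have h0 : pole_order F (fun x _ => x) 0.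
    by apply: pole_order_ext (pole_order_const sF k0) => x y yE; rewrite (e x y yE).
  by have := pole_order_uniq sF h2 h0.
have G0 k : (weier_poly p' q') - k%:P != 0.
  apply/eqP => e; have := size_weier_poly p' q'.
  by rewrite (subr0_eq e) size_polyC; case: (k != 0).
have sqY n : pole_order F Y n -> pole_order F (fun x y => (weier_poly p' q').[X x y]) (n + n).
  move=> oY; apply: pole_order_ext (pole_order_mul oY oY) => x y yE.
  by rewrite -hY // expr2.
have pconst (k : K) (Z : K -> K -> K) n : (0 < n)%N -> pole_order F Z n ->
    ~ (forall x y, y ^+ 2 = F.[x] -> Z x y = k).
  move=> n0 oZ e; have [k0 | k0] := eqVneq k 0.
    by apply: (pole_order_nonzero sF oZ); rewrite k0 in e.
  have h0 : pole_order F Z 0.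
    by apply: pole_order_ext (pole_order_const sF k0) => x y yE; rewrite e.
  by have e0 := pole_order_uniq sF oZ h0; rewrite e0 in n0.
case: (regular_pole_order sF rX) => [[k Xk] | [m [m0 oX]]].
  exfalso; case: (regular_pole_order sF rY) => [[l Yl] | [n [n0 oY]]].
    apply: (notconst (A.[k] + B.[k] * l)) => x y yE.
    by rewrite {1}(hx x y yE) Xk // Yl.
  apply: (pconst (weier_poly p' q').[k] _ _ _ (sqY _ oY)); first by rewrite addn_gt0 n0.
  by move=> x y yE; rewrite Xk.
have oG : pole_order F (fun x y => (weier_poly p' q').[X x y]) (m * 3).
  have := pole_order_poly sF oX m0 (_ : weier_poly p' q' != 0).
  by rewrite size_weier_poly; apply; rewrite -size_poly_eq0 size_weier_poly.
case: (regular_pole_order sF rY) => [[l Yl] | [n [n0 oY]]].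
  exfalso; apply: (pconst (l ^+ 2) _ _ _ oG); first by rewrite muln_gt0 m0.
  by move=> x y yE; rewrite -hY // Yl.
have nm : (n + n = m * 3)%N := pole_order_uniq sF (sqY _ oY) oG.
have hx' : pole_order F (fun x y => A.[X x y] + B.[X x y] * Y x y) 2.
  by apply: pole_order_ext pole_order_x => x y yE; rewrite {1}(hx x y yE).
have oA : A != 0 -> pole_order F (fun x y => A.[X x y]) (m * (size A).-1).
  exact: pole_order_poly.
have oB : B != 0 -> pole_order F (fun x y => B.[X x y] * Y x y) (m * (size B).-1 + n).
  by move=> B0; apply: pole_order_mul => //; apply: pole_order_poly.
have m2 : m = 2%N.
  (* By 2n = 3m the orders of A(X) and B(X)Y are an even and an odd multiple of m/2, hence distinct,
     and the larger one is the order of the sum. *)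
  have two : (exists d, 2 = m * d)%N \/ (exists d, 2 = m * d + n)%N.
    have [A0 | A0] := eqVneq A 0; have [B0 | B0] := eqVneq B 0.
    - case: (pole_order_nonzero sF hx') => x y _.
      by rewrite A0 B0 !horner0 mul0r addr0.
    - right; exists (size B).-1; apply: (pole_order_uniq sF hx').
      by apply: pole_order_ext (oB B0) => x y _; rewrite A0 horner0 add0r.
    - left; exists (size A).-1; apply: (pole_order_uniq sF hx').
      by apply: pole_order_ext (oA A0) => x y _; rewrite B0 horner0 mul0r addr0.
    case: (ltngtP (m * (size A).-1) (m * (size B).-1 + n)) => lt.
    - right; exists (size B).-1; apply: (pole_order_uniq sF hx').
      exact: pole_order_add (oA A0) (oB B0) lt.
    - left; exists (size A).-1; apply: (pole_order_uniq sF hx').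
      apply: pole_order_ext (pole_order_add sF (oB B0) (oA A0) lt) => x y _.
      by rewrite addrC.
    have : (m * (2 * (size A).-1) = m * (2 * (size B).-1 + 3))%N by lia.
    by move/eqP; rewrite eqn_pmul2l //; lia.
  case: two => -[d dE]; last by case: d dE => [|d]; rewrite ?muln0 ?mulnS; lia.
  have : (m %| 2)%N by rewrite dE dvdn_mulr.
  by move/(dvdn_leq (isT : (0 < 2)%N)); case: m m0 nm {oX oG oA oB dE} => [|[|[|m]]] //; lia.
have n3 : n = 3%N by lia.
rewrite m2 in oX; rewrite n3 in oY.
have [a [b [XE sX]]] := oX; have [c [d [YE sY]]] := oY.
move: sX sY; rewrite !size_cnorm // => sX sY.
have b0 : b = 0.
  have [// | b0] := eqVneq b 0; move: sX; rewrite (negPf b0).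
  rewrite -size_poly_eq0 in b0; case: (size b) b0 => // sb _.
  by rewrite mulnS; lia.
have sa : size a = 2%N.
  by move: sX; rewrite b0 eqxx maxn0; case: (size a) => [|[|[|sa]]] //; rewrite !mulnS.
have d0 : d != 0.
  by apply/eqP => d0; move: sY; rewrite d0 eqxx maxn0; case: (size c) => // sc; rewrite mulnS; lia.
move: sY; rewrite (negPf d0) => sY.
have sd : size d = 1%N.
  rewrite -size_poly_eq0 in d0; move: sY; case: (size d) d0 => [|[|sd]] // _.
  by rewrite !mulnS; lia.
have sc : (size c <= 2)%N.
  by move: sY; case: (size c) => [|[|[|sc]]] //; rewrite !mulnS; lia.
have lin (r : {poly K}) : (size r <= 2)%N -> forall x, r.[x] = r`_1 * x + r`_0.
  move=> sr x; rewrite (horner_coef_wide _ sr) !big_ord_recl big_ord0 /= /bump /=.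
  by rewrite expr0 expr1; ring.
exists a`_1, a`_0, d`_0, c`_1, c`_0; split.
- have : lead_coef a != 0 by rewrite lead_coef_eq0 -size_poly_eq0 sa.
  by rewrite lead_coefE sa.
- have : lead_coef d != 0 by rewrite lead_coef_eq0.
  by rewrite lead_coefE sd.
move=> x y yE; rewrite XE // YE // b0 horner0 mul0r addr0 lin ?sa //.
rewrite (lin c) // (lin d) ?sd // [d`_1]nth_default ?sd //.
by split=> //; ring.
Qed.

End Integral.

(** Comparing (x, y) with (x, -y) at x = 0 and x = 1 gives ep = 0 and de = 0. The x^2-coefficient of
    the remaining identity in x gives be = 0, and its constant term then gives ga^2 = 0. *)
Lemma no_affine_iso (K : numClosedFieldType) (X Y : K -> K -> K) (A B : {poly K}) :
  regular (weier_poly 0 1) X -> regular (weier_poly 0 1) Y ->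
  (forall x y, y ^+ 2 = (weier_poly 0 1).[x] -> Y x y ^+ 2 = (weier_poly (-1) 0).[X x y]) ->
  (forall x y, y ^+ 2 = (weier_poly 0 1).[x] -> x = A.[X x y] + B.[X x y] * Y x y) ->
  False.
Proof.
move=> rX rY hY hx.
have [al [be [ga [de [ep [al0 ga0 h]]]]]] :=
  affine_coordinates (size_weier_poly 0 1) rX rY hY hx.
have rel x y : y ^+ 2 = x ^+ 3 + 1 ->
    (ga * y + de * x + ep) ^+ 2 = (al * x + be) ^+ 3 - (al * x + be).
  move=> e; have yE : y ^+ 2 = (weier_poly 0 1).[x] by rewrite horner_weier_poly e; ring.
  have := hY x y yE; rewrite horner_weier_poly; have [-> ->] := h x y yE => ->.
  by ring.
have rel2 x : ga ^+ 2 * (x ^+ 3 + 1) + (de * x + ep) ^+ 2 =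
    (al * x + be) ^+ 3 - (al * x + be).
  pose y := sqrtC (x ^+ 3 + 1); have yE : y ^+ 2 = x ^+ 3 + 1 by rewrite sqrtCK.
  have yE' : (- y) ^+ 2 = x ^+ 3 + 1 by rewrite sqrrN.
  have e1 := rel _ _ yE; have e2 := rel _ _ yE'.
  by apply: (lincomb3 e1 e2 yE 2%:R^-1 2%:R^-1 (- ga ^+ 2)); field.
have two0 := two_neq0 K.
have ep0 : ep = 0.
  have e1 : 1 ^+ 2 = 0 ^+ 3 + 1 :> K by ring.
  have e2 : (-1) ^+ 2 = 0 ^+ 3 + 1 :> K by ring.
  apply: (mulfI (mulf_neq0 (mulf_neq0 two0 two0) ga0)); rewrite mulr0.
  by apply: (lincomb2 (rel _ _ e1) (rel _ _ e2) 1 (-1)); ring.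
have de0 : de = 0.
  pose s := sqrtC (2%:R : K); have sE : s ^+ 2 = 2%:R by rewrite sqrtCK.
  have s0 : s != 0 by rewrite sqrtC_eq0.
  have e1 : s ^+ 2 = 1 ^+ 3 + 1 by rewrite sE; ring.
  have e2 : (- s) ^+ 2 = 1 ^+ 3 + 1 by rewrite sqrrN e1.
  apply: (mulfI (mulf_neq0 (mulf_neq0 (mulf_neq0 two0 two0) ga0) s0)); rewrite mulr0.
  by apply: (lincomb2 (rel _ _ e1) (rel _ _ e2) 1 (-1)); rewrite ep0; ring.
rewrite de0 ep0 in rel2.
have be0 : be = 0.
  have n6 : (6%:R : K) != 0 by rewrite pnatr_eq0.
  apply: (mulfI (mulf_neq0 n6 (expf_neq0 2 al0))); rewrite mulr0.
  by apply: (lincomb3 (rel2 1) (rel2 (-1)) (rel2 0) (-1) (-1) 2%:R); ring.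
have /eqP : ga ^+ 2 = 0 by apply: (lincomb1 (rel2 0) 1); rewrite be0; ring.
by rewrite sqrf_eq0 (negPf ga0).
Qed.

(** * Composition of regular maps between curves *)

Section RegularMaps.
Variable K : numClosedFieldType.
Implicit Types (f g h : cubic_form K) (u v w : 'rV[K]_3) (A B : 'M[K]_3).
Implicit Types (H G Phi Psi : 'rV[K]_3 -> 'rV[K]_3).

Definition polyfun (a : 'rV[K]_3 -> K) := exists p : {mpoly K[3]}, forall v, a v = p.@[v 0].

Lemma polyfun_const k : polyfun (fun _ => k).
Proof. by exists k%:MP => v; rewrite mevalC. Qed.

Lemma polyfun_coord i : polyfun (fun v => v 0 i).
Proof. by exists 'X_i => v; rewrite mevalXU. Qed.

Lemma polyfun_add a b : polyfun a -> polyfun b -> polyfun (fun v => a v + b v).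
Proof. by move=> [p hp] [q hq]; exists (p + q) => v; rewrite mevalD hp hq. Qed.

Lemma polyfun_mul a b : polyfun a -> polyfun b -> polyfun (fun v => a v * b v).
Proof. by move=> [p hp] [q hq]; exists (p * q) => v; rewrite mevalM hp hq. Qed.

Lemma polyfun_opp a : polyfun a -> polyfun (fun v => - a v).
Proof. by move=> [p hp]; exists (- p) => v; rewrite mevalN hp. Qed.

Lemma polyfun_exp a n : polyfun a -> polyfun (fun v => a v ^+ n).
Proof. by move=> [p hp]; exists (p ^+ n) => v; rewrite rmorphXn /= hp. Qed.

Definition polyvec H := forall i, polyfun (fun v => H v 0 i).
Definition homogvec H := exists d : nat, forall k v, H (k *: v) = k ^+ d *: H v.

Lemma polyfun_comp a H : polyfun a -> polyvec H -> polyfun (fun v => a (H v)).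
Proof.
move=> [p hp] hH; have [q0 h0] := hH i0; have [q1 h1] := hH i1; have [q2 h2] := hH i2.
exists (p \mPo [tuple q0; q1; q2]) => v; rewrite hp comp_mpoly_meval.
by apply: meval_eq; elim/ord3_ind; rewrite (tnth_nth 0) /= -?h0 -?h1 -?h2.
Qed.

(** Compared with [regular_map], H is only a polynomial function that is homogeneous in its values;
    this is easier to verify for composites and explicit formulas. *)
Definition local_repr f Phi v := exists H, [/\ polyvec H, homogvec H, H v != 0 &
  forall w, on_curve f w -> H w != 0 -> <[Phi w]>%VS = <[H w]>%VS].

Definition curve_map f g Phi :=
  (forall v, on_curve f v -> on_curve g (Phi v)) /\
  (forall v, on_curve f v -> local_repr f Phi v).

Lemma on_curve_scale f k v : k != 0 -> on_curve f (k *: v) <-> on_curve f v.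
Proof.
move=> k0; rewrite /on_curve -!/(ev _ _) evZv scaler_eq0 (negPf k0); split=> -[v0 e].
  split=> //; apply/eqP; move/eqP: e; rewrite mulf_eq0 expf_eq0 (negPf k0) andbF.
  by [].
by rewrite e mulr0.
Qed.

Lemma homogvec_line H k v : homogvec H -> k != 0 -> <[H (k *: v)]>%VS = <[H v]>%VS.
Proof. by move=> [d hd] k0; rewrite hd vlineZ // expf_neq0. Qed.

Lemma homogvec_neq0 H k v : homogvec H -> k != 0 -> (H (k *: v) != 0) = (H v != 0).
Proof. by move=> [d hd] k0; rewrite hd scaler_eq0 expf_eq0 (negPf k0) andbF. Qed.

Lemma curve_map_line f g Phi u v : curve_map f g Phi -> on_curve f v ->
  <[u]>%VS = <[v]>%VS -> u != 0 -> <[Phi u]>%VS = <[Phi v]>%VS.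
Proof.
move=> [_ hl] fv uv u0; have [k k0 uE] := vline_eqP u0 uv.
have [H [_ hom Hv hH]] := hl v fv.
by rewrite uE !hH ?homogvec_neq0 ?on_curve_scale // homogvec_line.
Qed.

Lemma curve_map_comp f g h Phi Psi :
  curve_map f g Phi -> curve_map g h Psi -> curve_map f h (Psi \o Phi).
Proof.
move=> [m1 l1] [m2 l2]; split=> [v fv | v fv]; first by apply/m2/m1.
have [H [pH hH Hv HE]] := l1 v fv; have gv := m1 v fv.
have [G [pG hG Gv GE]] := l2 _ gv.
have [k k0 vE] := vline_eqP gv.1 (HE v fv Hv).
have GHv : G (H v) != 0 by move: Gv; rewrite vE homogvec_neq0.
have [j Hj] : exists j, H v 0 j != 0.
  by move: Hv; case/rV0Pn => j; exists j.
(* The factor [H w 0 j] restricts to points where H is nonzero; G of degree 0 would not vanish at H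
   w = 0 by itself. *)
exists (fun w => H w 0 j *: G (H w)); split.
- move=> i; have [p hp] := polyfun_mul (pH j) (polyfun_comp (pG i) pH).
  by exists p => w; rewrite -hp mxE.
- have [d hd] := hH; have [e he] := hG; exists (d + d * e)%N => c w.
  by rewrite hd he mxE !scalerA exprD exprM; congr (_ *: _); ring.
- by rewrite scaler_eq0 negb_or Hj.
move=> w fw; rewrite scaler_eq0 negb_or => /andP [Hwj GHw].
have Hw : H w != 0 by apply/rV0Pn; exists j.
have gw := m1 w fw.
have [c c0 wE] := vline_eqP gw.1 (HE w fw Hw).
rewrite vlineZ // -(homogvec_line (H w) hG c0) -wE; apply: GE => //.
by rewrite wE homogvec_neq0.
Qed.

Lemma meval_scale (p : {mpoly K[3]}) d k v : p \is d.-homog ->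
  p.@[(k *: v) 0] = k ^+ d * p.@[v 0].
Proof.
move=> hp; rewrite !mevalE mulr_sumr; apply: eq_big_seq => m /(dhomog_mf hp) dm.
rewrite -dm /= mdegE -prodrXr mulrCA -big_split /=; congr (_ * _).
by apply: eq_bigr => i _; rewrite mxE exprMn.
Qed.

Lemma curve_map_regular f g Phi : regular_map f g Phi -> curve_map f g Phi.
Proof.
move=> [m l]; split=> // v /l [d [F [Fv FE]]].
exists (fun w => \row_i (F i).@[w 0]); split=> //.
- by move=> i; exists (F i) => w; rewrite mxE.
- by exists d => k w; apply/rowP => i; rewrite !mxE (meval_scale _ _ (dhomog_is_dhomog (F i))).
Qed.

Lemma curve_map_linear f A : A \in unitmx -> curve_map (csub A f) f (mulmxr A).
Proof.
move=> uA; split=> v [v0 e].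
  by split; rewrite /= ?mulmx_unit_eq0 // -/(ev _ _) -ev_csub.
exists (mulmxr A); split=> //=.
- move=> i; exists (\sum_j A j i *: 'X_j) => w.
  rewrite raddf_sum /= mxE; apply: eq_bigr => j _.
  by rewrite mevalZ mevalXU mulrC.
- by exists 1%N => k w; rewrite expr1 /= -scalemxAl.
- by rewrite mulmx_unit_eq0.
Qed.

Definition inverse_maps f g Phi Psi :=
  [/\ curve_map f g Phi, curve_map g f Psi,
      forall v, on_curve f v -> <[Psi (Phi v)]>%VS = <[v]>%VS
    & forall w, on_curve g w -> <[Phi (Psi w)]>%VS = <[w]>%VS].

Lemma inverse_maps_sym f g Phi Psi : inverse_maps f g Phi Psi -> inverse_maps g f Psi Phi.
Proof. by case. Qed.

Lemma inverse_maps_comp f g h Phi Psi Phi' Psi' :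
  inverse_maps f g Phi Psi -> inverse_maps g h Phi' Psi' ->
  inverse_maps f h (Phi' \o Phi) (Psi \o Psi').
Proof.
move=> [m1 m2 e1 e2] [n1 n2 e3 e4]; split.
- exact: curve_map_comp m1 n1.
- exact: curve_map_comp n2 m2.
- move=> v fv; have gv := m1.1 v fv; have hv := n1.1 _ gv.
  rewrite /= (curve_map_line m2 gv) ?e1 ?e3 //.
  by have [] := n2.1 _ hv.
- move=> v fv; have gv := n2.1 v fv; have hv := m2.1 _ gv.
  rewrite /= (curve_map_line n1 gv) ?e4 ?e2 //.
  by have [] := m1.1 _ hv.
Qed.

Lemma inverse_maps_linear f A : A \in unitmx ->
  inverse_maps (csub A f) f (mulmxr A) (mulmxr (invmx A)).
Proof.
move=> uA; split; first exact: curve_map_linear.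
- have := @curve_map_linear (csub A f) (invmx A).
  by rewrite unitmx_inv csubK //; apply.
- by move=> v _ /=; rewrite mulmxK.
- by move=> v _ /=; rewrite mulmxKV.
Qed.

Lemma isomorphic_inverse_maps f g : isomorphic_curves f g ->
  exists Phi Psi, inverse_maps f g Phi Psi.
Proof.
by case=> Phi [Psi [m1 m2 e1 e2]]; exists Phi, Psi; split=> //; apply: curve_map_regular.
Qed.

End RegularMaps.

Lemma polyvec_vec (K : numClosedFieldType) (a b c : 'rV[K]_3 -> K) :
  polyfun a -> polyfun b -> polyfun c -> polyvec (fun v => vec (a v) (b v) (c v)).
Proof.
move=> [p hp] [q hq] [r hr]; elim/ord3_ind; [exists p | exists q | exists r] => v;
by rewrite vecE.
Qed.

(** * The involution that sends v to the third point on the line through P0 *)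

Section Residual.
Variable K : numClosedFieldType.
Implicit Types (u v w : 'rV[K]_3).

Definition weier_form (p q : K) : cubic_form K :=
  cubic_of_seq [:: -1; 0; 0; 0; 0; - p; 0; 1; 0; - q].

Lemma ev_weier_form p q x y z : ev (weier_form p q) (vec x y z) = weier p q x y z.
Proof. by rewrite evE /cubic_val /weier /=; ring. Qed.

Variables (p x0 y0 : K).
Let q := y0 ^+ 2 - x0 ^+ 3 - p * x0.
Let E := weier_form p q.
Hypothesis smE : smooth E.
Hypothesis lE : lineless E.

Let P0 := vec x0 y0 1.

(** For v on the curve, the form at s P0 + t v is st (s grad_at v + t polar v); its third root is s
    : t = polar v : - grad_at v. *)
Definition grad_at v := v 0 i0 * (- 3%:R * x0 ^+ 2 - p) + v 0 i1 * (2%:R * y0)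
  + v 0 i2 * (y0 ^+ 2 - 2%:R * p * x0 - 3%:R * q).
Definition polar v := x0 * (- 3%:R * v 0 i0 ^+ 2 - p * v 0 i2 ^+ 2)
  + y0 * (2%:R * v 0 i1 * v 0 i2)
  + (v 0 i1 ^+ 2 - 2%:R * p * v 0 i0 * v 0 i2 - 3%:R * q * v 0 i2 ^+ 2).

(* Third intersection of the curve with the line through v and P0. *)
Definition residual v := polar v *: P0 - grad_at v *: v.

Definition slope_num v :=
  v 0 i0 ^+ 2 + v 0 i0 * x0 * v 0 i2 + x0 ^+ 2 * v 0 i2 ^+ 2 + p * v 0 i2 ^+ 2.
Definition slope_den v := v 0 i2 * (v 0 i1 + y0 * v 0 i2).

(* The same point, from the slope slope_num v / slope_den v of that line; this
   expression remains valid at v = P0. *)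
Definition residual' v :=
  let m := slope_num v in let n := slope_den v in
  vec (n * (m ^+ 2 * v 0 i2 - (v 0 i0 + x0 * v 0 i2) * n ^+ 2))
   (y0 * n ^+ 3 * v 0 i2 + m * (m ^+ 2 * v 0 i2 - (v 0 i0 + 2%:R * x0 * v 0 i2) * n ^+ 2))
   (n ^+ 3 * v 0 i2).

(** On the curve [residual] vanishes only at P0, where the third point is that of the tangent
    line. *)
Definition residual_map v := if residual v != 0 then residual v else residual' v.

Lemma residualE x y z : residual (vec x y z) =
  let d2 := x0 * (- 3%:R * x ^+ 2 - p * z ^+ 2) + y0 * (2%:R * y * z)
     + (y ^+ 2 - 2%:R * p * x * z - 3%:R * q * z ^+ 2) in
  let d1 := x * (- 3%:R * x0 ^+ 2 - p) + y * (2%:R * y0)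
     + z * (y0 ^+ 2 - 2%:R * p * x0 - 3%:R * q) in
  vec (d2 * x0 - d1 * x) (d2 * y0 - d1 * y) (d2 - d1 * z).
Proof. by rewrite /residual /polar /grad_at !vecE !vecZ vecN vecD mulr1. Qed.

Lemma residualZ k v : residual (k *: v) = k ^+ 2 *: residual v.
Proof.
elim/(@vecP K): v => x y z; rewrite vecZ !residualE /= vecZ; congr vec; ring.
Qed.

Lemma residual'Z k v : residual' (k *: v) = k ^+ 7 *: residual' v.
Proof.
elim/(@vecP K): v => x y z; rewrite /residual' /slope_num /slope_den !vecZ !vecE.
by congr vec; ring.
Qed.

Lemma residual_P0 : residual P0 = 0.
Proof. by apply/eqP; rewrite residualE vec_eq0 /= /q; apply/and3P; split; apply/eqP; ring. Qed.

Lemma residual_residual v : residual (residual v) = - grad_at v ^+ 3 *: v.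
Proof.
elim/(@vecP K): v => x y z; rewrite /grad_at [residual (vec x y z)]residualE /= residualE.
by rewrite !vecE vecZ /q; congr vec; ring.
Qed.

Lemma on_residual v : ev E v = 0 -> ev E (residual v) = 0.
Proof.
elim/(@vecP K): v => x y z; rewrite residualE /= !ev_weier_form => e.
apply: (lincomb1 e (- (x * (- 3%:R * x0 ^+ 2 - p) + y * (2%:R * y0)
     + z * (y0 ^+ 2 - 2%:R * p * x0 - 3%:R * q)) ^+ 3)).
by rewrite /weier /q; ring.
Qed.

Lemma P0_neq0 : P0 != 0.
Proof. by rewrite vec_eq0 oner_eq0 !andbF. Qed.

Lemma on_P0 : ev E P0 = 0.
Proof. by rewrite ev_weier_form /weier /q; ring. Qed.

(** If v is not a multiple of P0, both middle coefficients of the form on the line through P0 and v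
    vanish, and the curve contains that line. *)
Lemma residual_eq0 v : on_curve E v -> residual v = 0 -> exists k, v = k *: P0.
Proof.
move=> [v0 ve] r0; have [c0 | c0] := eqVneq (cross P0 v) 0.
  exact: cross_eq0 P0_neq0 c0.
have d1 : grad_at v = 0.
  have := residual_residual v; rewrite r0 -(scale0r 0) residualZ expr0n scale0r.
  move/esym/eqP; rewrite scaler_eq0 (negPf v0) orbF oppr_eq0 expf_eq0 /=.
  by move/eqP.
have d2 : polar v = 0.
  move: r0; rewrite /residual d1 scale0r subr0 => /eqP.
  by rewrite scaler_eq0 (negPf P0_neq0) orbF => /eqP.
case: (lineless_line lE c0) => s t.
have -> : ev E (s *: P0 + t *: v) = s ^+ 3 * ev E P0 + s ^+ 2 * t * grad_at v
    + s * t ^+ 2 * polar v + t ^+ 3 * ev E v.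
  elim/(@vecP K): v {v0 ve r0 c0 d1 d2} => x y z.
  rewrite /polar /grad_at !vecZ vecD !ev_weier_form !vecE /weier; ring.
by rewrite on_P0 d1 d2 (ve : ev E v = 0); ring.
Qed.

Lemma residual'_P0 : residual' P0 = let m := 3%:R * x0 ^+ 2 + p in let n := 2%:R * y0 in
  vec (n * (m ^+ 2 - 2%:R * x0 * n ^+ 2))
      (y0 * n ^+ 3 + m * (m ^+ 2 - 3%:R * x0 * n ^+ 2)) (n ^+ 3).
Proof.
by rewrite /residual' /slope_num /slope_den !vecE; congr vec; ring.
Qed.

Lemma residual'_P0_neq0 : residual' P0 != 0.
Proof.
rewrite residual'_P0 /= vec_eq0; apply/negP => /and3P [_ /eqP e2 /eqP e3].
have n0 : 2%:R * y0 = 0 by apply/eqP; rewrite -[_ == 0](expf_eq0 _ 3) e3.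
have y00 : y0 = 0 by apply: (mulfI (two_neq0 K)); rewrite n0 mulr0.
have m0 : 3%:R * x0 ^+ 2 + p = 0.
  apply/eqP; rewrite -[_ == 0](expf_eq0 _ 3); apply/eqP.
  by apply: (lincomb1 e2 1); rewrite y00; ring.
case: smE => _ /(_ P0); apply; apply/singular_atP; split.
- exact: P0_neq0.
- exact: on_P0.
- elim/(@vecP K) => x y z; rewrite dirder_cubic_of /=.
  by apply: (lincomb2 m0 y00 (- x + z * x0) (2%:R * y)); rewrite /q y00; ring.
Qed.

Lemma on_residual'_P0 : ev E (residual' P0) = 0.
Proof. by rewrite residual'_P0 /= ev_weier_form /weier /q; ring. Qed.

Lemma grad_residual'_P0 : grad_at (residual' P0) = 0.
Proof. by rewrite residual'_P0 /= /grad_at !vecE /q; ring. Qed.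

Lemma residual_line v : on_curve E v -> residual v != 0 -> residual' v != 0 ->
  <[residual v]>%VS = <[residual' v]>%VS.
Proof.
elim/(@vecP K): v => x y z ve r0 r0'.
have z0 : z != 0.
  apply: contraNneq r0' => ->; rewrite /residual' /slope_num /slope_den !vecE.
  by rewrite vec_eq0; apply/and3P; split; apply/eqP; ring.
have vE : vec x y z = z *: vec (x / z) (y / z) 1 by rewrite vecZ; congr vec; field.
move: ve r0 r0'; rewrite vE on_curve_scale // residualZ residual'Z.
rewrite !scaler_eq0 !expf_eq0 (negPf z0) !andbF /= !vlineZ ?expf_neq0 //.
move: (x / z) (y / z) => {z0 vE z}x {}y [_]; rewrite -/(ev _ _) ev_weier_form /weier => e.
(* If y = -y0, then also x = x0, since otherwise the slope numerator vanishes too and so does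
   [residual']. The line is vertical, with third point (0:1:0). *)
move=> r0 r0'; have [n0 | n0] := eqVneq (y + y0) 0.
  have yE : y = - y0 by apply: (lincomb1 n0 1); ring.
  have m0 : x ^+ 2 + x * x0 + x0 ^+ 2 + p != 0.
    apply: contraNneq r0' => m0; rewrite /residual' /slope_num /slope_den !vecE vec_eq0;
    apply/and3P; split; apply/eqP;
    by apply: (lincomb2 n0 m0 0 0); rewrite (_ : p = - (x ^+ 2 + x * x0 + x0 ^+ 2)) ?yE;
      [ring | apply: (lincomb1 m0 1); ring].
  have xE : x = x0.
    apply: (mulfI m0); apply: (lincomb2 e n0 (-1) (y - y0)); rewrite /q; ring.
  rewrite (_ : residual _ = (- 8%:R * y0 ^+ 3) *: vec 0 1 0) in r0 *; last first.
    by rewrite residualE vecZ xE yE /q; congr vec; ring.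
  rewrite (_ : residual' _ = (3%:R * x0 ^+ 2 + p) ^+ 3 *: vec 0 1 0) in r0' *; last first.
    by rewrite /residual' /slope_num /slope_den !vecE vecZ xE yE; congr vec; ring.
  rewrite !vlineZ //.
    by apply: contraNneq r0' => ->; rewrite scale0r.
  by apply: contraNneq r0 => ->; rewrite scale0r.
have dx0 : x - x0 != 0.
  apply: contraNneq r0 => dx0; have xE : x = x0 by apply: (lincomb1 dx0 1); ring.
  have yE : y = y0.
    by apply: (mulfI n0); apply: (lincomb1 e 1); rewrite xE /q; ring.
  by rewrite residualE xE yE vec_eq0 /q; apply/and3P; split; apply/eqP; ring.
(* Eliminating p by the equations of both points makes the two expressions identically
   proportional. *)
have pE : p = (y ^+ 2 - y0 ^+ 2) / (x - x0) - (x ^+ 2 + x * x0 + x0 ^+ 2).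
  apply: (mulfI dx0); apply: (lincomb1 e (-1)); rewrite /q; field.
  by rewrite dx0.
have -> : residual' (vec x y 1) = ((y + y0) / (x - x0)) ^+ 3 *: residual (vec x y 1).
  rewrite residualE /residual' /slope_num /slope_den !vecE vecZ /q pE.
  by congr vec; field; rewrite dx0.
by rewrite vlineZ // expf_neq0 // mulf_neq0 // invr_eq0.
Qed.

(** Here v lies on the tangent at P0, so it is the third point of that tangent. *)
Lemma residual_tangent v : on_curve E v -> residual v != 0 -> grad_at v = 0 ->
  <[residual' P0]>%VS = <[v]>%VS.
Proof.
elim/(@vecP K): v => x y z [v0]; rewrite -/(ev _ _) ev_weier_form => e r0 g0.
have T0 := residual'_P0_neq0; rewrite residual'_P0 /= in T0 *.
have [z0 | z0] := eqVneq z 0.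
  have x00 : x = 0.
    apply/eqP; rewrite -[_ == 0](expf_eq0 _ 3); apply/eqP.
    by apply: (lincomb1 e (-1)); rewrite /weier z0; ring.
  have y1 : y != 0 by move: v0; rewrite vec_eq0 x00 z0 eqxx andbT.
  have y00 : y0 = 0.
    apply: (mulfI (mulf_neq0 (two_neq0 K) y1)); apply: (lincomb1 g0 1).
    by rewrite /grad_at !vecE x00 z0; ring.
  rewrite (_ : vec x y z = y *: vec 0 1 0); last by rewrite vecZ x00 z0; congr vec; ring.
  rewrite (_ : vec _ _ _ = (3%:R * x0 ^+ 2 + p) ^+ 3 *: vec 0 1 0) in T0 *; last first.
    by rewrite vecZ y00; congr vec; ring.
  by rewrite !vlineZ //; apply: contraNneq T0 => ->; rewrite scale0r.
have vE : vec x y z = z *: vec (x / z) (y / z) 1 by rewrite vecZ; congr vec; field.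
have {}e : weier p q (x / z) (y / z) 1 = 0.
  by apply: (lincomb1 e (z ^+ 3)^-1); rewrite /weier; field.
have {}g0 : (3%:R * x0 ^+ 2 + p) * (x / z - x0) = 2%:R * y0 * (y / z - y0).
  by apply: (lincomb1 g0 (- z^-1)); rewrite /grad_at !vecE /q; field.
move: r0; rewrite vE residualZ scaler_eq0 !expf_eq0 (negPf z0) andbF /= vlineZ //.
move: (x / z) (y / z) e g0 => {v0 z0 vE z}x {}y; rewrite /weier => e g0 r0.
have [dx0 | dx0] := eqVneq (x - x0) 0.
  have xE : x = x0 by apply: (lincomb1 dx0 1); ring.
  have /eqP : (y - y0) ^+ 2 = 0 by apply: (lincomb2 e g0 1 1); rewrite xE /q; ring.
  rewrite sqrf_eq0 subr_eq0 => /eqP yE.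
  by move: r0; rewrite xE yE residual_P0 eqxx.
have pE : p = 2%:R * y0 * (y - y0) / (x - x0) - 3%:R * x0 ^+ 2.
  by apply: (mulfI dx0); apply: (lincomb1 g0 1); field; rewrite dx0.
have sq : (y - y0) ^+ 2 = (x - x0) ^+ 2 * (x + 2%:R * x0).
  by apply: (lincomb2 e g0 1 1); rewrite /q; ring.
have TE : vec (2%:R * y0 * ((3%:R * x0 ^+ 2 + p) ^+ 2 - 2%:R * x0 * (2%:R * y0) ^+ 2))
    (y0 * (2%:R * y0) ^+ 3 + (3%:R * x0 ^+ 2 + p) *
       ((3%:R * x0 ^+ 2 + p) ^+ 2 - 3%:R * x0 * (2%:R * y0) ^+ 2)) ((2%:R * y0) ^+ 3)
    = (2%:R * y0) ^+ 3 *: vec x y 1.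
  rewrite vecZ pE; congr vec; last by ring.
    by apply: (lincomb1 sq ((2%:R * y0) ^+ 3 / (x - x0) ^+ 2)); field; rewrite dx0.
  apply: (lincomb1 sq ((2%:R * y0) ^+ 3 * (y - y0) / (x - x0) ^+ 3)); field.
  by rewrite dx0.
by move: T0; rewrite TE scaler_eq0 negb_or => /andP [n0 _]; rewrite vlineZ.
Qed.

Lemma residual_map_line v : on_curve E v -> residual' v != 0 ->
  <[residual_map v]>%VS = <[residual' v]>%VS.
Proof. by rewrite /residual_map => ve; case: ifP => // r0 r0'; apply: residual_line. Qed.

Lemma residual'_base v : on_curve E v -> residual v = 0 ->
  exists2 k, k != 0 & residual' v = k *: residual' P0.
Proof.
move=> ve /(residual_eq0 ve) [k kE]; exists (k ^+ 7); last by rewrite kE residual'Z.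
by rewrite expf_neq0 //; apply: contraNneq ve.1 => k0; rewrite kE k0 scale0r.
Qed.

Lemma on_curve_residual'_P0 : on_curve E (residual' P0).
Proof. by split; [exact: residual'_P0_neq0 | exact: on_residual'_P0]. Qed.

Lemma on_residual_map v : on_curve E v -> on_curve E (residual_map v).
Proof.
move=> ve; rewrite /residual_map; case: eqVneq => [r0 | r0] /=.
  have [k k0 ->] := residual'_base ve r0.
  by rewrite on_curve_scale //; apply: on_curve_residual'_P0.
by split=> //; apply: on_residual; case: ve.
Qed.

Lemma residual_map_scale k v : k != 0 -> <[residual_map (k *: v)]>%VS = <[residual_map v]>%VS.
Proof.
move=> k0; rewrite /residual_map residualZ scaler_eq0 expf_eq0 (negPf k0) andbF /=.
by case: ifP => _; rewrite ?residual'Z vlineZ // expf_neq0.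
Qed.

Lemma residual_map_P0 : residual_map P0 = residual' P0.
Proof. by rewrite /residual_map residual_P0 eqxx. Qed.

Lemma residual_map_residual'_P0 : <[residual_map (residual' P0)]>%VS = <[P0]>%VS.
Proof.
rewrite /residual_map; case: eqVneq => [r0 | r0] /=; last first.
  move: r0; rewrite /residual grad_residual'_P0 scale0r subr0 scaler_eq0 negb_or.
  by case/andP => h _; rewrite vlineZ.
have [c cE] := residual_eq0 on_curve_residual'_P0 r0.
have c0 : c != 0.
  by apply: contraNneq residual'_P0_neq0 => c0; rewrite cE c0 scale0r.
by rewrite {1}cE residual'Z vlineZ ?expf_neq0 // cE vlineZ.
Qed.

Lemma residual_map_involutive v : on_curve E v ->
  <[residual_map (residual_map v)]>%VS = <[v]>%VS.
Proof.
move=> ve; have [r0 | r0] := eqVneq (residual v) 0.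
  have [k kE] := residual_eq0 ve r0.
  have k0 : k != 0 by apply: contraNneq ve.1 => k0; rewrite kE k0 scale0r.
  have -> : residual_map v = residual' v by rewrite /residual_map r0 eqxx.
  rewrite kE residual'Z residual_map_scale ?expf_neq0 //.
  by rewrite residual_map_residual'_P0 vlineZ.
have -> : residual_map v = residual v by rewrite /residual_map r0.
have [g0 | g0] := eqVneq (grad_at v) 0.
  have rE : residual v = polar v *: P0 by rewrite /residual g0 scale0r subr0.
  have d0 : polar v != 0 by apply: contraNneq r0 => e; rewrite rE e scale0r.
  by rewrite rE residual_map_scale // residual_map_P0; apply: residual_tangent.
have n0 : - grad_at v ^+ 3 != 0 by rewrite oppr_eq0 expf_neq0.
rewrite /residual_map residual_residual scaler_eq0 (negPf n0) (negPf ve.1) /=.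
by rewrite vlineZ.
Qed.

Lemma curve_map_residual : curve_map E E residual_map.
Proof.
have pc := @polyfun_const K; have px := @polyfun_coord K.
have pg : polyfun grad_at by rewrite /grad_at; do ?[apply: polyfun_add | apply: polyfun_mul].
have pd : polyfun polar.
  rewrite /polar; do ?[apply: polyfun_add | apply: polyfun_mul | apply: polyfun_opp
    | apply: polyfun_exp | apply: pc | apply: px].
split=> [v | v ve]; first exact: on_residual_map.
have [r0 | r0] := eqVneq (residual v) 0; last first.
  exists residual; split=> //.
  - move=> i; have [h hE] : polyfun (fun v => polar v * P0 0 i + - (grad_at v * v 0 i)).
      by do ?[apply: polyfun_add | apply: polyfun_opp | apply: polyfun_mul].
    by exists h => w; rewrite -hE !mxE.
  - by exists 2%N => k w; rewrite residualZ.
  - by move=> w _ w0; rewrite /residual_map w0.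
exists residual'; split.
- have pm : polyfun slope_num.
    by rewrite /slope_num; do ?[apply: polyfun_add | apply: polyfun_mul | apply: polyfun_exp].
  have pn : polyfun slope_den.
    by rewrite /slope_den; do ?[apply: polyfun_add | apply: polyfun_mul].
  by apply: polyvec_vec; do ?[apply: polyfun_add | apply: polyfun_mul
    | apply: polyfun_opp | apply: polyfun_exp].
- by exists 7%N => k w; rewrite residual'Z.
- have [k k0 ->] := residual'_base ve r0.
  by rewrite scaler_eq0 negb_or k0 residual'_P0_neq0.
- by move=> w we; apply: residual_map_line.
Qed.

Lemma residual_inverse : inverse_maps E E residual_map residual_map.
Proof. by split; try exact: curve_map_residual; apply: residual_map_involutive. Qed.

Lemma residual_opposite : <[residual_map (vec x0 (- y0) 1)]>%VS = <[vec 0 1 0 : 'rV[K]_3]>%VS.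
Proof.
have [y00 | y00] := eqVneq y0 0.
  have -> : vec x0 (- y0) 1 = P0 by rewrite /P0 y00 oppr0.
  have T0 := residual'_P0_neq0; rewrite residual_map_P0.
  rewrite (_ : residual' P0 = (3%:R * x0 ^+ 2 + p) ^+ 3 *: vec 0 1 0) in T0 *; last first.
    by rewrite residual'_P0 vecZ y00; congr vec; ring.
  by rewrite vlineZ //; apply: contraNneq T0 => ->; rewrite scale0r.
have rE : residual (vec x0 (- y0) 1) = (- 8%:R * y0 ^+ 3) *: vec 0 1 0.
  by rewrite residualE vecZ /q; congr vec; ring.
have n0 : - 8%:R * y0 ^+ 3 != 0 by rewrite mulf_neq0 ?expf_neq0 // oppr_eq0 pnatr_eq0.
rewrite /residual_map rE scaler_eq0 (negPf n0) vec_eq0 oner_eq0 andbF /=.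
by rewrite vlineZ.
Qed.

End Residual.

(** * Two smooth cubics that are not isomorphic *)

Section NonIsotrivial.
Variable K : numClosedFieldType.
Implicit Types (f g : cubic_form K) (u v w : 'rV[K]_3) (A B : 'M[K]_3).
Implicit Types (V : {vspace cubic_form K}).

Lemma on_curve_affine (p q x y : K) :
  on_curve (weier_form p q) (vec x y 1) <-> y ^+ 2 = (weier_poly p q).[x].
Proof.
rewrite /on_curve -/(ev _ _) ev_weier_form horner_weier_poly /weier vec_eq0 oner_eq0 !andbF.
by split=> [[_ e] | e]; [| split=> //]; apply: (lincomb1 e 1); ring.
Qed.

Lemma on_curve_infinity (p q : K) : on_curve (weier_form p q) (vec 0 1 0).
Proof.
split; first by rewrite vec_eq0 oner_eq0 andbF.
by rewrite -/(ev _ _) ev_weier_form /weier; ring.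
Qed.

Lemma curve_infinity (p q : K) v : on_curve (weier_form p q) v -> v 0 i2 = 0 ->
  <[v]>%VS = <[vec 0 1 0]>%VS.
Proof.
elim/(@vecP K): v => x y z [v0]; rewrite -/(ev _ _) ev_weier_form vec2 => e z0.
have x0 : x = 0.
  apply/eqP; rewrite -[_ == 0](expf_eq0 _ 3); apply/eqP.
  by apply: (lincomb1 e (-1)); rewrite z0 /weier; ring.
rewrite x0 z0 (_ : vec _ _ _ = y *: vec 0 1 0); last by rewrite vecZ; congr vec; ring.
by rewrite vlineZ //; move: v0; rewrite vec_eq0 x0 z0 eqxx andbT.
Qed.

Lemma curve_affine v : v 0 i2 != 0 -> exists k, k != 0 /\
  v = k *: vec (v 0 i0 / v 0 i2) (v 0 i1 / v 0 i2) 1.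
Proof.
elim/(@vecP K): v => x y z; rewrite !vecE => z0; exists z; split=> //.
by rewrite vecZ; congr vec; field.
Qed.

Lemma smooth_weier_form (p q : K) : 4%:R * p ^+ 3 + 27%:R * q ^+ 2 != 0 -> smooth (weier_form p q).
Proof.
move=> D; split.
  apply/eqP => /(congr1 (fun f => ev f (vec 1 0 0))); rewrite ev0 ev_weier_form /weier => e.
  have /eqP : 1 = 0 :> K by apply: (lincomb1 e (-1)); ring.
  by rewrite oner_eq0.
move=> v /singular_atP; elim/(@vecP K): v => x y z [v0].
rewrite ev_weier_form => e d.
have := d (vec 1 0 0); have := d (vec 0 1 0); have := d (vec 0 0 1).
rewrite !dirder_cubic_of /= => e3 e2 e1.
have [z0 | z0] := eqVneq z 0.
  have x0 : x = 0.
    apply/eqP; rewrite -[_ == 0](expf_eq0 _ 3); apply/eqP.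
    by apply: (lincomb1 e (-1)); rewrite z0 /weier; ring.
  have /eqP : y ^+ 2 = 0 by apply: (lincomb1 e3 1); rewrite z0 x0; ring.
  by rewrite sqrf_eq0 => y0; move: v0; rewrite vec_eq0 x0 z0 y0 !eqxx.
have y0 : y = 0.
  by apply: (mulfI (mulf_neq0 (two_neq0 K) z0)); apply: (lincomb1 e2 1); ring.
have h1 : 2%:R * p * x + 3%:R * q * z = 0.
  by apply: (mulfI z0); apply: (lincomb2 e3 y0 (-1) y); ring.
have h2 : 3%:R * x ^+ 2 + p * z ^+ 2 = 0 by apply: (lincomb1 e1 (-1)); ring.
case/eqP: D; apply: (mulIf (expf_neq0 2 z0)).
by apply: (lincomb2 h1 h2 (3%:R * (3%:R * q * z - 2%:R * p * x)) (4%:R * p ^+ 2)); ring.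
Qed.

Lemma affine_regular (p q p' q' : K) Phi :
  curve_map (weier_form p q) (weier_form p' q') Phi ->
  (forall x y, y ^+ 2 = (weier_poly p q).[x] -> Phi (vec x y 1) 0 i2 != 0) ->
  forall i, regular (weier_poly p q)
    (fun x y => Phi (vec x y 1) 0 i / Phi (vec x y 1) 0 i2).
Proof.
move=> [m l] n0 i; apply: regular_local.
move=> x0 y0 e0; have c0 := (on_curve_affine p q x0 y0).2 e0.
have [H [pH _ H0 HE]] := l _ c0.
exists (fun x y => H (vec x y 1) 0 i2), (fun x y => H (vec x y 1) 0 i).
have rH j : regular (weier_poly p q) (fun x y => H (vec x y 1) 0 j).
  have [h hE] := pH j; apply: regular_ext (regular_mpoly (weier_poly p q) h) => x y _.
  by rewrite hE.
split=> //.
  have [k k0 kE] := vline_eqP (m _ c0).1 (HE _ c0 H0).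
  by apply: contraNneq (n0 _ _ e0) => h0; rewrite kE mxE h0 mulr0.
move=> x y e; have c := (on_curve_affine p q x y).2 e.
have [-> | Hn] := eqVneq (H (vec x y 1)) 0; first by rewrite !mxE mul0r.
have [k k0 kE] := vline_eqP (m _ c).1 (HE _ c Hn).
have := n0 _ _ e; rewrite kE mxE mulf_eq0 negb_or => /andP [_ h2].
by rewrite ![(k *: (_ : 'rV_3)) 0 _]mxE; field; rewrite k0 h2.
Qed.

(** An affine point sent to infinity would have the same image as (0:1:0), against injectivity. *)
Lemma affine_points (p q p' q' : K) Phi Psi :
  inverse_maps (weier_form p q) (weier_form p' q') Phi Psi ->
  <[Phi (vec 0 1 0)]>%VS = <[vec 0 1 0 : 'rV[K]_3]>%VS ->
  forall x y, y ^+ 2 = (weier_poly p q).[x] -> Phi (vec x y 1) 0 i2 != 0.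
Proof.
move=> [m1 m2 e1 e2] hO x y /on_curve_affine c; apply/eqP => z0.
have c' := m1.1 _ c; have cO := on_curve_infinity p q.
have h : <[Phi (vec x y 1)]>%VS = <[Phi (vec 0 1 0)]>%VS.
  by rewrite hO; apply: curve_infinity c' z0.
have := curve_map_line m2 (m1.1 _ cO) h c'.1; rewrite !e1 //.
case/(vline_eqP c.1) => k _; rewrite vecZ => /vec_inj [_ _ /eqP].
by rewrite mulr0 oner_eq0.
Qed.

Lemma inverse_at_infinity (p q p' q' : K) Phi Psi :
  inverse_maps (weier_form p q) (weier_form p' q') Phi Psi ->
  <[Phi (vec 0 1 0)]>%VS = <[vec 0 1 0 : 'rV[K]_3]>%VS ->
  <[Psi (vec 0 1 0)]>%VS = <[vec 0 1 0 : 'rV[K]_3]>%VS.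
Proof.
move=> [m1 m2 e1 e2] hO; have cO := on_curve_infinity p q.
have cO' := on_curve_infinity p' q'.
by rewrite -(curve_map_line m2 cO' hO (m1.1 _ cO).1) e1.
Qed.

Lemma normalize_at_infinity (p q p' q' : K) Phi Psi : smooth (weier_form p' q') ->
  inverse_maps (weier_form p q) (weier_form p' q') Phi Psi ->
  exists Phi' Psi', inverse_maps (weier_form p q) (weier_form p' q') Phi' Psi' /\
    <[Phi' (vec 0 1 0)]>%VS = <[vec 0 1 0 : 'rV[K]_3]>%VS.
Proof.
move=> sE hm; have [m1 _ _ _] := hm; have cO := on_curve_infinity p q.
have cQ := m1.1 _ cO; pose Q := Phi (vec 0 1 0).
have [z0 | z0] := eqVneq (Q 0 i2) 0.
  by exists Phi, Psi; split=> //; apply: curve_infinity cQ z0.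
(* A smooth cubic is a member of some special pencil, hence irreducible. *)
have lE : lineless (weier_form p' q').
  have [V [[_ _ _ irr] mV]] := smooth_in_special sE.
  exact: irreducible_lineless (irr _ mV).
have [k [k0 QE]] := curve_affine z0.
move: (Q 0 i0 / Q 0 i2) (Q 0 i1 / Q 0 i2) QE => x y QE.
have e : y ^+ 2 = x ^+ 3 + p' * x + q'.
  rewrite -horner_weier_poly; apply/on_curve_affine.
  by rewrite -(on_curve_scale _ _ k0) -QE.
have qE : q' = (- y) ^+ 2 - x ^+ 3 - p' * x by apply: (lincomb1 e (-1)); ring.
(* The line through Q = (x, y) and (x, -y) is vertical, so the involution based at (x, -y) sends Q
   to infinity. *)
have hr : inverse_maps (weier_form p' q') (weier_form p' q')
    (residual_map p' x (- y)) (residual_map p' x (- y)).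
  by rewrite qE; apply: residual_inverse; rewrite -qE.
exists (residual_map p' x (- y) \o Phi), (Psi \o residual_map p' x (- y)); split.
  exact: inverse_maps_comp hm hr.
rewrite /= -/Q QE residual_map_scale // -{2}[y]opprK.
by apply: residual_opposite; rewrite -qE.
Qed.

Lemma weier_forms_not_isomorphic Phi Psi :
  ~ inverse_maps (weier_form (0 : K) 1) (weier_form (-1) 0) Phi Psi.
Proof.
have s2 : smooth (weier_form (-1 : K) 0).
  apply: smooth_weier_form; rewrite (_ : _ + _ = - 4%:R) ?oppr_eq0 ?pnatr_eq0 //.
  by ring.
move/(normalize_at_infinity s2) => {Phi Psi} [Phi [Psi [hm hO]]].
have hO' := inverse_at_infinity hm hO.
have a1 := affine_points hm hO; have a2 := affine_points (inverse_maps_sym hm) hO'.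
have [m1 m2 e1 e2] := hm.
pose X x y := Phi (vec x y 1) 0 i0 / Phi (vec x y 1) 0 i2.
pose Y x y := Phi (vec x y 1) 0 i1 / Phi (vec x y 1) 0 i2.
have [A [B AB]] := affine_regular m2 a2 i0.
have XY x y : y ^+ 2 = (weier_poly 0 1).[x] -> on_curve (weier_form (-1) 0) (vec (X x y) (Y x y) 1)
    /\ <[vec (X x y) (Y x y) 1]>%VS = <[Phi (vec x y 1)]>%VS.
  move=> e; have [k [k0 kE]] := curve_affine (a1 _ _ e).
  rewrite -/(X x y) -/(Y x y) in kE; rewrite kE vlineZ //; split=> //.
  rewrite -(on_curve_scale _ _ k0) -kE; apply: m1.1.
  exact/on_curve_affine.
apply: (@no_affine_iso K X Y A B).
- exact: affine_regular m1 a1 i0.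
- exact: affine_regular m1 a1 i1.
- by move=> x y /XY [/on_curve_affine].
move=> x y e; have [c l] := XY x y e; have c1 := (on_curve_affine _ _ _ _).2 e.
rewrite -AB; last exact/on_curve_affine.
have := curve_map_line m2 (m1.1 _ c1) l c.1; rewrite e1 //.
case/(vline_eqP (m2.1 _ c).1) => k k0 ->.
by rewrite vecZ !vecE mulr1 mulrC mulKf.
Qed.

Lemma special_not_isotrivial V : special_pencil V -> ~ isotrivial V.
Proof.
move=> sV iso; have [A hA] := special_std sV; have [uA hV] := hA.
have model f : smooth f -> exists B, B \in unitmx /\ member V (csub B f).
  move=> sf; have [t [B [uB e]]] := special_form sf.
  exists (invmx A *m B); rewrite unitmx_mul unitmx_inv uA; split=> //.
  rewrite -csubM e; split; first by rewrite (mem_csubV _ hA) cubicW_std.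
  by rewrite csub_eq0 ?unitmx_inv // cubicW_neq0.
have s1 : smooth (weier_form (0 : K) 1).
  apply: smooth_weier_form; rewrite (_ : _ + _ = 27%:R) ?pnatr_eq0 //; ring.
have s2 : smooth (weier_form (-1 : K) 0).
  apply: smooth_weier_form; rewrite (_ : _ + _ = - 4%:R) ?oppr_eq0 ?pnatr_eq0 //.
  by ring.
have [B1 [u1 m1]] := model _ s1; have [B2 [u2 m2]] := model _ s2.
have := iso _ _ m1 m2 ((smooth_csub _ u1).2 s1) ((smooth_csub _ u2).2 s2).
case/isomorphic_inverse_maps => Phi [Psi h].
have h1 := inverse_maps_sym (inverse_maps_linear (weier_form 0 1) u1).
have h2 := inverse_maps_linear (weier_form (-1) 0) u2.
exact: weier_forms_not_isomorphic (inverse_maps_comp (inverse_maps_comp h1 h) h2).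
Qed.

End NonIsotrivial.

Theorem theorem1p3 (R : realType) :
  (forall f : cubic_form R[i], smooth f ->
     exists V : {vspace cubic_form R[i]}, special_pencil V /\ member V f) /\
  (forall V W : {vspace cubic_form R[i]},
     special_pencil V -> special_pencil W -> projectively_equivalent V W) /\
  (forall V : {vspace cubic_form R[i]}, special_pencil V ->
     [/\ exactly_singular_members 4 V,
         forall f, member V f -> singular f -> nodal_cubic f
       & ~ isotrivial V]).
Proof.
split; first exact: smooth_in_special.
split=> [V W /special_std [A hA] /special_std [B hB] | V sV].
  exact: std_equivalent hA hB.
have [A hA] := special_std sV; split.
- exact: std_exactly_four hA.
- by move=> f; apply: std_nodal hA.
- exact: special_not_isotrivial.
Qed.
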